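(* Let $((F,\nu,N),[\,,]_{F,h},(\rho,\eta))$ be a generalized Lie algebroid and let $(E,\pi,M)$ be an interior differential system of it. Then $(E,\pi,M)$ is involutive if and only if for any $(U,\xi_U)\in[\mathcal A_M]$ the ideal generated by the submodule $\Gamma(E^{0}_{\mid U},\pi^{0},U)$ (in the exterior algebra of forms on $h^{*}F_{\mid U}$) is an exterior differential system of the same generalized Lie algebroid.
   Context: Generalized Lie algebroids. Manifolds are smooth and $\mathcal F(N)$ is the ring of smooth real functions on $N$. Let $(F,\nu,N)$ be a vector bundle of rank $p$, $\eta:N\to M$ and $h:M\to N$ diffeomorphisms, and $(\rho,\eta)$ a vector bundle morphism from $(F,\nu,N)$ to $(TM,\tau_M,M)$. Let $\theta=\Gamma(Th\circ\rho,h\circ\eta):\Gamma(F,\nu,N)\to\Gamma(TN,\tau_N,N)$ be the induced $\mathcal F(N)$-module morphism, given in a local frame $(t_\alpha)$ of $F$ over $V\subseteq N$ and local coordinates $(x^i)$ on $U\subseteq h^{-1}(V)\subseteq M$ by $$\theta(z^\alpha t_\alpha)(f)=z^\alpha\rho^i_\alpha\Big(\frac{\partial (f\circ h)}{\partial x^i}\circ h^{-1}\Big),$$ where the $\rho^i_\alpha$ are the local component functions of $\rho$ (regarded as functions on $N$). It is a generalized Lie algebroid if there is a biadditive operation $[\,,]_{F,h}$ on $\Gamma(F,\nu,N)$ with $[u,u]_{F,h}=0$, the Jacobi identity, and $[u,fv]_{F,h}=f[u,v]_{F,h}+\theta(u)(f)\,v$ for $f\in\mathcal F(N)$. Locally $[t_\alpha,t_\beta]_{F,h}=L^\gamma_{\alpha\beta}t_\gamma$.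 Pull-back Lie algebroid. On the pull-back bundle $(h^*F,h^*\nu,M)$, with local frame $T_\alpha=t_\alpha\circ h$, one has the Lie algebroid structure over $M$ with anchor $\hat\rho: Z^\alpha T_\alpha\mapsto Z^\alpha(\rho^i_\alpha\circ h)\frac{\partial}{\partial x^i}$ and bracket $[\,,]_{h^*F}$ determined by $[T_\alpha,fT_\beta]_{h^*F}=f(L^\gamma_{\alpha\beta}\circ h)T_\gamma+(\rho^i_\alpha\circ h)\frac{\partial f}{\partial x^i}T_\beta$ and $[fT_\alpha,T_\beta]_{h^*F}=-[T_\beta,fT_\alpha]_{h^*F}$. Forms on $h^*F$ (alternating, function-multilinear maps on sections) carry the usual exterior product $\wedge$ and the differential $$d^{h^*F}\omega(Z_0,\dots,Z_q)=\sum_{i=0}^q(-1)^i\hat\rho(Z_i)\big(\omega(Z_0,\dots,\hat Z_i,\dots,Z_q)\big)+\sum_{i<j}(-1)^{i+j}\omega([Z_i,Z_j]_{h^*F},Z_0,\dots,\hat Z_i,\dots,\hat Z_j,\dots,Z_q).$$ $[\mathcal A_M]$ is the differentiable structure (set of charts $(U,\xi_U)$) of $M$, chosen so that each chart domain $U$ is also the domain of a local bundle chart. An interior differential system (IDS) of the generalized Lie algebroid is a vector subbundle $(E,\pi,M)$ of $(h^*F,h^*\nu,M)$. Its annihilator $(E^0,\pi^0,M)$ is the vector subbundle of the dual bundle of $h^*F$ with $\Gamma(E^0,\pi^0,M)=\{\Omega\mid\Omega(S)=0\ \forall S\in\Gamma(E,\pi,M)\}$. The IDS is involutive if $[S,T]_{h^*F}\in\Gamma(E,\pi,M)$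 for all $S,T\in\Gamma(E,\pi,M)$. A differential ideal of the generalized Lie algebroid is an ideal $\mathcal I$ of the exterior algebra of the pull-back Lie algebroid with $d^{h^*F}\mathcal I\subseteq\mathcal I$. It is an exterior differential system (EDS) if there exists an IDS $(E',\pi',M)$ such that for all $k\ge1$ and every $k$-form $\omega\in\mathcal I$, $\omega(u_1,\dots,u_k)=0$ for all sections $u_1,\dots,u_k$ of $E'$. For an ideal of forms over a chart domain $U$ these definitions are applied with all objects restricted to $U$. *)

(* Defs.v *)
From HB Require Import structures.
From mathcomp Require Import all_boot all_order all_algebra.
From mathcomp Require Import all_classical all_reals all_analysis.
Import Order.TTheory GRing.Theory Num.Theory.
Import numFieldNormedType.Exports.
Set Implicit Arguments.
Unset Strict Implicit.
Unset Printing Implicit Defensive.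
Local Open Scope classical_set_scope.
Local Open Scope ring_scope.

(* Smooth functions on open subsets of R^m *)

Fixpoint Ck (R : realType) (m k : nat) (W : set 'rV[R]_m)
    (f : 'rV[R]_m -> R) : Prop :=
  (forall v, W v -> {for v, continuous f}) /\
  (if k is k'.+1 then
     forall i : 'I_m,
       (forall v, W v -> derivable f v (delta_mx 0 i)) /\
       Ck k' W (fun v => 'D_(delta_mx 0 i) f v)
   else True).

Definition Cinf (R : realType) (m : nat) (W : set 'rV[R]_m)
  (f : 'rV[R]_m -> R) : Prop := forall k, Ck k W f.

(* Manifolds *)

(* Only the values of [cmap] on [cdom] and of [cinv] on the image of [cdom]
   are meaningful. *)
Record chart (R : realType) (m : nat) (X : topologicalType) := Chart {
  cdom : set X;
  cmap : X -> 'rV[R]_m;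
  cinv : 'rV[R]_m -> X;
  cdom_open : open cdom;
  cimg_open : open (cmap @` cdom);
  cmapK : forall x, cdom x -> cinv (cmap x) = x;
  cmap_cont : forall x, cdom x -> {for x, continuous cmap};
  cinv_cont : forall v, (cmap @` cdom) v -> {for v, continuous cinv} }.

Definition smooth_transition (R : realType) (m : nat) (X : topologicalType)
    (c c' : chart R m X) : Prop :=
  forall i, Cinf (cmap c @` (cdom c `&` cdom c'))
                 (fun v => cmap c' (cinv c v) 0 i).

Record manifold (R : realType) (m : nat) := Manifold {
  points :> topologicalType;
  atlas : set (chart R m points);
  points_hausdorff : hausdorff_space points;
  points_second_countable : @second_countable points;
  atlas_cover : forall x : points, exists2 c, atlas c & cdom c x;
  atlas_compat : forall c c', atlas c -> atlas c' -> smooth_transition c c';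
  atlas_maximal : forall c,
    (forall c', atlas c' -> smooth_transition c c' /\ smooth_transition c' c) ->
    atlas c }.

(* For [U] open. *)
Definition smooth_on (R : realType) (m : nat) (M : manifold R m)
    (U : set M) (f : M -> R) : Prop :=
  forall c, atlas c -> Cinf (cmap c @` (U `&` cdom c)) (f \o cinv c).

Definition smooth_at (R : realType) (m : nat) (M : manifold R m)
    (x : M) (f : M -> R) : Prop :=
  exists U : set M, [/\ open U, U x & smooth_on U f].

Definition smooth_map (R : realType) (m n : nat) (M : manifold R m)
    (N : manifold R n) (g : M -> N) : Prop :=
  continuous g /\
  forall c d i, atlas c -> atlas d ->
    Cinf (cmap c @` (cdom c `&` g @^-1` cdom d))
         (fun v => cmap d (g (cinv c v)) 0 i).

Definition diffeo (R : realType) (m n : nat) (M : manifold R m)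
    (N : manifold R n) (g : M -> N) (g' : N -> M) : Prop :=
  [/\ cancel g g', cancel g' g, smooth_map g & smooth_map g'].

(* A function on the open set [U] is represented by its extension by zero, so
   that equality of functions on [U] is Leibniz equality; likewise for sections
   and forms below. *)
Definition funs (R : realType) (m : nat) (M : manifold R m) (U : set M) :
    set (M -> R) :=
  [set f | smooth_on U f /\ forall x, ~ U x -> f x = 0].

(* Tangent vectors at [x] are the derivations at [x] of the algebra of germs of
   smooth functions, extended by zero to the functions that are not smooth near
   [x]. *)
Definition tangent_vector (R : realType) (m : nat) (M : manifold R m) (x : M)
    (D : (M -> R) -> R) : Prop :=
  [/\ forall f, ~ smooth_at x f -> D f = 0,
      forall f g, smooth_at x f -> smooth_at x g ->
        (\forall y \near x, f y = g y) -> D f = D g,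
      forall f g, smooth_at x f -> smooth_at x g ->
        D (fun y => f y + g y) = D f + D g,
      forall (a : R) f, smooth_at x f -> D (fun y => a * f y) = a * D f &
      forall f g, smooth_at x f -> smooth_at x g ->
        D (fun y => f y * g y) = f x * D g + g x * D f].

(* Vector bundles *)

Record bchart (R : realType) (n p : nat) (N : manifold R n)
    (F : N -> lmodType R) := BChart {
  bdom : set N;
  bmap : forall y, F y -> 'rV[R]_p;
  binv : forall y, 'rV[R]_p -> F y;
  bdom_open : open bdom;
  bmap_linear : forall y, bdom y -> linear (@bmap y);
  bmapK : forall y, bdom y -> cancel (@bmap y) (@binv y);
  binvK : forall y, bdom y -> cancel (@binv y) (@bmap y) }.

(* The total space is the disjoint union of the fibres; its manifold structure
   is the one determined by the bundle charts. *)
Record vbundle (R : realType) (n : nat) (N : manifold R n) (p : nat) :=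
  VBundle {
  fibre :> N -> lmodType R;
  batlas : set (bchart p fibre);
  batlas_cover : forall y : N, exists2 c, batlas c & bdom c y;
  batlas_compat : forall c c' (v : 'rV[R]_p) i, batlas c -> batlas c' ->
    smooth_on (bdom c `&` bdom c') (fun y => bmap c' (binv c y v) 0 i) }.

(* A section over the open set [U] of the pull-back bundle g^*F, whose fibre at
   [x] is [F (g x)] and whose bundle charts are the pull-backs of those of [F];
   for [g := id] this is a section of [F]. *)
Definition sections (R : realType) (m n p : nat) (M : manifold R m)
    (N : manifold R n) (F : vbundle N p) (g : M -> N) (U : set M) :
    set (forall x : M, F (g x)) :=
  [set Z | (forall c i, batlas c ->
              smooth_on (U `&` g @^-1` bdom c)
                        (fun x => bmap c (Z x) 0 i)) /\
           (forall x, ~ U x -> Z x = 0)].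
Arguments sections {R m n p M N} F g U.

Definition lcomb (R : realType) (V : lmodType R) (r : nat) (e : 'I_r -> V)
    (a : 'rV[R]_r) : V := \sum_i a 0 i *: e i.

Definition is_basis (R : realType) (V : lmodType R) (S : set V) (r : nat)
    (e : 'I_r -> V) : Prop :=
  injective (lcomb e) /\ range (lcomb e) = S.

(* Generalized Lie algebroids *)

(* The induced morphism Gamma(Th o rho, h o eta): the vector field theta(z) is
   y |-> Th (rho (z y')) where h (eta y') = y. *)
Definition theta (R : realType) (m n p : nat) (M : manifold R m)
    (N : manifold R n) (F : vbundle N p) (h : M -> N)
    (hinv : N -> M) (etainv : M -> N)
    (rho : forall y, F y -> (M -> R) -> R)
    (z : forall y, F y) (f : N -> R) : N -> R :=
  fun y => let y' := etainv (hinv y) in rho y' (z y') (f \o h).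

Record gla (R : realType) (m n p : nat) (M : manifold R m) (N : manifold R n)
    (F : vbundle N p) := GLA {
  gh : M -> N;
  ghinv : N -> M;
  gh_diffeo : diffeo gh ghinv;
  geta : N -> M;
  getainv : M -> N;
  geta_diffeo : diffeo geta getainv;
  rho : forall y, F y -> (M -> R) -> R;
  rho_tangent : forall y (v : F y), tangent_vector (geta y) (rho v);
  rho_linear : forall y (a : R) (v w : F y) f, smooth_at (geta y) f ->
    rho (a *: v + w) f = a * rho v f + rho w f;
  rho_smooth : forall (V : set N) (W : set M) (z : forall y, F y) f,
    open V -> open W -> sections F id V z -> funs W f ->
    smooth_on (V `&` geta @^-1` W) (fun y => rho (z y) f);
  theta_linear : forall (f : N -> R) (z : forall y, F y) (g : N -> R),
    funs setT f -> sections F id setT z -> funs setT g ->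
    theta gh ghinv getainv rho (fun y => f y *: z y) g =
    (fun y => f y * theta gh ghinv getainv rho z g y);
  gbr : (forall y, F y) -> (forall y, F y) -> forall y, F y;
  gbr_section : forall u v, sections F id setT u -> sections F id setT v ->
    sections F id setT (gbr u v);
  gbr_addl : forall u u' v, sections F id setT u -> sections F id setT u' ->
    sections F id setT v ->
    gbr (fun y => u y + u' y) v = (fun y => gbr u v y + gbr u' v y);
  gbr_addr : forall u v v', sections F id setT u -> sections F id setT v ->
    sections F id setT v' ->
    gbr u (fun y => v y + v' y) = (fun y => gbr u v y + gbr u v' y);
  gbr_alt : forall u, sections F id setT u -> gbr u u = (fun y => 0);
  gbr_jacobi : forall u v w, sections F id setT u -> sections F id setT v ->
    sections F id setT w ->
    (fun y => gbr u (gbr v w) y + gbr v (gbr w u) y + gbr w (gbr u v) y) =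
    (fun y => 0);
  gbr_leibniz : forall u (f : N -> R) v, sections F id setT u ->
    funs setT f -> sections F id setT v ->
    gbr u (fun y => f y *: v y) =
    (fun y => f y *: gbr u v y + theta gh ghinv getainv rho u f y *: v y) }.

(* The pull-back Lie algebroid over an open set *)

Definition hsec (R : realType) (m n p : nat) (M : manifold R m)
    (N : manifold R n) (F : vbundle N p) (G : gla M F) : Type :=
  forall x : M, F (gh G x).

Definition hsections (R : realType) (m n p : nat) (M : manifold R m)
    (N : manifold R n) (F : vbundle N p) (G : gla M F) (U : set M) :
    set (hsec G) := sections F (gh G) U.
Arguments hsections {R m n p M N F} G U.

(* Z^alpha T_alpha |-> Z^alpha (rho^i_alpha o h) d/dx^i. By [theta_linear],
   [rho] vanishes on the fibre over h x unless eta (h x) = x, so this is a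
   tangent vector at [x]. *)
Definition rhohat (R : realType) (m n p : nat) (M : manifold R m)
    (N : manifold R n) (F : vbundle N p) (G : gla M F)
    (Z : hsec G) (f : M -> R) : M -> R := fun x => rho G (Z x) f.

(* The value at [x] of the bracket of Z = Z^a T_a and W = W^b T_b, T_a = t_a o h,
   as obtained from the rules for [T_a, f T_b] and [f T_a, T_b] and
   biadditivity:
     Z^a W^b (L^c_ab o h) T_c + Z^a rhohat(T_a)(W^b) T_b
       - W^b rhohat(T_b)(Z^a) T_a,
   where L^c_ab t_c = [t_a, t_b]. The local frame (t_a) is given by global
   sections of F that form a frame near h x. The set is a singleton when Z and W
   are smooth near [x]. *)
Definition hbracket_at (R : realType) (m n p : nat) (M : manifold R m)
    (N : manifold R n) (F : vbundle N p) (G : gla M F)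
    (Z W : hsec G) (x : M) : set (F (gh G x)) :=
  [set b | exists (t : 'I_p -> forall y, F y) (Zc Wc : 'I_p -> M -> R),
    [/\ forall a, sections F id setT (t a),
        \forall y \near gh G x, is_basis setT (fun a => t a y),
        forall a, smooth_at x (Zc a) /\ smooth_at x (Wc a),
        \forall y \near x, Z y = \sum_a Zc a y *: t a (gh G y) /\
                           W y = \sum_a Wc a y *: t a (gh G y) &
        b = \sum_a \sum_b
              ((Zc a x * Wc b x) *: gbr G (t a) (t b) (gh G x)
               + (Zc a x * rho G (t a (gh G x)) (Wc b)) *: t b (gh G x)
               - (Wc b x * rho G (t b (gh G x)) (Zc a)) *: t a (gh G x))]].
Arguments hbracket_at {R m n p M N F G} Z W x.

Definition hbracket (R : realType) (m n p : nat) (M : manifold R m)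
    (N : manifold R n) (F : vbundle N p) (G : gla M F) (U : set M)
    (Z W : hsec G) : hsec G :=
  fun x => if x \in U then xget 0 (hbracket_at Z W x) else 0.

(* Exterior algebra over an open set *)

(* An element of the exterior algebra is encoded as a function on finite
   sequences of sections: its component of degree q is its restriction to
   sequences of size q. All components of degree > p vanish automatically, so
   the direct product of the spaces of q-forms is their direct sum. The value
   is zero by convention when some argument is not a section over [U]. *)
Definition form (R : realType) (m n p : nat) (M : manifold R m)
    (N : manifold R n) (F : vbundle N p) (G : gla M F) : Type :=
  seq (hsec G) -> M -> R.

Definition all_sec (R : realType) (m n p : nat) (M : manifold R m)
    (N : manifold R n) (F : vbundle N p) (G : gla M F) (U : set M)
    (s : seq (hsec G)) : bool := all (fun Z => Z \in hsections G U) s.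

Definition exterior (R : realType) (m n p : nat) (M : manifold R m)
    (N : manifold R n) (F : vbundle N p) (G : gla M F) (U : set M) :
    set (form G) :=
  [set w |
   [/\ forall s, all_sec U s -> funs U (w s),
       forall s, ~~ all_sec U s -> w s = (fun x => 0),
       forall s1 s2 (Z W : hsec G), all_sec U (s1 ++ [:: Z, W & s2]) ->
         w (s1 ++ (fun x => Z x + W x) :: s2) =
         (fun x => w (s1 ++ Z :: s2) x + w (s1 ++ W :: s2) x),
       forall s1 s2 (f : M -> R) (Z : hsec G), funs U f ->
         all_sec U (s1 ++ Z :: s2) ->
         w (s1 ++ (fun x => f x *: Z x) :: s2) =
         (fun x => f x * w (s1 ++ Z :: s2) x) &
       forall s1 s2 s3 (Z : hsec G), all_sec U (s1 ++ Z :: s2 ++ Z :: s3) ->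
         w (s1 ++ Z :: s2 ++ Z :: s3) = (fun x => 0)]].

Definition homogeneous (R : realType) (m n p : nat) (M : manifold R m)
    (N : manifold R n) (F : vbundle N p) (G : gla M F) (k : nat)
    (w : form G) : Prop := forall s, size s != k -> w s = (fun x => 0).

Definition kforms (R : realType) (m n p : nat) (M : manifold R m)
    (N : manifold R n) (F : vbundle N p) (G : gla M F) (U : set M) (k : nat) :
    set (form G) := [set w | exterior U w /\ homogeneous k w].

(* Number of inversions of the shuffle that moves the entries selected by the
   mask [t] in front of the others. *)
Fixpoint shuffle_inv (t : bitseq) : nat :=
  if t is b :: t' then ((if b then 0 else count id t') + shuffle_inv t')%N
  else 0%N.

(* Sum over all (i, j)-shuffles with i + j = size s: a mask selects the
   arguments of [w1], the others are passed to [w2]. *)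
Definition wedge (R : realType) (m n p : nat) (M : manifold R m)
    (N : manifold R n) (F : vbundle N p) (G : gla M F) (w1 w2 : form G) :
    form G :=
  fun s x => \sum_(t : (size s).-tuple bool)
    (-1) ^+ shuffle_inv t * (w1 (mask t s) x * w2 (mask (map negb t) s) x).

Definition del (T : Type) (i : nat) (s : seq T) : seq T :=
  take i s ++ drop i.+1 s.

Definition hd (R : realType) (m n p : nat) (M : manifold R m)
    (N : manifold R n) (F : vbundle N p) (G : gla M F) (U : set M)
    (w : form G) : form G :=
  fun s x =>
    let Z i : hsec G := nth (fun=> 0) s i in
    if all_sec U s && (x \in U) then
      \sum_(i < size s) (-1) ^+ i * rhohat (Z i) (w (del i s)) x
      + \sum_(j < size s) \sum_(i < j)
          (-1) ^+ (i + j) *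
          w (hbracket U (Z i) (Z j) :: del i (del j s)) x
    else 0.

Definition ext_ideal (R : realType) (m n p : nat) (M : manifold R m)
    (N : manifold R n) (F : vbundle N p) (G : gla M F) (U : set M)
    (I : set (form G)) : Prop :=
  [/\ I `<=` exterior U,
      I (fun _ _ => 0),
      forall w1 w2, I w1 -> I w2 -> I (fun s x => w1 s x + w2 s x) &
      forall w1 w2, exterior U w1 -> I w2 ->
        I (wedge w1 w2) /\ I (wedge w2 w1)].

Definition ideal_generated (R : realType) (m n p : nat) (M : manifold R m)
    (N : manifold R n) (F : vbundle N p) (G : gla M F) (U : set M)
    (S : set (form G)) : set (form G) :=
  [set w | forall I, ext_ideal U I -> S `<=` I -> I w].

(* Interior and exterior differential systems *)

(* A vector subbundle of h^*F over the open set [U]; only the fibres over [U]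
   matter. *)
Definition is_IDS (R : realType) (m n p : nat) (M : manifold R m)
    (N : manifold R n) (F : vbundle N p) (G : gla M F) (U : set M)
    (E : forall x : M, set (F (gh G x))) : Prop :=
  exists r : nat, forall x, U x ->
    exists (W : set M) (e : 'I_r -> hsec G),
      [/\ open W, W x, W `<=` U, forall i, hsections G W (e i) &
          forall y, W y -> is_basis (E y) (fun i => e i y)].

Definition sub_sections (R : realType) (m n p : nat) (M : manifold R m)
    (N : manifold R n) (F : vbundle N p) (G : gla M F)
    (E : forall x : M, set (F (gh G x))) (U : set M) : set (hsec G) :=
  [set S | hsections G U S /\ forall x, U x -> E x (S x)].

Definition annihilator (R : realType) (m n p : nat) (M : manifold R m)
    (N : manifold R n) (F : vbundle N p) (G : gla M F)
    (E : forall x : M, set (F (gh G x))) (U : set M) : set (form G) :=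
  [set w | kforms U 1 w /\
           forall S, sub_sections E U S -> w [:: S] = (fun x => 0)].

Definition is_involutive (R : realType) (m n p : nat) (M : manifold R m)
    (N : manifold R n) (F : vbundle N p) (G : gla M F)
    (E : forall x : M, set (F (gh G x))) : Prop :=
  forall S T, sub_sections E setT S -> sub_sections E setT T ->
    sub_sections E setT (hbracket setT S T).

Definition differential_ideal (R : realType) (m n p : nat) (M : manifold R m)
    (N : manifold R n) (F : vbundle N p) (G : gla M F) (U : set M)
    (I : set (form G)) : Prop :=
  ext_ideal U I /\ forall w, I w -> I (hd U w).

Definition is_EDS (R : realType) (m n p : nat) (M : manifold R m)
    (N : manifold R n) (F : vbundle N p) (G : gla M F) (U : set M)
    (I : set (form G)) : Prop :=
  differential_ideal U I /\
  exists E' : forall x : M, set (F (gh G x)),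
    is_IDS U E' /\
    forall k w, (0 < k)%N -> I w -> kforms U k w ->
      forall s, size s = k -> (forall i, (i < k)%N ->
        sub_sections E' U (nth (fun=> 0) s i)) -> w s = (fun x => 0).

(* A set of charts of the differentiable structure of [M] that covers [M] and
   whose domains are domains of local bundle charts, i.e. of local frames, of
   h^*F. *)
Definition adapted_charts (R : realType) (m n p : nat) (M : manifold R m)
    (N : manifold R n) (F : vbundle N p) (G : gla M F)
    (A : set (chart R m M)) : Prop :=
  [/\ A `<=` @atlas R m M,
      forall x : M, exists2 c, A c & cdom c x &
      forall c, A c -> exists T : 'I_p -> hsec G,
        (forall a, hsections G (cdom c) (T a)) /\
        forall x, cdom c x -> is_basis setT (fun a => T a x)].

(* Main.v *)
From HB Require Import structures.
From mathcomp Require Import all_boot all_order all_algebra.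
From mathcomp Require Import all_classical all_reals all_analysis.
From mathcomp Require Import ring lra.
Require Import Defs.
Import Order.TTheory GRing.Theory Num.Theory.
Import numFieldNormedType.Exports.
Set Implicit Arguments.
Unset Strict Implicit.
Unset Printing Implicit Defensive.
Local Open Scope classical_set_scope.
Local Open Scope ring_scope.

(** A differential of a form involves brackets of its arguments, so that
    involutivity of [E] makes the forms that vanish on [E] stable under the
    differential, and conversely. The theorem follows as soon as, over a chart
    domain [U], the ideal generated by the annihilator of [E] is known to be the
    set of all forms that vanish on sections of [E] ([ideal_generatedE]). If
    [E] is involutive and [w] vanishes on [E], every term of the formula for the
    differential of [w] vanishes on sections of [E] ([involutive_EDS]). If the
    ideal is stable under the differential and the 1-form [w] annihilates [E],
    then 0 = dw(S, T) = - w([S, T]) for sections S, T of [E], and there are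
    enough such forms to conclude that [S, T] is in [E] ([EDS_involutive_at]).

    That a form vanishing on [E] is a finite sum of products by 1-forms of the
    annihilator would be immediate with a frame of h^*F adapted to [E], but [E]
    need not be trivial over [U]. The frame T of h^*F over [U] defines a metric,
    for which the orthogonal projection on [E] is smooth by Gram's formula
    ([projector_smooth]); the coordinates of the normal component are p forms
    omega^a of the annihilator, defined on all of [U]. The derivation D that
    extends the normal projection, D w = sum_a omega^a /\ i_(T_a) w, has values
    in the ideal, and it multiplies the value of [w] on arguments that are normal
    or tangential to [E] by the number of normal ones. If [w] vanishes on [E],
    then (1 - D / p) .. (1 - D / 1) w = 0 since there are at most p arguments,
    while this form is congruent to [w] modulo the ideal.

    Two more things have to be established. The product and the differential of
    forms are forms ([ext_wedge], [ext_hd]): contracting by the first argument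
    turns both into recursions on the list of arguments, the antiderivation
    property of contractions and Cartan's formula, and each property of a form
    becomes an induction. The bracket of h^*F, whose value is chosen among those
    of an expression in local frames, obeys a single coordinate formula
    ([hbracket_at_coord]), from which its algebraic rules, its smoothness and its
    locality follow. This rests on the locality of the bracket of F and on the
    identity of theta with the anchor of the pull-back ([theta_at]), which holds
    because the linearity of theta over functions forces rho to vanish over the
    points y with h (eta y) different from y ([rho_off_diagonal]). Germs are
    extended to global objects by bump functions ([smooth_bump]). *)

(** * Smooth functions on open subsets of the numerical space *)

Lemma near_continuous (T U : topologicalType) (f g : T -> U) (x : T) :
  (\forall u \near x, f u = g u) ->
  {for x, continuous f} -> {for x, continuous g}.
Proof.
move=> fg; rewrite /prop_for /continuous_at -(nbhs_singleton fg).
by apply: cvg_trans; exact: near_eq_cvg.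
Qed.

Section Ck_theory.
Variable R : realType.
Implicit Types m n k : nat.

Lemma Ck_sub m k (W W' : set 'rV[R]_m) f : W' `<=` W -> Ck k W f -> Ck k W' f.
Proof.
move=> sW; elim: k f => [|k IH] f [cf df]; split=> //; try by move=> v /sW /cf.
move=> i; have [di ci] := df i; split=> [v /sW /di//|]; exact: IH.
Qed.

(** Every clause of [Ck] concerns one point of the set at a time, so smoothness
    on a set is tested point by point. This is what makes [smooth_on] a local
    notion. *)
Lemma Ck_pointwise m k (W : set 'rV[R]_m) f :
  (forall v, W v -> Ck k [set v] f) -> Ck k W f.
Proof.
elim: k f => [|k IH] f H; split=> //.
- by move=> v /H [+ _]; exact.
- by move=> v /H [+ _]; exact.
move=> i; split; first by move=> v /H [_ /(_ i)[+ _]]; exact.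
by apply: IH => v /H [_ /(_ i)[_ +]].
Qed.

(** Derivatives only see germs, so the induction is on germs: two functions
    with the same germ at a point have derivatives with the same germ there. *)
Lemma Ck_near m k (W : set 'rV[R]_m) f g :
  (forall v, W v -> \forall u \near v, f u = g u) -> Ck k W f -> Ck k W g.
Proof.
elim: k f g => [|k IH] f g fg [cf df]; split=> //;
  try by move=> v Wv; apply: near_continuous (cf v Wv); exact: fg.
move=> i; have [di ci] := df i; split.
  by move=> v Wv; apply: near_eq_derivable (di v Wv); exact: fg.
apply: IH ci => v Wv; have := nbhs_interior (fg v Wv); apply: filterS => u fgu.
exact: near_eq_derive.
Qed.

Lemma Ck_open_eq m k (W : set 'rV[R]_m) f g : open W ->
  (forall v, W v -> f v = g v) -> Ck k W f -> Ck k W g.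
Proof.
move=> oW fg; apply: Ck_near => v Wv.
by apply: filterS fg _; exact: open_nbhs_nbhs.
Qed.

Lemma Ck_pred m k (W : set 'rV[R]_m) f : Ck k.+1 W f -> Ck k W f.
Proof.
elim: k f => [|k IH] f [cf df]; first by split.
by split=> // i; have [di ci] := df i; split=> //; exact: IH.
Qed.

Lemma Ck_continuous m k (W : set 'rV[R]_m) f v :
  Ck k W f -> W v -> {for v, continuous f}.
Proof. by case: k => [|k] [cf _]; exact: cf. Qed.

Lemma Ck_cst m k (W : set 'rV[R]_m) (a : R) : Ck k W (fun=> a).
Proof.
elim: k a => [|k IH] a; split=> //; try by move=> v _; exact: cst_continuous.
move=> i; split=> [v _|]; first exact: derivable_cst.
have -> : (fun v : 'rV[R]_m => 'D_(delta_mx 0 i) (fun=> a) v) = fun=> 0.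
  by apply/funext => v; rewrite (derive_cst a).
exact: IH.
Qed.

Lemma CkD m k (W : set 'rV[R]_m) f g : open W ->
  Ck k W f -> Ck k W g -> Ck k W (fun v => f v + g v).
Proof.
move=> oW; elim: k f g => [|k IH] f g [cf df] [cg dg]; split=> //.
- by move=> v Wv; apply: continuousD; [exact: cf | exact: cg].
- by move=> v Wv; apply: continuousD; [exact: cf | exact: cg].
move=> i; have [dfi cfi] := df i; have [dgi cgi] := dg i; split.
  by move=> v Wv; apply: derivableD; [exact: dfi|exact: dgi].
apply: (@Ck_open_eq _ _ _ (fun v => 'D_(delta_mx 0 i) f v + 'D_(delta_mx 0 i) g v)) => //.
  by move=> v Wv; apply/esym; exact: (@deriveD _ _ _ f g v _ (dfi v Wv) (dgi v Wv)).
exact: IH.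
Qed.

Lemma CkM m k (W : set 'rV[R]_m) f g : open W ->
  Ck k W f -> Ck k W g -> Ck k W (fun v => f v * g v).
Proof.
move=> oW; elim: k f g => [|k IH] f g Hf Hg; have [cf df] := Hf; have [cg dg] := Hg; split=> //.
- by move=> v Wv; apply: continuousM; [exact: cf | exact: cg].
- by move=> v Wv; apply: continuousM; [exact: cf | exact: cg].
move=> i; have [dfi cfi] := df i; have [dgi cgi] := dg i; split.
  by move=> v Wv; apply: derivableM; [exact: dfi|exact: dgi].
apply: (@Ck_open_eq _ _ _ (fun v => f v * 'D_(delta_mx 0 i) g v + g v * 'D_(delta_mx 0 i) f v)) => //.
  by move=> v Wv; apply/esym; exact: (@deriveM _ _ f g v _ (dfi v Wv) (dgi v Wv)).
by apply: CkD => //; apply: IH => //; exact: Ck_pred.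
Qed.

Lemma Ck_sum m k (I : Type) (r : seq I) (W : set 'rV[R]_m)
    (f : I -> 'rV[R]_m -> R) : open W ->
  (forall i, Ck k W (f i)) -> Ck k W (fun v => \sum_(i <- r) f i v).
Proof.
move=> oW Hf; elim: r => [|i r IH].
  by rewrite (_ : (fun v => _) = fun=> 0); [exact: Ck_cst|apply/funext=> v; rewrite big_nil].
rewrite (_ : (fun v => _) = fun v => f i v + \sum_(j <- r) f j v); first exact: CkD.
by apply/funext=> v; rewrite big_cons.
Qed.

Lemma CkV m k (W : set 'rV[R]_m) f : open W -> (forall v, W v -> f v != 0) ->
  Ck k W f -> Ck k W (fun v => (f v)^-1).
Proof.
move=> oW f0; elim: k => [|k IH] Hf; have [cf df] := Hf; split=> //.
- by move=> v Wv; apply: continuousV; [exact: f0 | exact: cf].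
- by move=> v Wv; apply: continuousV; [exact: f0 | exact: cf].
move=> i; have [dfi cfi] := df i; split.
  by move=> v Wv; apply: derivableV; [exact: f0|exact: dfi].
apply: (@Ck_open_eq _ _ _ (fun v => (-1) * (((f v)^-1 * (f v)^-1) * 'D_(delta_mx 0 i) f v))) => //.
  move=> v Wv; rewrite (@deriveV _ _ f v _ (f0 v Wv) (dfi v Wv)).
  by rewrite -[_ *: _]/(_ * _) mulN1r mulNr -exprVn expr2.
apply: CkM => //; first exact: Ck_cst.
have fV := IH (Ck_pred Hf).
by apply: CkM => //; apply: CkM.
Qed.

Lemma continuous_rV m (T : topologicalType) (g : T -> 'rV[R]_m) x :
  (forall i, {for x, continuous (fun u => g u 0 i)}) -> {for x, continuous g}.
Proof.
move=> cg A [P nP sPA]; rewrite /= nbhs_simpl.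
have : \forall u \near x, forall i : 'I_m, P 0 i (g u 0 i).
  by apply: filter_forall => i; exact: (cg i) (nP 0 i).
apply: filterS => u Pu; apply: sPA => i j; rewrite (ord1 i); exact: Pu.
Qed.

End Ck_theory.

(** * The chain rule *)

Lemma continuous_distP (R : realType) (T : topologicalType) (f : T -> R) (x : T) :
  {for x, continuous f} <->
  forall e, 0 < e -> \forall u \near x, `|f x - f u| < e.
Proof. by split=> [/cvgrPdist_lt|H]; [|apply/cvgrPdist_lt]. Qed.

Section chain_rule.
Variable R : realType.
Implicit Types m n k : nat.

Lemma derive_slice n (f : 'rV[R]_n -> R) (z d : 'rV[R]_n) (t : R) :
  derivable f (z + t *: d) d ->
  is_derive t 1 (fun s : R => f (z + s *: d)) ('D_d f (z + t *: d)).
Proof.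
have E : (fun h : R => h^-1 *: (((fun s : R => f (z + s *: d)) \o shift t) (h *: 1) - f (z + t *: d)))
       = (fun h : R => h^-1 *: ((f \o shift (z + t *: d)) (h *: d) - f (z + t *: d))).
  apply/funext => h /=; congr (_ *: (f _ - _)).
  by rewrite -[h *: 1]/(h * 1) mulr1 scalerDl addrCA.
by move=> df; split; [rewrite /derivable E | rewrite /derive E].
Qed.

(** The increment of [f] is telescoped by changing one coordinate at a time,
    and each step is a difference quotient along a coordinate axis, close to
    the partial derivative by the mean value theorem. This form of
    differentiability composes well with a derivative along a line. *)
Lemma caratheodory n (W : set 'rV[R]_n) (f : 'rV[R]_n -> R) (y0 : 'rV[R]_n) :
  open W -> W y0 -> Ck 1 W f ->
  exists A : 'I_n -> 'rV[R]_n -> R,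
    [/\ forall y, f y - f y0 = \sum_j (y 0 j - y0 0 j) * A j y,
        forall j, A j y0 = 'D_(delta_mx 0 j) f y0 &
        forall j, {for y0, continuous (A j)}].
Proof.
move=> oW Wy0 [cf df].
(* The first j coordinates of y followed by the last ones of y0. *)
pose z (j : nat) (y : 'rV[R]_n) : 'rV[R]_n :=
  \row_i (if (i < j)%N then y 0 i else y0 0 i).
have zS (j : 'I_n) y : z j.+1 y = z j y + (y 0 j - y0 0 j) *: delta_mx 0 j.
  apply/rowP => i; rewrite !mxE ltnS leq_eqVlt eqxx /= -(inj_eq val_inj).
  case: eqVneq => [e|_] /=; last by rewrite mulr0 addr0.
  have -> : i = j by exact: val_inj.
  by rewrite ltnn mulr1 addrC subrK.
pose A (j : 'I_n) (y : 'rV[R]_n) : R := if y 0 j == y0 0 j then 'D_(delta_mx 0 j) f y0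
  else (f (z j.+1 y) - f (z j y)) / (y 0 j - y0 0 j).
have AE (j : 'I_n) (y : 'rV[R]_n) : (y 0 j - y0 0 j) * A j y = f (z j.+1 y) - f (z j y).
  rewrite /A; case: eqVneq => [e|ne].
    by rewrite zS e subrr mul0r scale0r addr0 subrr.
  by rewrite mulrC divfK // subr_eq0.
exists A; split.
- move=> y; under eq_bigr do rewrite AE.
  rewrite -(big_mkord xpredT (fun j => f (z j.+1 y) - f (z j y))).
  rewrite telescope_sumr //; congr (f _ - f _); apply/rowP => i; rewrite mxE //.
  by rewrite ltn_ord.
- by move=> j; rewrite /A eqxx.
move=> j; apply/continuous_distP => e e0.
have [dj [cdj _]] := df j.
have : \forall u \near y0, W u /\ `|'D_(delta_mx 0 j) f y0 - 'D_(delta_mx 0 j) f u| < e.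
  apply: filterI; first exact: open_nbhs_nbhs.
  by move: (cdj y0 Wy0) => /continuous_distP; exact.
move/nbhs_ballP => [d /= d0 Hd].
apply/nbhs_ballP; exists d => //= y [_ yd].
rewrite /A eqxx; case: eqVneq => [_|ne]; first by rewrite subrr normr0.
have Hz (t : R) : `|t| <= `|y 0 j - y0 0 j| -> ball y0 d (z j y + t *: delta_mx 0 j).
  move=> tle; split=> // i' i; rewrite (ord1 i') !mxE eqxx /=.
  have := yd 0 i; rewrite /ball /= /ball_ => yi.
  have [->|nij] := eqVneq i j.
    rewrite ltnn mulr1 opprD addrA subrr add0r normrN.
    apply: le_lt_trans tle _; rewrite distrC.
    by have := yd 0 j; rewrite /ball /= /ball_.
  rewrite mulr0 addr0; case: ifP => _ //.
  by rewrite subrr normr0.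
set h := y 0 j - y0 0 j.
have h0 : h != 0 by rewrite subr_eq0.
have dphi (t : R) : `|t| <= `|h| -> is_derive t 1 (fun s : R => f (z j y + s *: delta_mx 0 j))
      ('D_(delta_mx 0 j) f (z j y + t *: delta_mx 0 j)).
  move=> tle; apply: derive_slice; apply: dj.
  by have [] := Hd _ (Hz t tle).
have [c [cle Ec]] : exists c : R, `|c| <= `|h| /\
   f (z j y + h *: delta_mx 0 j) - f (z j y + 0 *: delta_mx 0 j)
     = 'D_(delta_mx 0 j) f (z j y + c *: delta_mx 0 j) * h.
  case: (ltgtP 0 h) => [hp|hn|h00].
  - have ins x : x \in `[0, h] -> `|x| <= `|h|.
      by rewrite in_itv /= => /andP[x0 xh]; rewrite !ger0_norm // ltW.
    have [||c cin E] := @MVT R (fun s : R => f (z j y + s *: delta_mx 0 j))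
       (fun s => 'D_(delta_mx 0 j) f (z j y + s *: delta_mx 0 j)) 0 h hp.
    + by move=> x xin; apply: dphi; apply: ins; exact: subset_itv_oo_cc.
    + apply: derivable_within_continuous => x xin.
      by have [] := dphi x (ins x xin).
    exists c; split; first by apply: ins; exact: subset_itv_oo_cc.
    by rewrite E subr0.
  - have ins x : x \in `[h, 0] -> `|x| <= `|h|.
      by rewrite in_itv /= => /andP[x0 xh]; rewrite !ler0_norm // ?lerN2 // ltW.
    have [||c cin E] := @MVT R (fun s : R => f (z j y + s *: delta_mx 0 j))
       (fun s => 'D_(delta_mx 0 j) f (z j y + s *: delta_mx 0 j)) h 0 hn.
    + by move=> x xin; apply: dphi; apply: ins; exact: subset_itv_oo_cc.
    + apply: derivable_within_continuous => x xin.
      by have [] := dphi x (ins x xin).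
    exists c; split; first by apply: ins; exact: subset_itv_oo_cc.
    by rewrite -opprB E sub0r mulrN opprK.
  - by rewrite -h00 eqxx in h0.
rewrite zS -/h; move: Ec; rewrite scale0r addr0 => ->.
rewrite mulfK //.
by have [] := Hd _ (Hz c cle).
Qed.

(** In the decomposition of [caratheodory] at [g v], the difference quotient of
    [f \o g] becomes a sum of products of difference quotients of the
    coordinates of [g] by functions that are continuous at [g v]. *)
Lemma derive_comp m n (W : set 'rV[R]_n) (f : 'rV[R]_n -> R)
    (g : 'rV[R]_m -> 'rV[R]_n) (v d : 'rV[R]_m) :
  open W -> W (g v) -> Ck 1 W f ->
  (forall j, derivable (fun u => g u 0 j) v d) ->
  is_derive v d (f \o g)
    (\sum_j 'D_(delta_mx 0 j) f (g v) * 'D_d (fun u => g u 0 j) v).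
Proof.
move=> oW Wg Cf dg.
have [A [AE A0 cA]] := caratheodory oW Wg Cf.
have dgm : derivable g v d by apply/derivable_mxP => i j; rewrite (ord1 i).
suff H : (h^-1 *: ((f \o g) (h *: d + v) - (f \o g) v)) @[h --> 0^'] -->
   (\sum_j 'D_(delta_mx 0 j) f (g v) * 'D_d (fun u => g u 0 j) v).
  split; first by apply/cvg_ex; eexists; exact: H.
  exact: cvg_lim H.
rewrite (_ : (fun h => _) = (fun h : R =>
    \sum_j (A j (g (h *: d + v)) * (h^-1 *: (g (h *: d + v) 0 j - g v 0 j))))); last first.
  apply/funext => h /=; rewrite AE scaler_sumr; apply: eq_bigr => j _.
  by rewrite -![h^-1 *: _]/(h^-1 * _); ring.
apply: cvg_big => [|j _]; first exact: add_continuous.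
apply: cvgM; last exact: dg j.
have cg0 : {for (0 : R), continuous (fun h : R => g (h *: d + v))}.
  have := dgm; move/derivable1P/derivable1_diffP/differentiable_continuous; exact.
rewrite -A0.
have -> : g v = g ((0 : R) *: d + v) by rewrite scale0r add0r.
have cA' : {for (0 : R), continuous (A j \o (fun h : R => g (h *: d + v)))}.
  by apply: continuous_comp => //; rewrite scale0r add0r; exact: cA.
by apply: cvg_trans cA'; apply: cvg_app; exact: nbhs_dnbhs.
Qed.

Lemma Ck_comp m n k (W : set 'rV[R]_m) (W' : set 'rV[R]_n)
    (f : 'rV[R]_n -> R) (g : 'rV[R]_m -> 'rV[R]_n) :
  open W -> open W' -> (forall v, W v -> W' (g v)) ->
  Ck k W' f -> (forall j, Ck k W (fun v => g v 0 j)) -> Ck k W (f \o g).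
Proof.
move=> oW oW' gW; elim: k f => [|k IH] f Cf Cg.
  split=> // v Wv; apply: continuous_comp; last by case: Cf => + _; apply; exact: gW.
  by apply: continuous_rV => i; case: (Cg i) => + _; exact.
have Cf1 : Ck 1 W' f.
  case: Cf => cf df; split=> // i; have [di ci] := df i.
  by split=> //; split=> // v; exact: Ck_continuous ci.
split.
  move=> v Wv; apply: continuous_comp; last by case: Cf => + _; apply; exact: gW.
  by apply: continuous_rV => i; case: (Cg i) => + _; exact.
move=> i.
have H v : W v -> is_derive v (delta_mx 0 i) (f \o g)
    (\sum_j 'D_(delta_mx 0 j) f (g v) * 'D_(delta_mx 0 i) (fun u => g u 0 j) v).
  move=> Wv; apply: (@derive_comp _ _ W') => //; first exact: gW.
  by move=> j; case: (Cg j) => _ /(_ i)[+ _]; exact.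
split; first by move=> v /H[].
apply: (Ck_open_eq (f := fun v => \sum_j 'D_(delta_mx 0 j) f (g v)
   * 'D_(delta_mx 0 i) (fun u => g u 0 j) v)) => //.
  by move=> v /H[].
apply: Ck_sum => // j; apply: CkM => //.
  apply: (IH (fun u => 'D_(delta_mx 0 j) f u)); last by move=> j'; exact: Ck_pred.
  by case: Cf => _ /(_ j)[].
by case: (Cg j) => _ /(_ i)[].
Qed.
End chain_rule.

(** * A flat function *)

Section flat_function.
Variable R : realType.
Implicit Types (x : R).

(** For n = 0 this is the flat function exp (- 1 / x). The powers of 1 / x make
    the family closed under differentiation up to linear combinations, so that
    one induction treats all the derivatives at once. *)
Definition flat (n : nat) (x : R) : R :=
  if 0 < x then x^-1 ^+ n * expR (- x^-1) else 0.

Lemma flat_ge0 n x : 0 <= flat n x.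
Proof.
by rewrite /flat; case: ltP => // x0; rewrite mulr_ge0 ?expR_ge0 // exprn_ge0 // invr_ge0 ltW.
Qed.

Lemma flat_le0 n x : x <= 0 -> flat n x = 0.
Proof. by rewrite /flat; case: ltP. Qed.

Lemma flat0_gt0 x : 0 < x -> 0 < flat 0 x.
Proof. by move=> x0; rewrite /flat x0 expr0 mul1r expR_gt0. Qed.

Lemma flat_bounded n x : flat n.+1 x <= n.+1`!%:R.
Proof.
rewrite /flat; case: ltP => // x0.
have y0 : 0 <= x^-1 by rewrite invr_ge0 ltW.
rewrite expRN ler_pdivrMr ?expR_gt0 // mulrC -ler_pdivrMr ?ltr0n ?fact_gt0 //.
by apply: le_trans (expR_ge1Dxn n y0); rewrite lerDr.
Qed.

Lemma flat_mul n x : flat n x = x * flat n.+1 x.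
Proof.
rewrite /flat; case: ltP => x0; last by rewrite mulr0.
by rewrite exprS !mulrA divff ?mul1r // gt_eqF.
Qed.

(** At 0 the difference quotient of [flat n] is [flat n.+1], and [flat n.+1 x =
    x * flat n.+2 x] is O(x) because [flat n.+2] is bounded. *)
Lemma is_derive_flat n x : is_derive x 1 (flat n) (flat n.+2 x - n%:R * flat n.+1 x).
Proof.
have [x0|x0|x0] := ltgtP x 0.
- rewrite !flat_le0 ?ltW // mulr0 subr0.
  apply: (near_eq_is_derive (f := cst 0)).
  near=> y; rewrite flat_le0 //; apply: ltW; near: y; exact: lt_nbhsl.
- apply: (@near_eq_is_derive _ _ _ (fun y : R => y^-1 ^+ n * expR (- y^-1) : R)).
    near=> y; rewrite /flat ifT //; near: y; exact: lt_nbhsr.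
  have xn0 : x != 0 by rewrite gt_eqF.
  have dV : is_derive x 1 (fun y : R => y^-1) (- x^-1 ^+ 2).
    have := @is_deriveV _ id x 1 1 xn0 (is_derive_id _ _).
    by rewrite -exprVn -[_ *: _]/(_ * _) mulr1.
  have dN : is_derive x 1 (fun y : R => - y^-1) (x^-1 ^+ 2).
    by have := is_deriveN dV; rewrite opprK.
  have dE : is_derive x 1 (fun y : R => expR (- y^-1)) (expR (- x^-1) * x^-1 ^+ 2).
    exact: (is_derive1_comp (is_derive_expR _) dN).
  have dX : is_derive x 1 (fun y : R => y^-1 ^+ n)
      ((n%:R * x^-1 ^+ n.-1) * (- x^-1 ^+ 2)).
    have -> : (fun y : R => y^-1 ^+ n) = (fun y : R => y^-1) ^+ n.
      by apply/funext => y; rewrite exprfctE.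
    exact: (is_deriveX n dV).
  apply: (is_derive_eq (is_deriveM dX dE)).
  rewrite /flat x0 -![_ *: _]/(_ * _); move: (expR _) => e; case: (n) => [|k] /=; move: x^-1 => y; rewrite ?exprS; [ring|move: (y ^+ k) (k.+1%:R) => z c; ring].
- rewrite x0 !flat_le0 // mulr0 subr0.
  have H : h^-1 *: ((flat n \o shift 0) (h *: 1) - flat n 0) @[h --> (0 : R)^'] --> (0 : R).
    (* The constant is the bound of flat n.+2 given by flat_bounded. *)
    apply: (@cvg_to_0_linear _ _ (n.+2`!%:R) 1) => // h /andP[h0 _].
    rewrite /= (flat_le0 n (lexx 0)) subr0 addr0 -[h *: 1]/(h * 1) mulr1.
    rewrite -[_ *: _]/(_ * _) flat_mul mulKf -?normr_gt0 // flat_mul normrM mulrC.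
    by rewrite ler_wpM2r // ger0_norm ?flat_ge0 // flat_bounded.
  split; first by apply/cvg_ex; exists 0; exact: H.
  exact: cvg_lim H.
Unshelve. all: by end_near. Qed.


Lemma derive_scalar_comp (V : normedModType R) (phi : R -> R) (f : V -> R)
    (v d : V) (a : R) :
  is_derive (f v) 1 phi a -> derivable f v d ->
  is_derive v d (phi \o f) (a * 'D_d f v).
Proof.
move=> dphi df.
have E : forall g : V -> R, (fun h : R => h^-1 *: ((g \o shift v) (h *: d) - g v))
   = (fun h : R => h^-1 *: (((fun s : R => g (s *: d + v)) \o shift 0) (h *: 1)
      - g (0 *: d + v))).
  by move=> g; apply/funext => h /=; rewrite addr0 scale0r add0r [h%:A]mulr1.
have df' : is_derive (0 : R) 1 (fun s : R => f (s *: d + v)) ('D_d f v).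
  by split; [exact: (derivable1P f v d).1 df|rewrite /derive E].
have [|H1 H2] := @is_derive1_comp R phi _ 0 a _ _ df'.
  by rewrite scale0r add0r.
by split; [exact: (derivable1P (phi \o f) v d).2 H1|rewrite -H2 /derive E].
Qed.

Lemma Ck_flat m k n (W : set 'rV[R]_m) f : open W -> Ck k W f ->
  Ck k W (fun v => flat n (f v)).
Proof.
move=> oW; elim: k n => [|k IH] n Cf.
  split=> // v Wv; apply: continuous_comp; first exact: Ck_continuous Cf Wv.
  by have [/derivable1_diffP/differentiable_continuous] := is_derive_flat n (f v).
have H i v : W v -> is_derive v (delta_mx 0 i) (fun u => flat n (f u))
   ((flat n.+2 (f v) + (- n%:R) * flat n.+1 (f v)) * 'D_(delta_mx 0 i) f v).
  move=> Wv; rewrite mulNr; apply: derive_scalar_comp; first exact: is_derive_flat.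
  by case: Cf => _ /(_ i)[+ _]; exact.
split.
  move=> v Wv; apply: continuous_comp; first exact: Ck_continuous Cf Wv.
  by have [/derivable1_diffP/differentiable_continuous] := is_derive_flat n (f v).
move=> i; split=> [v /(H i)[]//|].
apply: (Ck_open_eq (f := fun v => (flat n.+2 (f v) + (- n%:R) * flat n.+1 (f v))
   * 'D_(delta_mx 0 i) f v)) => // [v /(H i)[_ ->]//|].
have Cf' := Ck_pred Cf.
apply: CkM => //; last by case: Cf => _ /(_ i)[].
apply: CkD => //; first exact: IH.
by apply: CkM => //; [exact: Ck_cst|exact: IH].
Qed.

End flat_function.

(** * Smooth functions on a manifold *)

Section smooth_functions.
Variables (R : realType) (m : nat) (M : manifold R m).
Implicit Types (U V : set M) (f g : M -> R) (x y : M) (c : chart R m M).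

Lemma chart_image_open c U : open U -> open (cmap c @` (U `&` cdom c)).
Proof.
move=> oU; rewrite openE => v [x [Ux cx] <-].
have vi : (cmap c @` cdom c) (cmap c x) by exists x.
have : \forall u \near cmap c x, (cmap c @` cdom c) u /\ U (cinv c u).
  apply: filterI; first by apply: open_nbhs_nbhs; split=> //; exact: cimg_open.
  apply: (cinv_cont vi); rewrite /= cmapK //; exact: open_nbhs_nbhs.
by apply: filterS => u [[y cy <-]]; rewrite cmapK // => Uy; exists y.
Qed.

Lemma smooth_on_sub U V f : U `<=` V -> smooth_on V f -> smooth_on U f.
Proof.
move=> sUV sf c Ac k; apply: Ck_sub (sf c Ac k).
by apply: image_subset => y [/sUV].
Qed.

Lemma smooth_on_at U f : open U ->
  (smooth_on U f <-> forall x, U x -> smooth_at x f).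
Proof.
move=> oU; split=> [sf x Ux|sf c Ac k]; first by exists U.
apply: Ck_pointwise => v [x [Ux cx] <-].
have [V [oV Vx sV]] := sf x Ux.
by apply: Ck_sub (sV c Ac k) => _ ->; exists x.
Qed.

Lemma smooth_at_nbhs x f : smooth_at x f -> \forall y \near x, smooth_at y f.
Proof.
move=> [U [oU Ux sU]]; have : nbhs x U by exact: open_nbhs_nbhs.
by apply: filterS => y Uy; exists U.
Qed.

Lemma smooth_at_near x f g :
  (\forall y \near x, f y = g y) -> smooth_at x f -> smooth_at x g.
Proof.
move=> /nbhs_interior; rewrite nbhsE => -[V [oV Vx] fg] [U [oU Ux sU]].
have fgV y : V y -> f y = g y by move=> /fg /nbhs_singleton.
exists (U `&` V); split=> [||c Ac k]; [exact: openI|by []|].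
apply: (Ck_open_eq (f := f \o cinv c)).
- exact/chart_image_open/openI.
- by move=> v [y [[Uy Vy] cy] <-] /=; rewrite cmapK // fgV.
by apply: smooth_on_sub sU c Ac k => y [].
Qed.

Lemma smooth_at_eq x f g : f =1 g -> smooth_at x f -> smooth_at x g.
Proof. by move=> /funext ->. Qed.

Lemma smooth_at_cst x (a : R) : smooth_at x (fun=> a).
Proof. by exists setT; split=> //; [exact: openT|move=> c _ k; exact: Ck_cst]. Qed.

(** Shared by the closure lemmas below: pass to the intersection of two
    neighbourhoods and work in each chart. *)
Lemma smooth_at_op2 (op : R -> R -> R) x f g :
  (forall k (W : set 'rV[R]_m) (a b : 'rV[R]_m -> R), open W ->
     Ck k W a -> Ck k W b -> Ck k W (fun v => op (a v) (b v))) ->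
  smooth_at x f -> smooth_at x g -> smooth_at x (fun y => op (f y) (g y)).
Proof.
move=> Cop [U [oU Ux sU]] [V [oV Vx sV]].
exists (U `&` V); split=> [||c Ac k]; [exact: openI|by []|].
apply: Cop; first exact/chart_image_open/openI.
- by apply: smooth_on_sub sU c Ac k => y [].
- by apply: smooth_on_sub sV c Ac k => y [].
Qed.

Lemma smooth_atD x f g :
  smooth_at x f -> smooth_at x g -> smooth_at x (fun y => f y + g y).
Proof. by apply: smooth_at_op2 => k W a b; exact: CkD. Qed.

Lemma smooth_atM x f g :
  smooth_at x f -> smooth_at x g -> smooth_at x (fun y => f y * g y).
Proof. by apply: smooth_at_op2 => k W a b; exact: CkM. Qed.

Lemma smooth_atZ x (a : R) f : smooth_at x f -> smooth_at x (fun y => a * f y).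
Proof. by apply: smooth_atM; exact: smooth_at_cst. Qed.

Lemma smooth_atN x f : smooth_at x f -> smooth_at x (fun y => - f y).
Proof.
by move=> sf; apply: smooth_at_eq (smooth_atZ (-1) sf) => y; rewrite mulN1r.
Qed.

Lemma smooth_atB x f g :
  smooth_at x f -> smooth_at x g -> smooth_at x (fun y => f y - g y).
Proof. by move=> sf sg; apply: smooth_atD => //; exact: smooth_atN. Qed.

Lemma smooth_at_sum x (I : Type) (r : seq I) (P : pred I) (f : I -> M -> R) :
  (forall i, P i -> smooth_at x (f i)) ->
  smooth_at x (fun y => \sum_(i <- r | P i) f i y).
Proof.
move=> sf; elim: r => [|i r IH].
  by apply: smooth_at_eq (smooth_at_cst x 0) => y; rewrite big_nil.
case: (boolP (P i)) => Pi.
  by apply: smooth_at_eq (smooth_atD (sf i Pi) IH) => y; rewrite big_cons Pi.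
by apply: smooth_at_eq IH => y; rewrite big_cons (negbTE Pi).
Qed.

Lemma smooth_at_prod x (I : Type) (r : seq I) (f : I -> M -> R) :
  (forall i, smooth_at x (f i)) ->
  smooth_at x (fun y => \prod_(i <- r) f i y).
Proof.
move=> sf; elim: r => [|i r IH].
  by apply: smooth_at_eq (smooth_at_cst x 1) => y; rewrite big_nil.
by apply: smooth_at_eq (smooth_atM (sf i) IH) => y; rewrite big_cons.
Qed.

Lemma smooth_at_continuous x f : smooth_at x f -> {for x, continuous f}.
Proof.
move=> [U [oU Ux sU]]; have [c Ac cx] := atlas_cover x.
have cf : {for cmap c x, continuous (f \o cinv c)}.
  by apply: Ck_continuous (sU c Ac 0%N) _; exists x.
have : {for x, continuous (f \o cinv c \o cmap c)}.
  by apply: continuous_comp => //; exact: cmap_cont.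
apply: near_continuous.
have : nbhs x (cdom c) by apply: open_nbhs_nbhs; split=> //; exact: cdom_open.
by apply: filterS => y cy /=; rewrite cmapK.
Qed.

Lemma smooth_atV x f : f x != 0 -> smooth_at x f ->
  smooth_at x (fun y => (f y)^-1).
Proof.
move=> f0 sf; have [U [oU Ux sU]] := sf.
have : nbhs x [set y | f y != 0].
  exact: (cvgr_neq0 _ (smooth_at_continuous sf) f0).
rewrite nbhsE => -[V [oV Vx] Vf].
exists (U `&` V); split=> [||c Ac k]; [exact: openI|by []|].
apply: CkV; first exact/chart_image_open/openI.
- by move=> v [y [[Uy Vy] cy] <-] /=; rewrite cmapK //; exact: Vf.
- by apply: smooth_on_sub sU c Ac k => y [].
Qed.

Lemma smooth_at_flat x n f : smooth_at x f -> smooth_at x (fun y => flat n (f y)).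
Proof.
move=> [U [oU Ux sU]]; exists U; split=> // c Ac k.
by apply: Ck_flat; [exact: chart_image_open|exact: sU].
Qed.

Lemma smooth_at_coord c i x : atlas c -> cdom c x ->
  smooth_at x (fun y => cmap c y 0 i).
Proof.
move=> Ac cx; exists (cdom c); split=> //; first exact: cdom_open.
move=> c' Ac' k; rewrite setIC; exact: (atlas_compat Ac' Ac).
Qed.

End smooth_functions.

Lemma smooth_at_comp (R : realType) (m n : nat) (M : manifold R m)
    (N : manifold R n) (h : M -> N) (g : N -> R) (x : M) :
  smooth_map h -> smooth_at (h x) g -> smooth_at x (g \o h).
Proof.
move=> [ch sh] [V [oV Vx sV]]; have [d Ad dx] := atlas_cover (h x).
have od := @cdom_open _ _ _ d.
exists (h @^-1` (V `&` cdom d)); split=> //.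
  by apply: open_comp => [y _|]; [exact: ch|exact: openI].
move=> c Ac k.
apply: (Ck_open_eq (f := (g \o cinv d) \o (fun v => cmap d (h (cinv c v))))).
- by apply: chart_image_open; apply: open_comp => [y _|]; [exact: ch|exact: openI].
- by move=> v [y [[Vy dy] cy] <-] /=; rewrite !cmapK.
apply: (@Ck_comp _ _ _ _ _ (cmap d @` (V `&` cdom d))).
- by apply: chart_image_open; apply: open_comp => [y _|]; [exact: ch|exact: openI].
- exact: chart_image_open.
- by move=> v [y [[Vy dy] cy] <-] /=; rewrite cmapK //; exists (h y).
- exact: sV.
move=> j; apply: Ck_sub (sh c d j Ac Ad k).
by move=> v [y [[Vy dy] cy] <-]; exists y.
Qed.

Lemma smooth_at_det (R : realType) (m k : nat) (M : manifold R m) (x : M)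
    (A : M -> 'M[R]_k) :
  (forall i j, smooth_at x (fun y => A y i j)) ->
  smooth_at x (fun y => \det (A y)).
Proof.
move=> sA; apply: smooth_at_sum => s _; apply: smooth_atM; first exact: smooth_at_cst.
by apply: smooth_at_prod => i; exact: sA.
Qed.

(** Cramer's rule. *)
Lemma smooth_at_invmx (R : realType) (m k : nat) (M : manifold R m) (x : M)
    (A : M -> 'M[R]_k) :
  (forall i j, smooth_at x (fun y => A y i j)) ->
  (\forall y \near x, A y \in unitmx) ->
  forall i j, smooth_at x (fun y => invmx (A y) i j).
Proof.
move=> sA uA i j.
apply: (@smooth_at_near _ _ _ _ (fun y => (\det (A y))^-1 * (\adj (A y)) i j)).
  by apply: filterS uA => y uy; rewrite /invmx uy [RHS]mxE.
apply: smooth_atM.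
  apply: smooth_atV; last exact: smooth_at_det.
  by have := nbhs_singleton uA; rewrite unitmxE unitfE.
apply: (@smooth_at_eq _ _ _ _ (fun y => (-1) ^+ (j + i) * \det (row' j (col' i (A y))))).
  by move=> y; rewrite mxE.
apply: smooth_atZ; apply: smooth_at_det => i' j'.
by apply: smooth_at_eq (sA (lift j i') (lift i j')) => y; rewrite !mxE.
Qed.

(** The function flat (s - r) / (flat (s - r) + flat (r - s / 2)) of the
    squared distance r to the image of x in a chart. It is supported in the
    image of a compact box of the chart; that image is closed because the
    manifold is Hausdorff, whence the smoothness of the extension by zero. *)
Lemma smooth_bump (R : realType) (m : nat) (M : manifold R m) (x : M) (U : set M) :
  open U -> U x ->
  exists phi : M -> R, [/\ forall y, smooth_at y phi,
    \forall y \near x, phi y = 1 &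
    forall y, ~ U y -> \forall z \near y, phi z = 0].
Proof.
move=> oU Ux; have [c Ac cx] := atlas_cover x.
pose a := cmap c x.
have : nbhs a (cmap c @` (U `&` cdom c)).
  by apply: open_nbhs_nbhs; split; [exact: chart_image_open|exists x].
move=> /nbhs_ballP [e /= e0 He].
pose d := e / 2; have d0 : 0 < d by rewrite divr_gt0.
have de : d < e by rewrite /d; lra.
pose s := d ^+ 2; have s0 : 0 < s by rewrite exprn_gt0.
pose B := [set v : 'rV[R]_m | forall i, `[a 0 i - d, a 0 i + d]%classic (v ord0 i)].
have cB : compact B.
  apply: (@rV_compact _ _ (fun i => `[a 0 i - d, a 0 i + d]%classic)) => i.
  exact: segment_compact.
have BW : B `<=` cmap c @` (U `&` cdom c).
  move=> v Bv; apply: He; split=> // i' i; rewrite (ord1 i') /ball /= /ball_.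
  have := Bv i; rewrite /= in_itv /= => /andP[h1 h2].
  by apply: le_lt_trans de; rewrite ler_norml; apply/andP; split; lra.
have BW' : B `<=` cmap c @` cdom c by move=> v /BW [y [_ cy] <-]; exists y.
pose K := cinv c @` B.
have clK : closed K.
  apply: compact_closed; first exact: points_hausdorff.
  apply: continuous_compact => //; apply: continuous_in_subspaceT => v vB.
  by apply: cinv_cont; apply: BW'; exact/set_mem.
have KU : K `<=` U `&` cdom c.
  by move=> _ [v /BW [y [Uy cy] <-] <-]; rewrite cmapK.
pose r y := \sum_i (cmap c y 0 i - a 0 i) ^+ 2.
pose psi y := flat 0 (s - r y) / (flat 0 (s - r y) + flat 0 (r y - s / 2)).
pose phi y := if y \in cdom c then psi y else 0.
have phiK y : ~ K y -> phi y = 0.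
  rewrite /phi; case: ifPn => // /set_mem cy nK; rewrite /psi.
  have [rs|sr] := ltP (r y) s; last by rewrite flat_le0 ?mul0r // subr_le0.
  exfalso; apply: nK; exists (cmap c y); last by rewrite cmapK.
  move=> i; rewrite /= in_itv /=.
  have : (cmap c y 0 i - a 0 i) ^+ 2 <= s.
    apply: le_trans (ltW rs); rewrite /r (bigD1 i) //= lerDl.
    by apply: sumr_ge0 => j _; exact: sqr_ge0.
  rewrite /s; move: (cmap c y 0 i) (a 0 i) => u w; rewrite !expr2 => uw.
  by apply/andP; split; rewrite leNgt; apply/negP => h; nra.
have nearK y : ~ K y -> \forall z \near y, phi z = 0.
  move=> nKy; have : nbhs y (~` K).
    by apply: open_nbhs_nbhs; split=> //; exact: closed_openC.
  by apply: filterS => z; exact: phiK.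
have nearc y : cdom c y -> nbhs y (cdom c).
  by move=> cy; apply: open_nbhs_nbhs; split=> //; exact: cdom_open.
have sr y : cdom c y -> smooth_at y r.
  move=> cy; apply: smooth_at_sum => i _.
  apply: (@smooth_at_eq _ _ _ _ (fun y => (cmap c y 0 i - a 0 i) * (cmap c y 0 i - a 0 i))).
    by move=> z; rewrite expr2.
  by apply: smooth_atM; apply: smooth_atB;
    (exact: smooth_at_cst || exact: smooth_at_coord).
exists phi; split.
- move=> y; have [cy|ncy] := pselect (cdom c y); last first.
    have nK : ~ K y by move=> /KU[].
    by apply: smooth_at_near (smooth_at_cst y 0); apply: filterS (nearK y nK) => z ->.
  apply: (@smooth_at_near _ _ _ _ psi).
    by apply: filterS (nearc y cy) => z cz; rewrite /phi mem_set.
  have s1 : smooth_at y (fun y => flat 0 (s - r y)).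
    by apply/smooth_at_flat/smooth_atB; [exact: smooth_at_cst|exact: sr].
  have s2 : smooth_at y (fun y => flat 0 (r y - s / 2)).
    by apply/smooth_at_flat/smooth_atB; [exact: sr|exact: smooth_at_cst].
  apply: smooth_atM => //; apply: smooth_atV; last exact: smooth_atD.
  apply: lt0r_neq0; have [h|h] := ltP (r y) s.
    by apply: ltr_wpDr; [exact: flat_ge0|apply: flat0_gt0; rewrite subr_gt0].
  apply: ltr_wpDl; first exact: flat_ge0.
  by apply: flat0_gt0; rewrite subr_gt0; lra.
- have rx : r x = 0 by rewrite /r big1 // => i _; rewrite subrr expr0n.
  have : \forall y \near x, r y < s / 2.
    apply: (cvgr_lt (r x) (smooth_at_continuous (sr x cx))).
    by rewrite rx divr_gt0.
  apply: filterS2 (nearc x cx) => y cy ry.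
  rewrite /phi mem_set // /psi (flat_le0 0 (x := r y - s / 2)); last by lra.
  by rewrite addr0 divff // lt0r_neq0 // flat0_gt0 //; lra.
- by move=> y nUy; apply: nearK => /KU[].
Qed.

(** * Sections of vector bundles *)

Lemma smooth_map_id (R : realType) (m : nat) (M : manifold R m) :
  smooth_map (id : M -> M).
Proof. by split=> [x //|c d i Ac Ad]; exact: atlas_compat. Qed.

(** Bump functions turn germs into global functions. The bracket and the module
    rules of a generalized Lie algebroid are only given for global objects, so
    all local computations go through such extensions. *)
Lemma smooth_germ_extension (R : realType) (m : nat) (M : manifold R m) (x : M)
    (f : M -> R) : smooth_at x f ->
  exists f' : M -> R, funs setT f' /\ \forall y \near x, f' y = f y.
Proof.
move=> [U [oU Ux sU]]; have [phi [sphi phi1 phi0]] := smooth_bump oU Ux.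
exists (fun y => phi y * f y); split; last first.
  by apply: filterS phi1 => y ->; rewrite mul1r.
split; last by move=> y /(_ I).
apply/smooth_on_at; first exact: openT.
move=> y _; have [Uy|nUy] := pselect (U y).
  by apply: smooth_atM => //; exists U.
apply: smooth_at_near (smooth_at_cst y 0).
by apply: filterS (phi0 y nUy) => z ->; rewrite mul0r.
Qed.

Section bundle_chart.
Variables (R : realType) (n p : nat) (N : manifold R n) (F : vbundle N p).
Variables (c : bchart p F) (y : N) (cy : bdom c y).

Lemma bmapD (v w : F y) : bmap c (v + w) = bmap c v + bmap c w.
Proof. by have := bmap_linear cy 1 v w; rewrite !scale1r. Qed.

Lemma bmap0 : bmap c (0 : F y) = 0.
Proof. by apply: (addrI (bmap c (0 : F y))); rewrite -bmapD !addr0. Qed.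

Lemma bmapZ (a : R) (v : F y) : bmap c (a *: v) = a *: bmap c v.
Proof. by have := bmap_linear cy a v 0; rewrite bmap0 !addr0. Qed.

Lemma bmapN (v : F y) : bmap c (- v) = - bmap c v.
Proof. by rewrite -scaleN1r bmapZ scaleN1r. Qed.

Lemma bmap_sum (I : Type) (r : seq I) (v : I -> F y) :
  bmap c (\sum_(i <- r) v i) = \sum_(i <- r) bmap c (v i).
Proof. by elim: r => [|i r IH]; rewrite ?big_nil ?bmap0 // !big_cons bmapD IH. Qed.

Lemma bmap_inj : injective (fun v : F y => bmap c v).
Proof. exact: can_inj (bmapK cy). Qed.

(** The vectors [binv c y (delta_mx 0 i)] form the frame attached to the bundle
    chart [c]. *)
Lemma bmap_decomp (v : F y) : v = \sum_i bmap c v 0 i *: binv c y (delta_mx 0 i).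
Proof.
apply: bmap_inj => /=; rewrite bmap_sum [LHS]row_sum_delta; apply: eq_bigr => i _.
by rewrite bmapZ binvK.
Qed.

End bundle_chart.

Section sections_theory.
Variables (R : realType) (m n p : nat) (M : manifold R m) (N : manifold R n).
Variables (F : vbundle N p) (g : M -> N).
Hypothesis sg : smooth_map g.
Implicit Types (Z W : forall x : M, F (g x)) (x : M) (U : set M) (c : bchart p F).

Definition smooth_sec Z x : Prop := forall c, batlas c -> bdom c (g x) ->
  forall i, smooth_at x (fun y => bmap c (Z y) 0 i).

Let cg : continuous g. Proof. by case: sg. Qed.

Lemma near_bdom c x : bdom c (g x) -> \forall y \near x, bdom c (g y).
Proof.
by move=> cx; apply: cg; apply: open_nbhs_nbhs; split=> //; exact: bdom_open.
Qed.

Lemma sectionsP U Z : open U ->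
  (sections F g U Z <-> (forall x, U x -> smooth_sec Z x) /\ forall x, ~ U x -> Z x = 0).
Proof.
move=> oU; split=> -[H1 H2]; split=> //.
  move=> x Ux c Ac cx i; exists (U `&` g @^-1` bdom c); split; [|by []|exact: H1].
  by apply: openI => //; apply: open_comp => [y _|]; [exact: cg|exact: bdom_open].
move=> c i Ac; apply/smooth_on_at; last by move=> x [Ux cx]; exact: H1.
by apply: openI => //; apply: open_comp => [y _|]; [exact: cg|exact: bdom_open].
Qed.

(** One bundle chart suffices, because the transition functions are smooth. *)
Lemma smooth_sec_chart c Z x : batlas c -> bdom c (g x) ->
  (forall i, smooth_at x (fun y => bmap c (Z y) 0 i)) -> smooth_sec Z x.
Proof.
move=> Ac cx sZ c' Ac' c'x i.
apply: (@smooth_at_near _ _ _ _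
   (fun y => \sum_j bmap c (Z y) 0 j * bmap c' (binv c (g y) (delta_mx 0 j)) 0 i)).
  apply: filterS2 (near_bdom cx) (near_bdom c'x) => y cy c'y.
  rewrite [in RHS](bmap_decomp cy (Z y)) bmap_sum // summxE.
  by apply: eq_bigr => j _; rewrite bmapZ // mxE.
apply: smooth_at_sum => j _; apply: smooth_atM => //.
apply: (smooth_at_comp (g := fun y => bmap c' (binv c y (delta_mx 0 j)) 0 i)) => //.
exists (bdom c `&` bdom c'); split=> //; first by apply: openI; exact: bdom_open.
exact: batlas_compat.
Qed.

Lemma smooth_sec_near Z W x : (\forall y \near x, Z y = W y) -> smooth_sec Z x -> smooth_sec W x.
Proof.
move=> ZW sZ c Ac cx i; apply: smooth_at_near (sZ c Ac cx i).
by apply: filterS ZW => y ->.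
Qed.

Lemma smooth_sec_nbhs Z x : smooth_sec Z x -> \forall y \near x, smooth_sec Z y.
Proof.
move=> sZ; have [c Ac cx] := batlas_cover F (g x).
have : \forall y \near x, forall i, smooth_at y (fun y' => bmap c (Z y') 0 i).
  by apply: filter_forall => i; exact/smooth_at_nbhs/sZ.
by apply: filterS2 (near_bdom cx) => y cy; exact: smooth_sec_chart.
Qed.

Lemma smooth_secD Z W x : smooth_sec Z x -> smooth_sec W x -> smooth_sec (fun y => Z y + W y) x.
Proof.
move=> sZ sW c Ac cx i; apply: smooth_at_near (smooth_atD (sZ c Ac cx i) (sW c Ac cx i)).
by apply: filterS (near_bdom cx) => y cy; rewrite bmapD // mxE.
Qed.

Lemma smooth_secZ (f : M -> R) Z x :
  smooth_at x f -> smooth_sec Z x -> smooth_sec (fun y => f y *: Z y) x.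
Proof.
move=> sf sZ c Ac cx i; apply: smooth_at_near (smooth_atM sf (sZ c Ac cx i)).
by apply: filterS (near_bdom cx) => y cy; rewrite bmapZ // mxE.
Qed.

Lemma smooth_sec0 x : smooth_sec (fun y => 0) x.
Proof.
move=> c Ac cx i; apply: smooth_at_near (smooth_at_cst x 0).
by apply: filterS (near_bdom cx) => y cy; rewrite bmap0 // mxE.
Qed.

Lemma smooth_sec_sum (I : Type) (r : seq I) (Z : I -> forall x : M, F (g x)) x :
  (forall i, smooth_sec (Z i) x) -> smooth_sec (fun y => \sum_(i <- r) Z i y) x.
Proof.
move=> sZ; elim: r => [|i r IH].
  by apply: smooth_sec_near (@smooth_sec0 x); apply: nearW => y; rewrite big_nil.
apply: smooth_sec_near (smooth_secD (sZ i) IH); apply: nearW => y; by rewrite big_cons.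
Qed.

(** Multiplication by a bump function extends a section over [U] by zero. *)
Lemma section_cutoff Z x U : open U -> U x -> (forall y, U y -> smooth_sec Z y) ->
  exists phi : M -> R, [/\ forall y, smooth_at y phi,
    \forall y \near x, phi y = 1,
    forall y, ~ U y -> phi y = 0 &
    sections F g setT (fun y => phi y *: Z y)].
Proof.
move=> oU Ux sZ; have [phi [sphi phi1 phi0]] := smooth_bump oU Ux.
exists phi; split=> //; first by move=> y /phi0; exact: nbhs_singleton.
apply/sectionsP; first exact: openT.
split=> [y _|y /(_ I)//]; have [Uy|nUy] := pselect (U y).
  by apply: smooth_secZ => //; exact: sZ.
apply: smooth_sec_near (@smooth_sec0 y).
by apply: filterS (phi0 y nUy) => z ->; rewrite scale0r.
Qed.

Lemma section_germ_extension Z x : smooth_sec Z x ->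
  exists Z', sections F g setT Z' /\ \forall y \near x, Z' y = Z y.
Proof.
move=> sZ; have : nbhs x [set y | smooth_sec Z y] by exact: smooth_sec_nbhs.
rewrite nbhsE => -[U [oU Ux] HU].
have [phi [_ phi1 _ sphi]] := section_cutoff oU Ux HU.
exists (fun y => phi y *: Z y); split=> //.
by apply: filterS phi1 => y ->; rewrite scale1r.
Qed.

End sections_theory.

Lemma smooth_sec_comp (R : realType) (m n p : nat) (M : manifold R m)
    (N : manifold R n) (F : vbundle N p) (g : M -> N) (t : forall y, F y) x :
  smooth_map g -> smooth_sec (g := id) t (g x) -> smooth_sec (fun x => t (g x)) x.
Proof.
move=> sg st c Ac cx i.
exact: (smooth_at_comp (g := fun y => bmap c (t y) 0 i)) (st c Ac cx i).
Qed.

Section standard_frame.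
Variables (R : realType) (n p : nat) (N : manifold R n) (F : vbundle N p).

(** [t] agrees near [y] with the frame attached to [c], so that chart
    components are coefficients on [t]. Asking for equality near [y] only is
    what allows [t] to consist of global sections. *)
Definition frame_near (c : bchart p F) (t : 'I_p -> forall y, F y) (y : N) :=
  bdom c y /\ \forall z \near y, forall a, t a z = binv c z (delta_mx 0 a).

Lemma frame_extension (c : bchart p F) (y : N) : batlas c -> bdom c y ->
  exists t : 'I_p -> forall y, F y,
    (forall a, sections F id setT (t a)) /\ frame_near c t y.
Proof.
move=> Ac cy.
have H (a : 'I_p) : exists t : forall y, F y, sections F id setT t /\
   \forall z \near y, t z = binv c z (delta_mx 0 a).
  apply: (@section_germ_extension _ _ _ _ _ _ _ id) => //; first exact: smooth_map_id.
  apply: (smooth_sec_chart (smooth_map_id N) Ac cy) => i.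
  apply: smooth_at_near (smooth_at_cst y ((delta_mx 0 a : 'rV[R]_p) 0 i)).
  have : nbhs y (bdom c) by apply: open_nbhs_nbhs; split=> //; exact: bdom_open.
  by apply: filterS => z cz; rewrite binvK.
have [t Ht] := choice H.
exists t; split=> [a|]; first by case: (Ht a).
by split=> //; apply: filter_forall => a; case: (Ht a).
Qed.

End standard_frame.

(** * The anchor *)

Section tangent_vectors.
Variables (R : realType) (m : nat) (M : manifold R m) (x : M).
Variable (D : (M -> R) -> R).
Hypothesis tD : tangent_vector x D.
Implicit Types f g : M -> R.

Lemma tangent_nonsmooth f : ~ smooth_at x f -> D f = 0.
Proof. by case: tD => + _ _ _ _; exact. Qed.

Lemma tangent_near f g : smooth_at x f ->
  (\forall y \near x, f y = g y) -> D f = D g.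
Proof.
case: tD => _ + _ _ _ => H sf fg; apply: H => //.
exact: smooth_at_near sf.
Qed.

Lemma tangentD f g : smooth_at x f -> smooth_at x g ->
  D (fun y => f y + g y) = D f + D g.
Proof. by case: tD => _ _ + _ _; exact. Qed.

Lemma tangentZ a f : smooth_at x f -> D (fun y => a * f y) = a * D f.
Proof. by case: tD => _ _ _ + _; exact. Qed.

Lemma tangentM f g : smooth_at x f -> smooth_at x g ->
  D (fun y => f y * g y) = f x * D g + g x * D f.
Proof. by case: tD => _ _ _ _; exact. Qed.

(** The Leibniz rule for 1 = 1 * 1. *)
Lemma tangent_cst a : D (fun=> a) = 0.
Proof.
have s1 := smooth_at_cst x (1 : R).
have D1 : D (fun=> 1) = 0.
  have := tangentM s1 s1; rewrite !mul1r.
  by move=> /eqP; rewrite -subr_eq0 opprD addNKr oppr_eq0 => /eqP.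
have := tangentZ a s1; under eq_fun do rewrite mulr1.
by rewrite D1 mulr0.
Qed.

Lemma tangent_sum (I : Type) (r : seq I) (f : I -> M -> R) :
  (forall i, smooth_at x (f i)) ->
  D (fun y => \sum_(i <- r) f i y) = \sum_(i <- r) D (f i).
Proof.
move=> sf; elim: r => [|i r IH].
  under eq_fun do rewrite big_nil; by rewrite tangent_cst big_nil.
under eq_fun do rewrite big_cons; rewrite tangentD //; last exact: smooth_at_sum.
by rewrite IH big_cons.
Qed.

End tangent_vectors.

Section anchor.
Variables (R : realType) (m n p : nat) (M : manifold R m) (N : manifold R n).
Variables (F : vbundle N p) (G : gla M F).
Local Notation h := (gh G).

Lemma gh_smooth : smooth_map h. Proof. by case: (gh_diffeo G). Qed.
Lemma ghinv_smooth : smooth_map (ghinv G). Proof. by case: (gh_diffeo G). Qed.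
Lemma ghK : cancel h (ghinv G). Proof. by case: (gh_diffeo G). Qed.
Lemma ghinvK : cancel (ghinv G) h. Proof. by case: (gh_diffeo G). Qed.
Lemma getaK : cancel (geta G) (getainv G). Proof. by case: (geta_diffeo G). Qed.
Lemma getainvK : cancel (getainv G) (geta G). Proof. by case: (geta_diffeo G). Qed.

Lemma rho_nonsmooth y (v : F y) f : ~ smooth_at (geta G y) f -> rho G v f = 0.
Proof. by move=> nf; exact: (tangent_nonsmooth (rho_tangent G v) nf). Qed.

Lemma rhoP y (a : R) (v w : F y) f : rho G (a *: v + w) f = a * rho G v f + rho G w f.
Proof.
have [sf|nf] := pselect (smooth_at (geta G y) f); first exact: rho_linear.
by rewrite !rho_nonsmooth // mulr0 addr0.
Qed.

Lemma rhoD y (v w : F y) f : rho G (v + w) f = rho G v f + rho G w f.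
Proof. by have := rhoP 1 v w f; rewrite scale1r mul1r. Qed.

Lemma rho0 y f : rho G (0 : F y) f = 0.
Proof. by apply: (addrI (rho G (0 : F y) f)); rewrite -rhoD !addr0. Qed.

Lemma rhoZ y (a : R) (v : F y) f : rho G (a *: v) f = a * rho G v f.
Proof. by have := rhoP a v 0 f; rewrite rho0 !addr0. Qed.

Lemma rho_sum y (I : Type) (r : seq I) (v : I -> F y) f :
  rho G (\sum_(i <- r) v i) f = \sum_(i <- r) rho G (v i) f.
Proof. by elim: r => [|i r IH]; rewrite ?big_nil ?rho0 // !big_cons rhoD IH. Qed.

Lemma fibre_extension y (v : F y) : exists z, sections F id setT z /\ z y = v.
Proof.
have [c Ac cy] := batlas_cover F y.
pose z0 : forall y', F y' := fun y' => binv c y' (bmap c v).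
have [|z [sz zz0]] := @section_germ_extension _ _ _ _ N N F id (smooth_map_id N) z0 y.
  apply: (smooth_sec_chart (smooth_map_id N) Ac cy) => i.
  apply: smooth_at_near (smooth_at_cst y (bmap c v 0 i)).
  have : nbhs y (bdom c) by apply: open_nbhs_nbhs; split=> //; exact: bdom_open.
  by apply: filterS => z cz; rewrite binvK.
by exists z; split=> //; rewrite (nbhs_singleton zz0) /z0 bmapK.
Qed.

(** [rho v] is a tangent vector at [geta G y], whereas theta reads it at [ghinv
    G y]. If these points differ, evaluate the linearity of theta over the
    functions on N at h (eta y), for a function equal to 1 there and to 0 at y:
    one side contains [rho] of the zero vector and the other is [rho v f]. *)
Lemma rho_off_diagonal y (v : F y) f : geta G y <> ghinv G y -> rho G v f = 0.
Proof.
move=> ne; pose y0 := h (geta G y).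
have y0y : y0 <> y by move=> e; apply: ne; rewrite -{2}e /y0 ghK.
have [z [sz zy]] := fibre_extension v.
have [sf|] := pselect (smooth_at (geta G y) f); last exact: rho_nonsmooth.
have [f' [[sf' _] f'f]] := smooth_germ_extension sf.
(* theta differentiates functions on N, so f is transported along h. *)
pose g := f' \o ghinv G.
have gh : g \o h = f' by apply/funext => x; rewrite /g /= ghK.
have sg : funs setT g.
  split; last by move=> x /(_ I).
  apply/smooth_on_at; first exact: openT.
  move=> y' _; apply: smooth_at_comp ghinv_smooth _.
  by move/(smooth_on_at _ openT): sf'; exact.
have clo : open (~` [set y]).
  apply: closed_openC; apply: accessible_closed_set1; apply: hausdorff_accessible.
  exact: points_hausdorff.
have [phi [sphi phi1 phi0]] := smooth_bump clo y0y.
have fphi : funs setT phi.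
  by split; [apply/smooth_on_at; [exact: openT|move=> ? _] | move=> ? /(_ I)].
have := congr1 (fun k => k y0) (theta_linear G fphi sz sg).
rewrite /theta gh /= /y0 ghK getaK -/y0 zy.
have phiy : phi y = 0 := nbhs_singleton (phi0 y (fun H => H erefl)).
rewrite phiy scale0r rho0 (nbhs_singleton phi1) mul1r => ->.
have sf'y : smooth_at (geta G y) f' by move/(smooth_on_at _ openT): sf'; exact.
by apply/esym; apply: (tangent_near (rho_tangent G v) sf'y).
Qed.

(** When [eta (h x)] is [x] both sides are the same term. Otherwise both vanish
    by [rho_off_diagonal]. *)
Lemma theta_at (z : forall y, F y) g x :
  theta h (ghinv G) (getainv G) (rho G) z g (h x) = rho G (z (h x)) (g \o h).
Proof.
rewrite /theta ghK; have [e|ne] := pselect (geta G (h x) = x).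
  by have -> : getainv G x = h x by rewrite -{1}e getaK.
rewrite [RHS]rho_off_diagonal; last by rewrite ghK.
apply: rho_off_diagonal; rewrite getainvK => e; apply: ne.
by rewrite {1}e ghinvK getainvK.
Qed.

(** If [eta (h x)] is not [x], then [rho v] is zero, hence a derivation at any
    point. *)
Lemma rho_at x (v : F (h x)) : tangent_vector x (rho G v).
Proof.
have [e|ne] := pselect (geta G (h x) = x).
  by have := rho_tangent G v; rewrite e.
have r0 f : rho G v f = 0 by apply: rho_off_diagonal; rewrite ghK.
by split=> *; rewrite !r0 ?mulr0 ?addr0.
Qed.

(** Locally [Z] is a combination of pull-backs of global sections of F, and [f]
    agrees with a global function, so that the smoothness of [rho] on global
    objects applies. Replacing [f] by a global function does not change
    [rhohat], since [rho v] is a derivation at [x] by [rho_at]. *)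
Lemma rhohat_smooth (Z : hsec G) f x :
  smooth_sec Z x -> smooth_at x f -> smooth_at x (rhohat Z f).
Proof.
move=> sZ sf; have [f' [sf' f'f]] := smooth_germ_extension sf.
have [c Ac cx] := batlas_cover F (h x).
have [t [st [_ tx]]] := frame_extension Ac cx.
have nearh (P : N -> Prop) : (\forall y \near h x, P y) -> \forall y \near x, P (h y).
  by case: gh_smooth => + _ => /(_ x); exact.
apply: (@smooth_at_near _ _ _ _
   (fun y => \sum_a bmap c (Z y) 0 a * rho G (t a (h y)) f')).
  have f'fx := nbhs_interior f'f.
  apply: filterS3 (near_bdom gh_smooth cx) (nearh _ tx) f'fx => y cy ty fy.
  have sf'y : smooth_at y f' by case: sf' => /(smooth_on_at _ openT) + _; exact.
  rewrite /rhohat -(tangent_near (rho_at _) sf'y fy).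
  rewrite [in RHS](bmap_decomp cy (Z y)) rho_sum; apply: eq_bigr => a _.
  by rewrite rhoZ ty.
apply: smooth_at_sum => a _; apply: smooth_atM; first exact: sZ.
apply: (smooth_at_comp (g := fun y => rho G (t a y) f')); first exact: gh_smooth.
have := rho_smooth G openT openT (st a) sf'; rewrite preimage_setT setTI.
by move/(smooth_on_at _ openT); exact.
Qed.

(** * The bracket of a generalized Lie algebroid is local *)

Local Notation gsec := (sections F id setT).

Lemma gsecP (u : forall y, F y) : gsec u <-> forall y, smooth_sec (g := id) u y.
Proof.
split=> [/(sectionsP (smooth_map_id N) u openT)[H _] y|H]; first exact: H.
by apply/(sectionsP (smooth_map_id N) u openT); split=> [y _|y /(_ I)].
Qed.

Lemma gsecD (u v : forall y, F y) : gsec u -> gsec v -> gsec (fun y => u y + v y).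
Proof.
move=> /gsecP su /gsecP sv; apply/gsecP => y.
exact: (smooth_secD (smooth_map_id N)).
Qed.

Lemma gsecZ f (u : forall y, F y) : (forall y, smooth_at y f) -> gsec u ->
  gsec (fun y => f y *: u y).
Proof.
by move=> sf /gsecP su; apply/gsecP => y; exact: (smooth_secZ (smooth_map_id N)).
Qed.

Lemma gsec0 : gsec (fun y => 0).
Proof. by apply/gsecP => y; exact: (@smooth_sec0 _ _ _ _ N N F id (smooth_map_id N)). Qed.

Lemma gsec_sum (I : Type) (r : seq I) (u : I -> forall y, F y) :
  (forall i, gsec (u i)) -> gsec (fun y => \sum_(i <- r) u i y).
Proof.
move=> su; apply/gsecP => y; apply: (@smooth_sec_sum _ _ _ _ N N F id (smooth_map_id N)) => i.
by move/gsecP: (su i); exact.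
Qed.

Lemma gbr_anti u v y : gsec u -> gsec v -> gbr G u v y = - gbr G v u y.
Proof.
move=> su sv; have suv := gsecD su sv.
have := gbr_alt G suv => /(congr1 (fun w => w y)).
rewrite gbr_addl // gbr_addr // gbr_addr // gbr_alt // gbr_alt // add0r addr0.
by move/eqP; rewrite addr_eq0 => /eqP.
Qed.

Lemma gbr0r u y : gsec u -> gbr G u (fun=> 0) y = 0.
Proof.
move=> su; have := congr1 (fun w => w y) (gbr_addr G su gsec0 gsec0).
have -> : (fun y : N => (0 : F y) + 0) = fun=> 0.
  by apply: functional_extensionality_dep => z; rewrite addr0.
by move=> /= /eqP; rewrite -subr_eq0 opprD addNKr oppr_eq0 => /eqP.
Qed.

(** If phi is 1 near y and supported where w vanishes, then phi w = 0, and the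
    Leibniz rule for [u, phi w] at y gives [u, w](y) = 0. *)
Lemma gbr_germ0 u w y : gsec u -> gsec w ->
  (\forall z \near y, w z = 0) -> gbr G u w y = 0.
Proof.
move=> su sw w0.
have : nbhs y [set z | w z = 0] by [].
rewrite nbhsE => -[V [oV Vy] Vw].
have [phi [sphi phi1 phi0]] := smooth_bump oV Vy.
have fphi : funs setT phi.
  by split; [apply/smooth_on_at; [exact: openT|move=> ? _] | move=> ? /(_ I)].
have := congr1 (fun k => k y) (gbr_leibniz G su fphi sw).
rewrite (nbhs_singleton phi1) scale1r (nbhs_singleton w0) scaler0 addr0 => <-.
have -> : (fun z => phi z *: w z) = fun=> 0.
  apply: functional_extensionality_dep => z.
  have [/Vw ->|/phi0 nz] := pselect (V z); first by rewrite scaler0.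
  by rewrite (nbhs_singleton nz) scale0r.
by rewrite gbr0r.
Qed.

Lemma gbr_near u v w y : gsec u -> gsec v -> gsec w ->
  (\forall z \near y, v z = w z) -> gbr G u v y = gbr G u w y.
Proof.
move=> su sv sw vw.
have svw : gsec (fun z => v z + (-1) *: w z).
  by apply: gsecD => //; apply: gsecZ => // z; exact: smooth_at_cst.
have {1}-> : v = fun z => w z + (v z + (-1) *: w z).
  by apply: functional_extensionality_dep => z; rewrite scaleN1r addrC subrK.
rewrite gbr_addr // (@gbr_germ0 u (fun z => v z + (-1) *: w z)) ?addr0 //.
by apply: filterS vw => z ->; rewrite scaleN1r subrr.
Qed.

Lemma gbr_comb (I : Type) (r : seq I) u (f : I -> N -> R) (t : I -> forall y, F y) y :
  gsec u -> (forall i, funs setT (f i)) -> (forall i, gsec (t i)) ->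
  gbr G u (fun z => \sum_(i <- r) f i z *: t i z) y =
  \sum_(i <- r) (f i y *: gbr G u (t i) y
                 + theta h (ghinv G) (getainv G) (rho G) u (f i) y *: t i y).
Proof.
move=> su sf st.
have sft i : gsec (fun z => f i z *: t i z).
  by apply: gsecZ => // z; case: (sf i) => /(smooth_on_at _ openT) + _; exact.
elim: r => [|i r IH].
  rewrite big_nil; have -> : (fun z => \sum_(i <- [::]) f i z *: t i z) = fun=> 0.
    by apply: functional_extensionality_dep => z; rewrite big_nil.
  exact: gbr0r.
have -> : (fun z => \sum_(j <- i :: r) f j z *: t j z) =
    fun z => f i z *: t i z + \sum_(j <- r) f j z *: t j z.
  by apply: functional_extensionality_dep => z; rewrite big_cons.
rewrite big_cons gbr_addr //; last exact: gsec_sum.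
by rewrite gbr_leibniz // IH.
Qed.

(** Near [h x] replace [u] and [v] by combinations of the [t a] with global
    coefficients, which does not change the bracket by [gbr_near], then expand
    by additivity and the Leibniz rule. *)
Lemma gbr_coord c (t : 'I_p -> forall y, F y) x u v k :
  batlas c -> (forall a, gsec (t a)) -> frame_near c t (h x) ->
  gsec u -> gsec v ->
  bmap c (gbr G u v (h x)) 0 k =
    \sum_i \sum_j bmap c (u (h x)) 0 i * bmap c (v (h x)) 0 j
                  * bmap c (gbr G (t i) (t j) (h x)) 0 k
    + rho G (u (h x)) (fun x' => bmap c (v (h x')) 0 k)
    - rho G (v (h x)) (fun x' => bmap c (u (h x')) 0 k).
Proof.
move=> Ac st [cx tx] su sv.
have ext w : gsec w -> exists f : 'I_p -> N -> R, (forall i, funs setT (f i)) /\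
    \forall y \near h x, forall i, f i y = bmap c (w y) 0 i.
  move=> /gsecP sw.
  have [f Hf] := choice (fun i => smooth_germ_extension (sw (h x) c Ac cx i)).
  exists f; split=> [i|]; first by case: (Hf i).
  by apply: filter_forall => i; case: (Hf i).
(* f and e are global extensions of the chart components of u and v. *)
have [f [ff fu]] := ext u su; have [e [fe ev]] := ext v sv.
have near_c : \forall y \near h x, bdom c y.
  by apply: open_nbhs_nbhs; split=> //; exact: bdom_open.
have comb w (a : 'I_p -> N -> R) : (\forall y \near h x, forall i, a i y = bmap c (w y) 0 i) ->
    \forall y \near h x, w y = \sum_(i <- index_enum 'I_p) a i y *: t i y.
  move=> aw; apply: filterS3 near_c tx aw => y cy ty ay.
  by rewrite {1}(bmap_decomp cy (w y)); apply: eq_bigr => i _; rewrite ay ty.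
have scomb (a : 'I_p -> N -> R) : (forall i, funs setT (a i)) ->
    gsec (fun y => \sum_(i <- index_enum 'I_p) a i y *: t i y).
  move=> sa; apply: gsec_sum => i; apply: gsecZ => // y.
  by case: (sa i) => /(smooth_on_at _ openT) + _; exact.
have nearh (P : N -> Prop) : (\forall y \near h x, P y) -> \forall y \near x, P (h y).
  by case: gh_smooth => + _ => /(_ x); exact.
have Dext (w : F (h x)) (a : 'I_p -> N -> R) (z : forall y, F y) i :
    (forall i, funs setT (a i)) ->
    (\forall y \near h x, forall i, a i y = bmap c (z y) 0 i) ->
    rho G w (a i \o h) = rho G w (fun x' => bmap c (z (h x')) 0 i).
  move=> sa az; apply: (tangent_near (rho_at w)).
    apply: smooth_at_comp gh_smooth _.
    by case: (sa i) => /(smooth_on_at _ openT) + _; exact.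
  by apply: filterS (nearh _ az) => y; exact.
rewrite (gbr_near su sv (scomb e fe) (comb v e ev)) gbr_comb // bmap_sum // summxE.
have tk i j : bmap c (t i (h x)) 0 j = (i == j)%:R.
  by rewrite (nbhs_singleton tx) binvK // mxE eqxx /= eq_sym.
have tsum (w : 'I_p -> R) : \sum_i w i * bmap c (t i (h x)) 0 k = w k.
  rewrite (bigD1 k) //= tk eqxx mulr1 big1 ?addr0 // => i ne.
  by rewrite tk (negbTE ne) mulr0.
under eq_bigr => j _.
  rewrite bmapD // !bmapZ // !mxE gbr_anti // bmapN // mxE.
  rewrite (gbr_near (st j) su (scomb f ff) (comb u f fu)) gbr_comb // bmap_sum // summxE.
  under eq_bigr => i _ do rewrite bmapD // !bmapZ // !mxE.
  rewrite big_split /= tsum theta_at.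
  rewrite (Dext _ _ _ _ ff fu).
  over.
rewrite big_split /= tsum theta_at (Dext _ _ _ _ fe ev).
rewrite addrAC; congr (_ + _).
under eq_bigr => j _ do rewrite (nbhs_singleton ev) opprD mulrDr !mulrN.
rewrite big_split /= [X in _ + X]sumrN; congr (_ - _).
  rewrite exchange_big; apply: eq_bigr => j _ /=.
  rewrite mulr_sumr -sumrN; apply: eq_bigr => i _.
  rewrite (nbhs_singleton fu) (gbr_anti _ (st i) (st j)) bmapN // mxE.
  ring.
rewrite {2}(bmap_decomp cx (v (h x))) rho_sum; apply: eq_bigr => j _.
by rewrite rhoZ (nbhs_singleton tx).
Qed.

End anchor.

(** * The bracket of the pull-back Lie algebroid in coordinates *)

(** The algebra behind the independence of the frame: the left-hand side is the
    defining expression of the bracket in a frame s, with g its coefficients on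
    a reference frame, A the derivatives of these coefficients, and P, Q the
    derivatives of the components w, z. The right-hand side is the same
    expression in the reference frame. *)
Lemma bilinear_change_of_frame (R : comRingType) (p : nat) (k : 'I_p)
    (z w : 'I_p -> R) (g L A P Q : 'I_p -> 'I_p -> R) :
  \sum_a \sum_b (z a * w b * (\sum_i \sum_j g a i * g b j * L i j + A a b - A b a)
     + z a * P a b * g b k - w b * Q b a * g a k) =
  \sum_i \sum_j (\sum_a z a * g a i) * (\sum_b w b * g b j) * L i j
  + \sum_b (w b * (\sum_a z a * A a b) + g b k * (\sum_a z a * P a b))
  - \sum_a (z a * (\sum_b w b * A b a) + g a k * (\sum_b w b * Q b a)).
Proof.
have -> : \sum_i \sum_j (\sum_a z a * g a i) * (\sum_b w b * g b j) * L i j =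
   \sum_a \sum_b z a * w b * (\sum_i \sum_j g a i * g b j * L i j).
  under eq_bigr => i _ do under eq_bigr => j _ do rewrite mulr_suml mulr_suml.
  under [RHS]eq_bigr => a _ do under eq_bigr => b _ do
    (rewrite mulr_sumr; under eq_bigr => i _ do rewrite mulr_sumr).
  under eq_bigr => i _ do rewrite exchange_big.
  rewrite exchange_big; apply: eq_bigr => a _ /=.
  rewrite [RHS]exchange_big; apply: eq_bigr => i _ /=.
  rewrite [RHS]exchange_big; apply: eq_bigr => j _ /=.
  rewrite mulr_sumr mulr_suml; apply: eq_bigr => b _; ring.
have -> : \sum_b (w b * (\sum_a z a * A a b) + g b k * (\sum_a z a * P a b)) =
   \sum_a \sum_b (z a * w b * A a b + z a * P a b * g b k).
  rewrite [RHS]exchange_big; apply: eq_bigr => b _ /=.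
  by rewrite !mulr_sumr -big_split; apply: eq_bigr => a _ /=; ring.
have -> : \sum_a (z a * (\sum_b w b * A b a) + g a k * (\sum_b w b * Q b a)) =
   \sum_a \sum_b (z a * w b * A b a + w b * Q b a * g a k).
  apply: eq_bigr => b _ /=.
  by rewrite !mulr_sumr -big_split; apply: eq_bigr => a _ /=; ring.
rewrite -big_split -sumrB; apply: eq_bigr => a _ /=.
by rewrite -big_split -sumrB; apply: eq_bigr => b _ /=; ring.
Qed.

Section bracket.
Variables (R : realType) (m n p : nat) (M : manifold R m) (N : manifold R n).
Variables (F : vbundle N p) (G : gla M F).
Local Notation h := (gh G).
Local Notation gsec := (sections F id setT).
Implicit Types (Z W Y : hsec G) (x : M) (U : set M).

(** The rules for [T_a, f T_b] and [f T_a, T_b] summed up in the components of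
    a bundle chart: their terms with derivatives assemble into the anchors of
    [Z] and [W]. *)
Definition bracket_coord (c : bchart p F) (t : 'I_p -> forall y, F y) Z W x (k : 'I_p) : R :=
  \sum_i \sum_j bmap c (Z x) 0 i * bmap c (W x) 0 j
                * bmap c (gbr G (t i) (t j) (h x)) 0 k
  + rho G (Z x) (fun y => bmap c (W y) 0 k)
  - rho G (W x) (fun y => bmap c (Z y) 0 k).

Lemma near_gh x (P : N -> Prop) : (\forall y \near h x, P y) -> \forall y \near x, P (h y).
Proof. by case: (gh_smooth G) => + _ => /(_ x); exact. Qed.

Lemma frame_basis (c : bchart p F) (t : 'I_p -> forall y, F y) y :
  bdom c y -> (forall a, t a y = binv c y (delta_mx 0 a)) ->
  is_basis setT (fun a => t a y).
Proof.
move=> cy ty; have E v : lcomb (fun a => t a y) v = binv c y v.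
  apply: (bmap_inj cy) => /=; rewrite /lcomb bmap_sum // binvK //.
  rewrite [RHS]row_sum_delta; apply: eq_bigr => a _.
  by rewrite bmapZ // ty binvK.
split; first by move=> v w; rewrite !E => e; rewrite -(binvK cy v) e binvK.
by apply/seteqP; split=> // v _; exists (bmap c v) => //; rewrite E bmapK.
Qed.

(** This shows that the defining expression of the bracket does not depend on
    the frame and coefficients chosen, hence that the value selected by
    [hbracket] obeys one formula. *)
Lemma hbracket_at_coord c t x Z W b k :
  batlas c -> (forall a, gsec (t a)) -> frame_near c t (h x) ->
  hbracket_at Z W x b -> bmap c b 0 k = bracket_coord c t Z W x k.
Proof.
move=> Ac st ft [s [Zc [Wc [ss _ sZW ZWs ->]]]]; have [cx tx] := ft.
have nc := near_bdom (gh_smooth G) cx.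
have scoord a k' : smooth_at x (fun y => bmap c (s a (h y)) 0 k').
  by have := smooth_sec_comp (x := x) (gh_smooth G) ((gsecP (s a)).1 (ss a) (h x)); exact.
have ZE k' : \forall y \near x, \sum_a Zc a y * bmap c (s a (h y)) 0 k' = bmap c (Z y) 0 k'.
  apply: filterS2 nc ZWs => y cy [-> _]; rewrite bmap_sum // summxE.
  by apply: eq_bigr => a _; rewrite bmapZ // mxE.
have WE k' : \forall y \near x, \sum_a Wc a y * bmap c (s a (h y)) 0 k' = bmap c (W y) 0 k'.
  apply: filterS2 nc ZWs => y cy [_ ->]; rewrite bmap_sum // summxE.
  by apply: eq_bigr => a _; rewrite bmapZ // mxE.
have [ZxE WxE] := nbhs_singleton ZWs.
have sZc a : smooth_at x (Zc a) by case: (sZW a).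
have sWc a : smooth_at x (Wc a) by case: (sZW a).
have rhoE (v : F (h x)) (Yc : 'I_p -> M -> R) Y :
   (forall a, smooth_at x (Yc a)) ->
   (\forall y \near x, \sum_a Yc a y * bmap c (s a (h y)) 0 k = bmap c (Y y) 0 k) ->
   rho G v (fun y => bmap c (Y y) 0 k) =
   \sum_b (Yc b x * rho G v (fun y => bmap c (s b (h y)) 0 k)
          + bmap c (s b (h x)) 0 k * rho G v (Yc b)).
  move=> sY YE; have tv := rho_at v.
  rewrite -(tangent_near tv _ YE); last first.
    by apply: smooth_at_sum => a _; exact: smooth_atM.
  rewrite (tangent_sum tv); last by move=> a; exact: smooth_atM.
  by apply: eq_bigr => b' _; rewrite (tangentM tv).
rewrite /bracket_coord (rhoE _ _ _ sWc (WE k)) (rhoE _ _ _ sZc (ZE k)).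
have rZ f : rho G (Z x) f = \sum_a Zc a x * rho G (s a (h x)) f.
  by rewrite ZxE rho_sum; apply: eq_bigr => a _; rewrite rhoZ.
have rW f : rho G (W x) f = \sum_a Wc a x * rho G (s a (h x)) f.
  by rewrite WxE rho_sum; apply: eq_bigr => a _; rewrite rhoZ.
under [in RHS]eq_bigr => i _ do under eq_bigr => j _ do
  rewrite -(nbhs_singleton (ZE i)) -(nbhs_singleton (WE j)).
under [X in _ = _ + X - _]eq_bigr => i _ do rewrite !rZ.
under [X in _ = _ + _ - X]eq_bigr => i _ do rewrite !rW.
rewrite -bilinear_change_of_frame bmap_sum // summxE; apply: eq_bigr => a _.
rewrite bmap_sum // summxE; apply: eq_bigr => b' _.
rewrite !bmapD // bmapN // !bmapZ // !mxE.
by rewrite (gbr_coord k Ac st ft (ss a) (ss b')).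
Qed.

Lemma hbracket_at_nonempty Z W x : smooth_sec Z x -> smooth_sec W x ->
  hbracket_at Z W x !=set0.
Proof.
move=> sZ sW; have [c Ac cx] := batlas_cover F (h x).
have [t [st ft]] := frame_extension Ac cx; have [_ tx] := ft.
have nc := near_bdom (gh_smooth G) cx.
eexists; exists t, (fun a y => bmap c (Z y) 0 a), (fun a y => bmap c (W y) 0 a).
split=> //.
- have ncN : \forall y \near h x, bdom c y.
    by apply: open_nbhs_nbhs; split=> //; exact: bdom_open.
  by apply: filterS2 ncN tx => y cy ty; exact: frame_basis cy ty.
- by move=> a; split; [exact: sZ|exact: sW].
apply: filterS2 nc (near_gh tx) => y cy ty.
split; [rewrite {1}(bmap_decomp cy (Z y))|rewrite {1}(bmap_decomp cy (W y))];
  by apply: eq_bigr => a _; rewrite ty.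
Qed.

Lemma hbracketE U c t x Z W k :
  batlas c -> (forall a, gsec (t a)) -> frame_near c t (h x) ->
  U x -> smooth_sec Z x -> smooth_sec W x ->
  bmap c (hbracket U Z W x) 0 k = bracket_coord c t Z W x k.
Proof.
move=> Ac st ft Ux sZ sW; rewrite /hbracket mem_set //.
apply: hbracket_at_coord => //.
by apply: xgetPex; exact: hbracket_at_nonempty.
Qed.

(** Each term of [bracket_coord] depends only on germs. *)
Lemma hbracket_ext U U' Z W Z' W' x : U x -> U' x ->
  smooth_sec Z x -> smooth_sec W x ->
  (\forall y \near x, Z y = Z' y) -> (\forall y \near x, W y = W' y) ->
  hbracket U Z W x = hbracket U' Z' W' x.
Proof.
move=> Ux U'x sZ sW ZZ' WW'.
have sZ' := smooth_sec_near ZZ' sZ; have sW' := smooth_sec_near WW' sW.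
have [c Ac cx] := batlas_cover F (h x).
have [t [st ft]] := frame_extension Ac cx.
apply: (bmap_inj cx); apply/rowP => k; rewrite !(hbracketE k Ac st ft) //.
have near_rho (v : F (h x)) Y Y' : smooth_sec Y x -> (\forall y \near x, Y y = Y' y) ->
   rho G v (fun y => bmap c (Y y) 0 k) = rho G v (fun y => bmap c (Y' y) 0 k).
  move=> sY YY'; apply: (tangent_near (rho_at v)); first exact: sY.
  by apply: filterS YY' => y ->.
rewrite /bracket_coord (near_rho _ _ _ sZ ZZ') (near_rho _ _ _ sW WW').
by rewrite (nbhs_singleton ZZ') (nbhs_singleton WW').
Qed.

Lemma frame_near_nbhs c (t : 'I_p -> forall y, F y) y : frame_near c t y ->
  \forall z \near y, frame_near c t z.
Proof.
move=> [cy ty]; have ty' := nbhs_interior ty.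
have nc : \forall z \near y, bdom c z.
  by apply: open_nbhs_nbhs; split=> //; exact: bdom_open.
by apply: filterS2 nc ty' => z cz tz.
Qed.

(** The frame [t] of [bracket_coord] can be kept fixed while the point moves
    near [x]. *)
Lemma smooth_sec_hbracket U Z W x : open U -> U x -> smooth_sec Z x -> smooth_sec W x ->
  smooth_sec (hbracket U Z W) x.
Proof.
move=> oU Ux sZ sW; have [c Ac cx] := batlas_cover F (h x).
have [t [st ft]] := frame_extension Ac cx.
apply: (smooth_sec_chart (gh_smooth G) Ac cx) => k.
have coord_smooth Y i : smooth_sec Y x -> smooth_at x (fun y => bmap c (Y y) 0 i).
  by move=> sY; exact: sY.
apply: (@smooth_at_near _ _ _ _ (fun y => bracket_coord c t Z W y k)).
  have nU : nbhs x U by exact: open_nbhs_nbhs.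
  have nZ := smooth_sec_nbhs (gh_smooth G) sZ; have nW := smooth_sec_nbhs (gh_smooth G) sW.
  apply: filterS3 (near_gh (frame_near_nbhs ft)) nU (filterI nZ nW).
  by move=> y fy Uy [sZy sWy]; rewrite (hbracketE k Ac st fy).
apply: smooth_atB; [apply: smooth_atD|].
- apply: smooth_at_sum => i _; apply: smooth_at_sum => j _; apply: smooth_atM.
    by apply: smooth_atM; exact: coord_smooth.
  apply: (smooth_at_comp (g := fun y => bmap c (gbr G (t i) (t j) y) 0 k)).
    exact: gh_smooth.
  by apply: ((gsecP _).1 (gbr_section G (st i) (st j)) (h x)).
- by apply: (rhohat_smooth sZ); exact: coord_smooth.
- by apply: (rhohat_smooth sW); exact: coord_smooth.
Qed.

Section pointwise_rules.
Variables (U : set M) (x : M) (Ux : U x).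

Lemma hbracket_anti Z W : smooth_sec Z x -> smooth_sec W x ->
  hbracket U Z W x = - hbracket U W Z x.
Proof.
move=> sZ sW; have [c Ac cx] := batlas_cover F (h x).
have [t [st ft]] := frame_extension Ac cx.
apply: (bmap_inj cx); apply/rowP => k.
rewrite bmapN // mxE !(hbracketE k Ac st ft) // /bracket_coord.
have -> : \sum_i \sum_j bmap c (Z x) 0 i * bmap c (W x) 0 j * bmap c (gbr G (t i) (t j) (h x)) 0 k =
   - \sum_i \sum_j bmap c (W x) 0 i * bmap c (Z x) 0 j * bmap c (gbr G (t i) (t j) (h x)) 0 k.
  rewrite exchange_big -sumrN; apply: eq_bigr => i _ /=.
  rewrite -sumrN; apply: eq_bigr => j _ /=.
  rewrite (gbr_anti G _ (st j) (st i)) bmapN // mxE; ring.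
ring.
Qed.

Lemma hbracketxx Z : smooth_sec Z x -> hbracket U Z Z x = 0.
Proof.
move=> sZ; have := hbracket_anti sZ sZ => /eqP.
rewrite -subr_eq0 opprK -mulr2n -scaler_nat scaler_eq0 pnatr_eq0 /=.
by move/eqP.
Qed.

Lemma hbracketDr Z W W' : smooth_sec Z x -> smooth_sec W x -> smooth_sec W' x ->
  hbracket U Z (fun y => W y + W' y) x = hbracket U Z W x + hbracket U Z W' x.
Proof.
move=> sZ sW sW'; have [c Ac cx] := batlas_cover F (h x).
have [t [st ft]] := frame_extension Ac cx.
have sWW' := smooth_secD (gh_smooth G) sW sW'.
apply: (bmap_inj cx); apply/rowP => k.
rewrite bmapD // mxE !(hbracketE k Ac st ft) // /bracket_coord rhoD.
have -> : rho G (Z x) (fun y => bmap c (W y + W' y) 0 k) =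
    rho G (Z x) (fun y => bmap c (W y) 0 k) + rho G (Z x) (fun y => bmap c (W' y) 0 k).
  rewrite -(tangentD (rho_at (Z x)) (sW c Ac cx k) (sW' c Ac cx k)).
  apply: (tangent_near (rho_at (Z x))); first exact: sWW'.
  by apply: filterS (near_bdom (gh_smooth G) cx) => y cy; rewrite bmapD // mxE.
under eq_bigr => i _ do under eq_bigr => j _ do rewrite bmapD // mxE mulrDr mulrDl.
under eq_bigr => i _ do rewrite big_split.
rewrite big_split /=; ring.
Qed.

Lemma hbracketZr Z W f : smooth_sec Z x -> smooth_sec W x -> smooth_at x f ->
  hbracket U Z (fun y => f y *: W y) x =
  f x *: hbracket U Z W x + rho G (Z x) f *: W x.
Proof.
move=> sZ sW sf; have [c Ac cx] := batlas_cover F (h x).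
have [t [st ft]] := frame_extension Ac cx.
have sfW := smooth_secZ (gh_smooth G) sf sW.
apply: (bmap_inj cx); apply/rowP => k.
rewrite bmapD // !bmapZ // !mxE !(hbracketE k Ac st ft) // /bracket_coord rhoZ.
have -> : rho G (Z x) (fun y => bmap c (f y *: W y) 0 k) =
    f x * rho G (Z x) (fun y => bmap c (W y) 0 k) + bmap c (W x) 0 k * rho G (Z x) f.
  rewrite -(tangentM (rho_at (Z x)) sf (sW c Ac cx k)).
  apply: (tangent_near (rho_at (Z x))); first exact: sfW.
  by apply: filterS (near_bdom (gh_smooth G) cx) => y cy; rewrite bmapZ // mxE.
under eq_bigr => i _ do under eq_bigr => j _ do
  rewrite bmapZ // mxE [_ * (f x * _)]mulrCA -mulrA.
under eq_bigr => i _ do rewrite -mulr_sumr.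
rewrite -mulr_sumr; ring.
Qed.

End pointwise_rules.
End bracket.

(** * Functions and sections over an open set *)

Section local_sections.
Variables (R : realType) (m n p : nat) (M : manifold R m) (N : manifold R n).
Variables (F : vbundle N p) (G : gla M F) (U : set M).
Hypothesis oU : open U.
Implicit Types (Z W Y : hsec G) (x : M) (f : M -> R).
Local Notation secb Z := (Z \in hsections G U).

Lemma funsP f : funs U f <-> (forall x, U x -> smooth_at x f) /\ forall x, ~ U x -> f x = 0.
Proof. by rewrite /funs /=; split=> -[H1 H2]; split=> //; apply/(smooth_on_at _ oU). Qed.

Lemma hsecP Z : secb Z <-> (forall x, U x -> smooth_sec Z x) /\ forall x, ~ U x -> Z x = 0.
Proof.
rewrite inE; exact: (sectionsP (gh_smooth G) Z oU).
Qed.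

Lemma funsD f g : funs U f -> funs U g -> funs U (fun x => f x + g x).
Proof.
move=> /funsP[sf f0] /funsP[sg g0]; apply/funsP; split=> x Ux.
  by apply: smooth_atD; [exact: sf|exact: sg].
by rewrite f0 // g0 // addr0.
Qed.

Lemma funsM f g : funs U f -> funs U g -> funs U (fun x => f x * g x).
Proof.
move=> /funsP[sf f0] /funsP[sg g0]; apply/funsP; split=> x Ux.
  by apply: smooth_atM; [exact: sf|exact: sg].
by rewrite f0 // mul0r.
Qed.

Lemma funsZ (a : R) f : funs U f -> funs U (fun x => a * f x).
Proof.
move=> /funsP[sf f0]; apply/funsP; split=> x Ux; first exact/smooth_atZ/sf.
by rewrite f0 // mulr0.
Qed.

Lemma funsN f : funs U f -> funs U (fun x => - f x).
Proof.
move=> /funsP[sf f0]; apply/funsP; split=> x Ux; first exact/smooth_atN/sf.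
by rewrite f0 // oppr0.
Qed.

Lemma funs0 : funs U (fun=> 0).
Proof. by apply/funsP; split=> // x _; exact: smooth_at_cst. Qed.

Lemma funs_sum (I : Type) (r : seq I) (f : I -> M -> R) :
  (forall i, funs U (f i)) -> funs U (fun x => \sum_(i <- r) f i x).
Proof.
move=> sf; elim: r => [|i r IH].
  by under eq_fun do rewrite big_nil; exact: funs0.
by under eq_fun do rewrite big_cons; exact: funsD.
Qed.

Lemma hsecD Z W : secb Z -> secb W -> secb (fun x => Z x + W x).
Proof.
move=> /hsecP[sZ Z0] /hsecP[sW W0]; apply/hsecP; split=> x Ux.
  by apply: (smooth_secD (gh_smooth G)); [exact: sZ|exact: sW].
by rewrite Z0 // W0 // addr0.
Qed.

Lemma hsecZ f Z : funs U f -> secb Z -> secb (fun x => f x *: Z x).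
Proof.
move=> /funsP[sf f0] /hsecP[sZ Z0]; apply/hsecP; split=> x Ux.
  by apply: (smooth_secZ (gh_smooth G)); [exact: sf|exact: sZ].
by rewrite Z0 // scaler0.
Qed.

Lemma hsec0 : secb (fun x => 0).
Proof.
by apply/hsecP; split=> // x _; exact: (@smooth_sec0 _ _ _ _ M N F (gh G) (gh_smooth G)).
Qed.

Lemma hsec_bracket Z W : secb Z -> secb W -> secb (hbracket U Z W).
Proof.
move=> /hsecP[sZ Z0] /hsecP[sW W0]; apply/hsecP; split=> x Ux.
  by apply: smooth_sec_hbracket => //; [exact: sZ|exact: sW].
by rewrite /hbracket memNset.
Qed.

Lemma funs_rhohat Z f : secb Z -> funs U f -> funs U (rhohat Z f).
Proof.
move=> /hsecP[sZ Z0] /funsP[sf f0]; apply/funsP; split=> x Ux.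
  by apply: rhohat_smooth; [exact: sZ|exact: sf].
by rewrite /rhohat Z0 // rho0.
Qed.

Lemma hbracketDr_fun Z W W' : secb Z -> secb W -> secb W' ->
  hbracket U Z (fun x => W x + W' x) = fun x => hbracket U Z W x + hbracket U Z W' x.
Proof.
move=> /hsecP[sZ _] /hsecP[sW _] /hsecP[sW' _].
apply: functional_extensionality_dep => x.
have [Ux|nUx] := pselect (U x); last by rewrite /hbracket !memNset // addr0.
by rewrite hbracketDr //; [exact: sZ|exact: sW|exact: sW'].
Qed.

Lemma hbracketZr_fun Z W f : secb Z -> secb W -> funs U f ->
  hbracket U Z (fun x => f x *: W x) =
  fun x => f x *: hbracket U Z W x + rhohat Z f x *: W x.
Proof.
move=> /hsecP[sZ _] /hsecP[sW W0] /funsP[sf f0].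
apply: functional_extensionality_dep => x.
have [Ux|nUx] := pselect (U x); last first.
  by rewrite /hbracket !memNset // W0 // !scaler0 addr0.
by rewrite hbracketZr //; [exact: sZ|exact: sW|exact: sf].
Qed.

Lemma hbracket_anti_fun Z W : secb Z -> secb W ->
  hbracket U Z W = fun x => (-1) *: hbracket U W Z x.
Proof.
move=> /hsecP[sZ _] /hsecP[sW _]; apply: functional_extensionality_dep => x.
have [Ux|nUx] := pselect (U x); last by rewrite /hbracket !memNset // scaler0.
by rewrite hbracket_anti // ?scaleN1r //; [exact: sZ|exact: sW].
Qed.

Lemma hbracketxx_fun Z : secb Z -> hbracket U Z Z = fun=> 0.
Proof.
move=> /hsecP[sZ _]; apply: functional_extensionality_dep => x.
have [Ux|nUx] := pselect (U x); last by rewrite /hbracket !memNset.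
by rewrite hbracketxx //; exact: sZ.
Qed.

End local_sections.

(** * The exterior algebra and contractions *)

Section exterior_algebra.
Variables (R : realType) (m n p : nat) (M : manifold R m) (N : manifold R n).
Variables (F : vbundle N p) (G : gla M F) (U : set M).
Hypothesis oU : open U.
Implicit Types (Z W Y : hsec G) (x : M) (f : M -> R) (s : seq (hsec G)) (w v : form G).
Local Notation secb Z := (Z \in hsections G U).
Local Notation ext := (exterior U).

Definition contract Z w : form G := fun s => w (Z :: s).

Lemma all_sec_cat s1 s2 : all_sec U (s1 ++ s2) = all_sec U s1 && all_sec U s2.
Proof. exact: all_cat. Qed.

Lemma all_sec_cons Z s : all_sec U (Z :: s) = secb Z && all_sec U s.
Proof. by []. Qed.

Definition all_secE := (all_sec_cat, all_sec_cons).

Lemma ext_funs w s : ext w -> funs U (w s).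
Proof.
case=> H1 H2 _ _ _; case: (boolP (all_sec U s)) => [/H1//|/H2 ->].
exact: funs0.
Qed.

Lemma ext_nonsec w s : ext w -> ~~ all_sec U s -> w s = fun=> 0.
Proof. by case=> _ H _ _ _; exact: H. Qed.

Lemma extD w s1 s2 Z W : ext w -> secb Z -> secb W ->
  w (s1 ++ (fun x => Z x + W x) :: s2) =
  fun x => w (s1 ++ Z :: s2) x + w (s1 ++ W :: s2) x.
Proof.
move=> ew sZ sW; have sZW := hsecD oU sZ sW.
case: (boolP (all_sec U s1 && all_sec U s2)) => H.
  by case: ew => _ _ H' _ _; apply: H'; rewrite !all_secE sZ sW.
by rewrite !(ext_nonsec ew) ?all_secE ?sZ ?sW ?sZW //; apply/funext => x; rewrite addr0.
Qed.

Lemma extZ w s1 s2 f Z : ext w -> funs U f -> secb Z ->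
  w (s1 ++ (fun x => f x *: Z x) :: s2) = fun x => f x * w (s1 ++ Z :: s2) x.
Proof.
move=> ew sf sZ; have sfZ := hsecZ oU sf sZ.
case: (boolP (all_sec U s1 && all_sec U s2)) => H.
  by case: ew => _ _ _ H' _; apply: H' => //; rewrite !all_secE sZ.
by rewrite !(ext_nonsec ew) ?all_secE ?sZ ?sfZ //; apply/funext => x; rewrite mulr0.
Qed.

Lemma ext_alt w s1 s2 s3 Z : ext w -> w (s1 ++ Z :: s2 ++ Z :: s3) = fun=> 0.
Proof.
move=> ew; case: (boolP (all_sec U (s1 ++ Z :: s2 ++ Z :: s3))) => H.
  by case: ew => _ _ _ _; exact.
exact: ext_nonsec.
Qed.

(** Vanishing on equal neighbours implies antisymmetry under adjacent
    transpositions, which moves two equal arguments next to each other.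
    Neighbours are all that the recursive computations below can see. *)
Lemma exterior_adjacent w :
  (forall s, all_sec U s -> funs U (w s)) ->
  (forall s, ~~ all_sec U s -> w s = fun=> 0) ->
  (forall s1 s2 Z W, all_sec U s1 -> all_sec U s2 -> secb Z -> secb W ->
    w (s1 ++ (fun x => Z x + W x) :: s2) =
    fun x => w (s1 ++ Z :: s2) x + w (s1 ++ W :: s2) x) ->
  (forall s1 s2 f Z, all_sec U s1 -> all_sec U s2 -> funs U f -> secb Z ->
    w (s1 ++ (fun x => f x *: Z x) :: s2) = fun x => f x * w (s1 ++ Z :: s2) x) ->
  (forall s1 s2 Z, all_sec U s1 -> all_sec U s2 -> secb Z ->
    w (s1 ++ Z :: Z :: s2) = fun=> 0) ->
  ext w.
Proof.
move=> H1 H2 H3 H4 H5; split=> //.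
- move=> s1 s2 Z W; rewrite !all_secE => /and4P[? ? ? ?]; exact: H3.
- move=> s1 s2 f Z sf; rewrite !all_secE => /and3P[? ? ?]; exact: H4.
move=> s1 s2 s3 Z; rewrite !all_secE => /and5P[a1 aZ a2 _ a3].
have swap t1 t2 X Y : all_sec U t1 -> all_sec U t2 -> secb X -> secb Y ->
    w (t1 ++ X :: Y :: t2) = fun x => - w (t1 ++ Y :: X :: t2) x.
  move=> b1 b2 sX sY; have sXY := hsecD oU sX sY.
  have := H5 t1 t2 _ b1 b2 sXY.
  rewrite H3 ?all_secE ?sXY // => E; apply/funext => x.
  have := congr1 (fun k => k x) E => /=.
  rewrite -cat_rcons -(cat_rcons Y) !H3 ?all_sec_cons /all_sec ?all_rcons ?sX ?sY //.
  rewrite !cat_rcons !H5 // add0r addr0 => /eqP; rewrite addr_eq0 => /eqP //.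
elim: s2 s1 a1 a2 => [|Y s2 IH] s1 a1; first by move=> _; exact: H5.
rewrite all_sec_cons => /andP[aY a2] /=.
have a23 : all_sec U (s2 ++ Z :: s3) by rewrite !all_secE a2 aZ a3.
rewrite (swap _ _ _ _ a1 a23 aZ aY); apply/funext => x; rewrite -cat_rcons IH ?oppr0 //.
by rewrite -cats1 !all_secE a1 aY.
Qed.

(** Expand w(.., Z + W, Z + W, ..) = 0. *)
Lemma ext_swap w s1 s2 Z W x : ext w ->
  w (s1 ++ Z :: W :: s2) x = - w (s1 ++ W :: Z :: s2) x.
Proof.
move=> ew; case: (boolP (secb Z && secb W)) => [/andP[sZ sW]|nZW].
  have E := congr1 (fun k => k x) (ext_alt s1 [::] s2 (fun x => Z x + W x) ew).
  move: E; rewrite /= extD // -cat_rcons -(cat_rcons W) !extD // !cat_rcons.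
  rewrite (ext_alt s1 [::] s2 Z ew) (ext_alt s1 [::] s2 W ew) add0r addr0.
  by move/eqP; rewrite addr_eq0 => /eqP.
have [n1 n2] : ~~ all_sec U (s1 ++ Z :: W :: s2) /\ ~~ all_sec U (s1 ++ W :: Z :: s2).
  by move: nZW; rewrite !all_secE; case: (secb Z); case: (secb W); rewrite //= ?andbF.
by rewrite !(ext_nonsec ew) // oppr0.
Qed.

Lemma ext0 : ext ((fun _ _ => 0) : form G).
Proof.
apply: exterior_adjacent => // *; first exact: funs0.
  by apply/funext => x; rewrite addr0.
by apply/funext => x; rewrite mulr0.
Qed.

Lemma ext_add w v : ext w -> ext v -> ext (fun s x => w s x + v s x).
Proof.
move=> ew ev; apply: exterior_adjacent => [s _|s ns|s1 s2 Z W _ _ sZ sW|s1 s2 f Z _ _ sf sZ|s1 s2 Z _ _ sZ].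
- by apply: funsD => //; exact: ext_funs.
- by rewrite !ext_nonsec //; apply/funext => x; rewrite addr0.
- by rewrite !extD //; apply/funext => x; rewrite addrACA.
- by rewrite !extZ //; apply/funext => x; rewrite mulrDr.
- by rewrite (ext_alt s1 [::]) // (ext_alt s1 [::]) //; apply/funext => x; rewrite addr0.
Qed.

Lemma ext_scale w (a : nat -> R) : ext w -> ext (fun s x => a (size s) * w s x).
Proof.
move=> ew; apply: exterior_adjacent => [s _|s ns|s1 s2 Z W _ _ sZ sW|s1 s2 g Z _ _ sg sZ|s1 s2 Z _ _ sZ].
- by apply: funsZ => //; exact: ext_funs.
- by rewrite !ext_nonsec //; apply/funext => x; rewrite mulr0.
- by rewrite !extD //; apply/funext => x; rewrite !size_cat /= mulrDr.
- by rewrite !extZ //; apply/funext => x; rewrite !size_cat /= mulrCA.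
- by rewrite (ext_alt s1 [::]) //; apply/funext => x; rewrite mulr0.
Qed.

Lemma ext_contract w Z : ext w -> ext (contract Z w).
Proof.
move=> ew; rewrite /contract; apply: exterior_adjacent => [s _|s ns|s1 s2 Y W _ _ sY sW|s1 s2 g Y _ _ sg sY|s1 s2 Y _ _ sY].
- exact: ext_funs.
- by rewrite ext_nonsec // all_sec_cons negb_and ns orbT.
- by rewrite -!cat_cons extD.
- by rewrite -!cat_cons extZ.
- by rewrite -cat_cons (ext_alt _ [::]).
Qed.

Lemma contractD w Z W : ext w -> secb Z -> secb W ->
  contract (fun x => Z x + W x) w = fun s x => contract Z w s x + contract W w s x.
Proof. by move=> ew sZ sW; apply/funext => s; exact: (extD [::]). Qed.

Lemma contractZ w Z f : ext w -> funs U f -> secb Z ->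
  contract (fun x => f x *: Z x) w = fun s x => f x * contract Z w s x.
Proof. by move=> ew sf sZ; apply/funext => s; exact: (extZ [::]). Qed.

Lemma contract_anti w Z W : ext w -> contract Z (contract W w) = fun s x => (-1) * contract W (contract Z w) s x.
Proof.
by move=> ew; apply/funext => s; apply/funext => x; rewrite mulN1r; exact: (ext_swap [::]).
Qed.

Lemma contractxx w Z : ext w -> contract Z (contract Z w) = fun _ _ => 0.
Proof. by move=> ew; apply/funext => s; exact: (ext_alt [::] [::]). Qed.

(** Forms take the value 0 as soon as one argument is not a section, so a
    contraction is a form for an arbitrary first argument. *)
Lemma contract_nonsec w Z : ext w -> ~~ secb Z -> contract Z w = fun _ _ => 0.
Proof.
move=> ew nZ; apply/funext => s; rewrite /contract ext_nonsec //.
by rewrite all_sec_cons negb_and nZ.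
Qed.

End exterior_algebra.

(** * The exterior differential *)

Section differential.
Variables (R : realType) (m n p : nat) (M : manifold R m) (N : manifold R n).
Variables (F : vbundle N p) (G : gla M F) (U : set M).
Hypothesis oU : open U.
Implicit Types (X Y Z W : hsec G) (x : M) (f g : M -> R) (s : seq (hsec G)) (w v : form G).
Local Notation secb Z := (Z \in hsections G U).
Local Notation ext := (exterior U).

Lemma rhohat_out Y f x : secb Y -> ~ U x -> rhohat Y f x = 0.
Proof. by move=> /(hsecP oU)[_ Y0] nUx; rewrite /rhohat Y0 // rho0. Qed.

Lemma rhohatD Y f g : secb Y -> funs U f -> funs U g ->
  rhohat Y (fun x => f x + g x) = fun x => rhohat Y f x + rhohat Y g x.
Proof.
move=> sY /(funsP oU)[sf _] /(funsP oU)[sg _]; apply/funext => x.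
have [Ux|nUx] := pselect (U x); last by rewrite !rhohat_out // addr0.
by apply: (tangentD (rho_at (Y x))); [exact: sf|exact: sg].
Qed.

Lemma rhohatM Y f g : secb Y -> funs U f -> funs U g ->
  rhohat Y (fun x => f x * g x) = fun x => f x * rhohat Y g x + rhohat Y f x * g x.
Proof.
move=> sY /(funsP oU)[sf _] /(funsP oU)[sg _]; apply/funext => x.
have [Ux|nUx] := pselect (U x); last by rewrite !rhohat_out // mulr0 mul0r addr0.
by rewrite [_ * g x]mulrC; apply: (tangentM (rho_at (Y x))); [exact: sf|exact: sg].
Qed.

Lemma rhohat0 Y : rhohat Y (fun=> 0) = fun=> 0.
Proof. by apply/funext => x; exact: (tangent_cst (rho_at (Y x))). Qed.

Lemma rhohat_addl Y Z f :
  rhohat (fun x => Y x + Z x) f = fun x => rhohat Y f x + rhohat Z f x.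
Proof. by apply/funext => x; rewrite /rhohat rhoD. Qed.

Lemma rhohat_mull Y f g : rhohat (fun x => f x *: Y x) g = fun x => f x * rhohat Y g x.
Proof. by apply/funext => x; rewrite /rhohat rhoZ. Qed.

Lemma hbracketDl_fun Z Y X : secb Z -> secb Y -> secb X ->
  hbracket U (fun x => Z x + Y x) X = fun x => hbracket U Z X x + hbracket U Y X x.
Proof.
move=> sZ sY sX; rewrite hbracket_anti_fun //; last exact: hsecD.
rewrite hbracketDr_fun // (hbracket_anti_fun oU sZ sX) (hbracket_anti_fun oU sY sX).
by apply: functional_extensionality_dep => x; rewrite scalerDr.
Qed.

Lemma hbracketZl_fun Z X f : secb Z -> secb X -> funs U f ->
  hbracket U (fun x => f x *: Z x) X =
  fun x => f x *: hbracket U Z X x + (- rhohat X f x) *: Z x.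
Proof.
move=> sZ sX sf; rewrite hbracket_anti_fun //; last exact: hsecZ.
rewrite hbracketZr_fun // (hbracket_anti_fun oU sZ sX).
apply: functional_extensionality_dep => x.
by rewrite scalerDr !scaleN1r scalerN scaleNr.
Qed.

(** The Lie derivative of [w] along [Y], by recursion on the arguments:
    contraction with X satisfies i_X L_Y = L_Y i_X - i_[Y,X]. *)
Fixpoint lie Y w s : M -> R :=
  if s is X :: s' then fun x => lie Y (contract X w) s' x - w (hbracket U Y X :: s') x
  else rhohat Y (w [::]).

(** The exterior product of df with [w], by recursion on the arguments. It
    measures the failure of the differential to be linear over functions. *)
Fixpoint dwedge f w s : M -> R :=
  if s is Y :: s' then fun x => rhohat Y f x * w s' x - dwedge f (contract Y w) s' x
  else fun=> 0.

(** The differential by recursion on the arguments, after Cartan's formula i_Y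
    d = L_Y - d i_Y. Multilinearity and alternation become inductions on the
    list of arguments, for all forms at once. *)
Fixpoint hd_rec w s : M -> R :=
  if s is Y :: s' then fun x => lie Y w s' x - hd_rec (contract Y w) s' x else fun=> 0.

Lemma ext_swap0 w Z W s x : ext w -> w [:: Z, W & s] x = - w [:: W, Z & s] x.
Proof. exact: (ext_swap oU [::]). Qed.

Lemma del0 (T : Type) (a : T) t : del 0 (a :: t) = t.
Proof. by rewrite /del /= drop0. Qed.

Lemma delS (T : Type) (a : T) i t : del i.+1 (a :: t) = a :: del i t.
Proof. by []. Qed.

(** Comparison with the closed formula: the terms with index j.+1 for X :: s
    are those with index j for s and the contraction by X, up to moving the
    bracket past X. *)
Lemma lieE Y w s x : ext w ->
  lie Y w s x = rhohat Y (w s) x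
   - \sum_(j < size s) (-1) ^+ j * w (hbracket U Y (nth (fun=> 0) s j) :: del j s) x.
Proof.
elim: s w => [|X s IH] w ew /=; first by rewrite big_ord0 subr0.
rewrite IH; last exact: (ext_contract oU).
rewrite -addrA; congr (_ + _); rewrite big_ord_recl expr0 mul1r /= del0.
rewrite opprD addrC; congr (_ - _).
apply: eq_bigr => j _.
by rewrite /contract (ext_swap0 _ _ _ _ ew) /= /bump add1n exprS delS; ring.
Qed.

(** Cartan's formula: the terms that involve the first argument form the Lie
    derivative, and the others form the differential of the contraction. *)
Lemma hd_recE w s x : ext w -> all_sec U s -> U x -> hd U w s x = hd_rec w s x.
Proof.
elim: s w => [|Y s IH] w ew a Ux.
  by rewrite /hd a mem_set //= !big_ord0 addr0.
have /andP[aY as'] : secb Y && all_sec U s by [].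
rewrite [RHS]/= -(IH (contract Y w)) //; last exact: (ext_contract oU).
rewrite /hd a as' mem_set // lieE //= .
rewrite big_ord_recl del0 expr0 mul1r /= -!addrA; congr (_ + _).
rewrite big_ord_recl big_ord0 add0r opprD addrCA; congr (_ + _).
  rewrite -sumrN; apply: eq_bigr => i _.
  by rewrite /bump add1n exprS delS; ring.
rewrite -opprD -big_split -sumrN; apply: eq_bigr => j _ /=.
rewrite /bump leq0n add1n add0n delS big_ord_recl add0n /= del0 opprD exprS mulN1r mulNr.
congr (_ + _); rewrite -sumrN; apply: eq_bigr => i _.
rewrite /contract (ext_swap0 _ _ _ _ ew) /bump leq0n !add1n delS /= addSn addnS !exprS; ring.
Qed.

Lemma lieDw Y w v s : secb Y -> ext w -> ext v ->
  lie Y (fun s x => w s x + v s x) s = fun x => lie Y w s x + lie Y v s x.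
Proof.
move=> sY; elim: s w v => [|X s IH] w v ew ev /=.
  by apply: rhohatD => //; exact: ext_funs.
have := IH (contract X w) (contract X v) (ext_contract oU X ew) (ext_contract oU X ev).
rewrite /contract => ->; apply/funext => x; ring.
Qed.

Lemma lieZw Y w f s : secb Y -> ext w -> funs U f ->
  lie Y (fun s x => f x * w s x) s = fun x => f x * lie Y w s x + rhohat Y f x * w s x.
Proof.
move=> sY; elim: s w => [|X s IH] w ew sf /=.
  by apply: rhohatM => //; exact: ext_funs.
have := IH (contract X w) (ext_contract oU X ew) sf.
rewrite /contract => ->; apply/funext => x; ring.
Qed.

Lemma lie0w Y s : lie Y (fun _ _ => 0) s = fun=> 0.
Proof.
elim: s => [|X s IH] /=; first exact: rhohat0.
by apply/funext => x; rewrite subr0 -[RHS](congr1 (fun k => k x) IH).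
Qed.

Lemma dwedgeZw f w (a : R) s :
  dwedge f (fun s x => a * w s x) s = fun x => a * dwedge f w s x.
Proof.
elim: s w => [|X s IH] w /=; first by apply/funext => x; rewrite mulr0.
have := IH (contract X w); rewrite /contract => ->; apply/funext => x; ring.
Qed.

Lemma hd_recDw w v s : ext w -> ext v -> all_sec U s ->
  hd_rec (fun s x => w s x + v s x) s = fun x => hd_rec w s x + hd_rec v s x.
Proof.
elim: s w v => [|X s IH] w v ew ev /=; first by move=> _; apply/funext => x; rewrite addr0.
move=> /andP[sX a].
have := IH (contract X w) (contract X v) (ext_contract oU X ew) (ext_contract oU X ev) a.
rewrite /contract => ->; rewrite lieDw //; apply/funext => x; ring.
Qed.

Lemma hd_recZw w f s : ext w -> funs U f -> all_sec U s ->
  hd_rec (fun s x => f x * w s x) s = fun x => f x * hd_rec w s x + dwedge f w s x.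
Proof.
elim: s w => [|X s IH] w ew sf /=; first by move=> _; apply/funext => x; rewrite mulr0 addr0.
move=> /andP[sX a].
have := IH (contract X w) (ext_contract oU X ew) sf a.
rewrite /contract => ->; rewrite lieZw //; apply/funext => x; ring.
Qed.

Lemma hd_rec0w s : hd_rec (fun _ _ => 0) s = fun=> 0.
Proof.
elim: s => [//|X s IH] /=; rewrite lie0w.
by apply/funext => x; rewrite sub0r -[RHS]oppr0 -[in RHS](congr1 (fun k => k x) IH).
Qed.

Lemma lie_funs Y w s : secb Y -> ext w -> funs U (lie Y w s).
Proof.
move=> sY; elim: s w => [|X s IH] w ew /=.
  by apply: funs_rhohat => //; exact: ext_funs.
apply: funsD => //; first exact/IH/ext_contract.
by apply: funsN => //; exact: ext_funs.
Qed.

Lemma lie_slotD Y w s1 s2 Z W : secb Y -> ext w -> secb Z -> secb W ->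
  lie Y w (s1 ++ (fun x => Z x + W x) :: s2) =
  fun x => lie Y w (s1 ++ Z :: s2) x + lie Y w (s1 ++ W :: s2) x.
Proof.
move=> sY; elim: s1 w => [|X s1 IH] w ew sZ sW /=; last first.
  rewrite IH //; last exact: ext_contract.
  rewrite -cat_cons (extD oU) // !cat_cons; apply/funext => x; ring.
rewrite (contractD oU) // lieDw //; try exact: ext_contract.
rewrite hbracketDr_fun // (extD oU [::]) //; try exact: hsec_bracket.
apply/funext => x /=; ring.
Qed.

Lemma lie_slotZ Y w s1 s2 f Z : secb Y -> ext w -> funs U f -> secb Z ->
  lie Y w (s1 ++ (fun x => f x *: Z x) :: s2) = fun x => f x * lie Y w (s1 ++ Z :: s2) x.
Proof.
move=> sY; elim: s1 w => [|X s1 IH] w ew sf sZ /=; last first.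
  rewrite IH //; last exact: ext_contract.
  rewrite -cat_cons (extZ oU) // !cat_cons; apply/funext => x; ring.
rewrite (contractZ oU) // lieZw //; try exact: ext_contract.
have sB := hsec_bracket oU sY sZ; have srf := funs_rhohat oU sY sf.
rewrite hbracketZr_fun // (extD oU [::]) //; try exact: hsecZ.
rewrite (extZ oU [::]) // (extZ oU [::]) //.
apply/funext => x /=; rewrite /contract; ring.
Qed.

Lemma lie_alt Y w s1 s2 Z : secb Y -> ext w -> secb Z ->
  lie Y w (s1 ++ Z :: Z :: s2) = fun=> 0.
Proof.
move=> sY; elim: s1 w => [|X s1 IH] w ew sZ /=; last first.
  rewrite IH //; last exact: ext_contract.
  by rewrite -cat_cons (ext_alt _ [::] _ _ ew) //; apply/funext => x; rewrite subr0.
rewrite (contractxx _ ew) // lie0w; apply/funext => x.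
by rewrite /contract (ext_swap0 _ _ _ _ ew) sub0r opprK subrr.
Qed.

Lemma lieDY Y Y' w s : secb Y -> secb Y' -> ext w -> all_sec U s ->
  lie (fun x => Y x + Y' x) w s = fun x => lie Y w s x + lie Y' w s x.
Proof.
move=> sY sY'; elim: s w => [|X s IH] w ew /=; first by move=> _; exact: rhohat_addl.
move=> /andP[sX a]; rewrite IH //; last exact: ext_contract.
rewrite hbracketDl_fun // (extD oU [::]) //; try exact: hsec_bracket.
apply/funext => x /=; ring.
Qed.

(** The term - rhohat(X)(f) Y of [f Y, X] produces the contribution of df. *)
Lemma lieZY Y f w s : secb Y -> funs U f -> ext w -> all_sec U s ->
  lie (fun x => f x *: Y x) w s =
  fun x => f x * lie Y w s x + dwedge f (contract Y w) s x.
Proof.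
move=> sY sf; elim: s w => [|X s IH] w ew /=.
  by move=> _; rewrite rhohat_mull; apply/funext => x; rewrite addr0.
move=> /andP[sX a]; rewrite IH //; last exact: ext_contract.
have sB := hsec_bracket oU sY sX; have srf := funsN oU (funs_rhohat oU sX sf).
rewrite hbracketZl_fun // (extD oU [::]) //; try exact: hsecZ.
rewrite (extZ oU [::]) // (extZ oU [::]) //.
rewrite (contract_anti oU Y X ew) dwedgeZw; apply/funext => x /=; rewrite /contract; ring.
Qed.

Lemma hd_rec_funs w s : ext w -> all_sec U s -> funs U (hd_rec w s).
Proof.
elim: s w => [|Y s IH] w ew /=; first by move=> _; exact: funs0.
move=> /andP[sY a]; apply: funsD => //; first exact: lie_funs.
by apply: funsN => //; apply: IH => //; exact: ext_contract.
Qed.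

Lemma hd_rec_slotD w s1 s2 Z W : ext w -> all_sec U s1 -> all_sec U s2 -> secb Z -> secb W ->
  hd_rec w (s1 ++ (fun x => Z x + W x) :: s2) =
  fun x => hd_rec w (s1 ++ Z :: s2) x + hd_rec w (s1 ++ W :: s2) x.
Proof.
elim: s1 w => [|Y s1 IH] w ew /=.
  move=> _ a sZ sW; rewrite lieDY // (contractD oU) // hd_recDw //; try exact: ext_contract.
  apply/funext => x; ring.
move=> /andP[sY a1] a2 sZ sW; rewrite IH //; last exact: ext_contract.
rewrite lie_slotD //; apply/funext => x; ring.
Qed.

(** In the first slot the two occurrences of df, from the Lie derivative along
    f Z and from the differential of f times the contraction by Z, cancel. *)
Lemma hd_rec_slotZ w s1 s2 f Z : ext w -> all_sec U s1 -> all_sec U s2 -> funs U f -> secb Z ->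
  hd_rec w (s1 ++ (fun x => f x *: Z x) :: s2) = fun x => f x * hd_rec w (s1 ++ Z :: s2) x.
Proof.
elim: s1 w => [|Y s1 IH] w ew /=.
  move=> _ a sf sZ; rewrite lieZY // (contractZ oU) // hd_recZw //; try exact: ext_contract.
  apply/funext => x; ring.
move=> /andP[sY a1] a2 sf sZ; rewrite IH //; last exact: ext_contract.
rewrite lie_slotZ //; apply/funext => x; ring.
Qed.

(** By Cartan's formula and i_Z L_Z = L_Z i_Z, which holds since [Z, Z] = 0. *)
Lemma hd_rec_alt w s1 s2 Z : ext w -> all_sec U s1 -> all_sec U s2 -> secb Z ->
  hd_rec w (s1 ++ Z :: Z :: s2) = fun=> 0.
Proof.
elim: s1 w => [|Y s1 IH] w ew /=; last first.
  move=> /andP[sY a1] a2 sZ; rewrite IH //; last exact: ext_contract.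
  by rewrite lie_alt //; apply/funext => x; rewrite subr0.
move=> _ a sZ; rewrite (contractxx _ ew) // hd_rec0w hbracketxx_fun //.
have -> : w ((fun=> 0) :: s2) = fun=> 0.
  have := extZ oU [::] s2 ew (funs0 oU) sZ => /=.
  have -> : (fun x => 0 *: Z x) = fun=> 0.
    by apply: functional_extensionality_dep => x; rewrite scale0r.
  by move=> ->; apply/funext => x; rewrite mul0r.
by apply/funext => x; rewrite !subr0 subrr.
Qed.

Lemma ext_hd w : ext w -> ext (hd U w).
Proof.
move=> ew.
have E s : all_sec U s -> hd U w s = hd_rec w s.
  move=> a; apply/funext => x; have [Ux|nUx] := pselect (U x); first exact: hd_recE.
  by have /(funsP oU)[_ ->] := hd_rec_funs ew a; rewrite // /hd memNset // andbF.
apply: (exterior_adjacent oU) => [s a|s na|s1 s2 Z W a1 a2 sZ sW|s1 s2 f Z a1 a2 sf sZ|s1 s2 Z a1 a2 sZ].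
- by rewrite E //; exact: hd_rec_funs.
- by apply/funext => x; rewrite /hd (negbTE na).
- have sZW := hsecD oU sZ sW.
  by rewrite !E ?all_sec_cat ?all_sec_cons ?a1 ?a2 ?sZ ?sW ?sZW // hd_rec_slotD.
- have sfZ := hsecZ oU sf sZ.
  by rewrite !E ?all_sec_cat ?all_sec_cons ?a1 ?a2 ?sZ ?sfZ // hd_rec_slotZ.
- by rewrite !E ?all_sec_cat ?all_sec_cons ?a1 ?a2 ?sZ // hd_rec_alt.
Qed.

End differential.

(** * The exterior product *)

Section wedge_product.
Variables (R : realType) (m n p : nat) (M : manifold R m) (N : manifold R n).
Variables (F : vbundle N p) (G : gla M F) (U : set M).
Hypothesis oU : open U.
Implicit Types (X Y Z W : hsec G) (x : M) (f g : M -> R) (s : seq (hsec G)) (w v : form G).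
Local Notation secb Z := (Z \in hsections G U).
Local Notation ext := (exterior U).

(** The sign picked up by moving a vector past a form; with it, contractions
    are antiderivations of the exterior product. *)
Definition grading_sign w : form G := fun s x => (-1) ^+ size s * w s x.

Lemma ext_grading_sign w : ext w -> ext (grading_sign w).
Proof. exact: (ext_scale oU (fun k => (-1) ^+ k)). Qed.

Lemma big_tuple_cons k (f : k.+1.-tuple bool -> R) :
  \sum_t f t = \sum_t f (cons_tuple true t) + \sum_t f (cons_tuple false t).
Proof.
rewrite (reindex (fun bt : bool * k.-tuple bool => cons_tuple bt.1 bt.2)) /=; last first.
  exists (fun t => (thead t, [tuple of behead t])).
    by move=> [b t] _; congr pair; exact: val_inj.
  by move=> t _; rewrite [RHS]tuple_eta; exact: val_inj.
rewrite -(pair_big xpredT xpredT (fun b t => f (cons_tuple b t))) /=.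
by rewrite big_bool.
Qed.

Lemma wedge_nil w v x : wedge w v [::] x = w [::] x * v [::] x.
Proof.
rewrite /wedge /= (bigD1 [tuple]) //= big1 ?addr0 ?expr0 ?mul1r // => t.
by rewrite (tuple0 t).
Qed.

(** Contraction is an antiderivation: a shuffle gives the first argument either
    to [w] or, past all the arguments of [w], to [v]. *)
Lemma wedge_cons w v Z s x :
  wedge w v (Z :: s) x = wedge (contract Z w) v s x + wedge (grading_sign w) (contract Z v) s x.
Proof.
rewrite /wedge [LHS]big_tuple_cons; congr (_ + _); apply: eq_bigr => t _ /=.
rewrite exprD /grading_sign size_mask ?size_tuple // /contract; ring.
Qed.

Lemma wedgeDl w w' v s x :
  wedge (fun s x => w s x + w' s x) v s x = wedge w v s x + wedge w' v s x.
Proof. by rewrite /wedge -big_split; apply: eq_bigr => t _ /=; ring. Qed.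

Lemma wedgeDr w v v' s x :
  wedge w (fun s x => v s x + v' s x) s x = wedge w v s x + wedge w v' s x.
Proof. by rewrite /wedge -big_split; apply: eq_bigr => t _ /=; ring. Qed.

Lemma wedgeZl w f v s x :
  wedge (fun s x => f x * w s x) v s x = f x * wedge w v s x.
Proof. by rewrite /wedge mulr_sumr; apply: eq_bigr => t _ /=; ring. Qed.

Lemma wedgeZr w f v s x :
  wedge w (fun s x => f x * v s x) s x = f x * wedge w v s x.
Proof. by rewrite /wedge mulr_sumr; apply: eq_bigr => t _ /=; ring. Qed.

Lemma wedge0l v s x : wedge (fun _ _ => 0) v s x = 0.
Proof. by rewrite /wedge big1 // => t _; rewrite mul0r mulr0. Qed.

Lemma wedge0r w s x : wedge w (fun _ _ => 0) s x = 0.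
Proof. by rewrite /wedge big1 // => t _; rewrite !mulr0. Qed.

Lemma grading_sign_contract Z w : contract Z (grading_sign w) = fun s x => (-1) * grading_sign (contract Z w) s x.
Proof.
by apply/funext => s; apply/funext => x; rewrite /contract /grading_sign /= exprS mulrA.
Qed.

(** For two equal first arguments, the double contractions vanish and the two
    mixed terms have opposite signs. *)
Lemma ext_wedge w v : ext w -> ext v -> ext (wedge w v).
Proof.
move=> ew ev; apply: (exterior_adjacent oU).
- move=> s _; rewrite /wedge; apply: (funs_sum oU) => t.
  by apply: funsZ => //; apply: funsM => //; exact: ext_funs.
- move=> s; elim: s w v ew ev => [//|Z s IH] w v ew ev.
  rewrite all_sec_cons => na; apply/funext => x; rewrite wedge_cons.
  have [sZ|nZ] := boolP (secb Z); last first.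
    by rewrite (contract_nonsec ew nZ) (contract_nonsec ev nZ) wedge0l wedge0r addr0.
  move: na; rewrite sZ => na.
  by rewrite !IH ?addr0 //; try exact: ext_contract; exact: ext_grading_sign.
- move=> s1 s2 Z W _ _ sZ sW; apply/funext => x.
  elim: s1 w v ew ev => [|X s1 IH] w v ew ev /=; rewrite !wedge_cons.
    by rewrite !(contractD oU) // wedgeDl wedgeDr addrACA.
  by rewrite !IH; try exact: ext_contract; try exact: ext_grading_sign; rewrite // addrACA.
- move=> s1 s2 f Z _ _ sf sZ; apply/funext => x.
  elim: s1 w v ew ev => [|X s1 IH] w v ew ev /=; rewrite !wedge_cons.
    by rewrite !(contractZ oU) // wedgeZl wedgeZr mulrDr.
  by rewrite !IH; try exact: ext_contract; try exact: ext_grading_sign; rewrite // mulrDr.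
- move=> s1 s2 Z _ _ sZ; apply/funext => x.
  elim: s1 w v ew ev => [|X s1 IH] w v ew ev /=; rewrite !wedge_cons.
    rewrite (contractxx _ ew) (contractxx _ ev) wedge0l wedge0r grading_sign_contract.
    by rewrite (wedgeZl _ (fun=> -1)); ring.
  by rewrite !IH; try exact: ext_contract; try exact: ext_grading_sign; rewrite // addr0.
Qed.

(** Each shuffle feeds [v] with arguments taken from [s]. *)
Lemma wedge_vanish (P : pred (hsec G)) w v s x : all P s ->
  (forall s, all P s -> v s = fun=> 0) -> wedge w v s x = 0 /\ wedge v w s x = 0.
Proof.
have allmask t s' : all P s' -> all P (mask t s').
  elim: s' t => [|Z s' IH] [|[] t] //= /andP[PZ a]; rewrite ?PZ; exact: IH.
move=> a v0; rewrite /wedge; split; rewrite big1 // => t _.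
  by rewrite (v0 (mask (map negb t) s)) ?mulr0 //; exact: allmask.
by rewrite (v0 (mask t s)) ?mul0r ?mulr0 //; exact: allmask.
Qed.

End wedge_product.

(** * Orthogonal projection onto a subbundle *)

Lemma lcomb_mulmx (R : realType) (V : lmodType R) (r k : nat) (e : 'I_k -> V)
    (u : 'rV[R]_r) (B : 'M[R]_(r, k)) :
  lcomb e (u *m B) = lcomb (fun i => lcomb e (row i B)) u.
Proof.
rewrite /lcomb; under eq_bigr => a _ do rewrite mxE scaler_suml.
rewrite exchange_big; apply: eq_bigr => i _ /=.
by rewrite scaler_sumr; apply: eq_bigr => a _; rewrite mxE scalerA.
Qed.

Lemma lcombD (R : realType) (V : lmodType R) (k : nat) (e : 'I_k -> V) (u v : 'rV[R]_k) :
  lcomb e (u + v) = lcomb e u + lcomb e v.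
Proof. by rewrite /lcomb -big_split; apply: eq_bigr => a _; rewrite mxE scalerDl. Qed.

Lemma lcombZ (R : realType) (V : lmodType R) (k : nat) (e : 'I_k -> V) a (u : 'rV[R]_k) :
  lcomb e (a *: u) = a *: lcomb e u.
Proof. by rewrite /lcomb scaler_sumr; apply: eq_bigr => i _; rewrite mxE scalerA. Qed.

Lemma lcomb0 (R : realType) (V : lmodType R) (k : nat) (e : 'I_k -> V) :
  lcomb e 0 = 0.
Proof. by rewrite /lcomb big1 // => a _; rewrite mxE scale0r. Qed.

(** If v B B^T = 0 then the squared norm of v B is 0, and the rows of B are
    independent. *)
Lemma gram_unit (R : realType) (r k : nat) (B : 'M[R]_(r, k)) :
  row_free B -> B *m B^T \in unitmx.
Proof.
move=> fB; rewrite -row_free_unit; apply: inj_row_free => v vB.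
have : (v *m B) *m (v *m B)^T = 0 by rewrite trmx_mul mulmxA -(mulmxA v) vB mul0mx.
move/(congr1 (fun A : 'M[R]_1 => A 0 0)); rewrite !mxE => H.
have vB0 : v *m B = 0.
  apply/rowP => j; apply/eqP; rewrite [X in _ == X]mxE -sqrf_eq0 expr2.
  have /psumr_eq0P : \sum_j (v *m B) 0 j * (v *m B) 0 j = 0.
    by rewrite -[RHS]H; apply: eq_bigr => i _; rewrite [X in _ = _ * X]mxE.
  by move=> /(_ (fun i _ => sqr_ge0 _)) ->.
by apply: (row_free_inj fB); rewrite vB0 mul0mx.
Qed.

(** The orthogonal projector onto the row space of [B]; row vectors are
    projected by right multiplication. *)
Definition orthoproj (R : realType) (r k : nat) (B : 'M[R]_(r, k)) : 'M[R]_k :=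
  B^T *m invmx (B *m B^T) *m B.

Lemma orthoproj_sym (R : realType) (r k : nat) (B : 'M[R]_(r, k)) :
  (orthoproj B)^T = orthoproj B.
Proof.
by rewrite /orthoproj !trmx_mul trmxK trmx_inv trmx_mul trmxK mulmxA.
Qed.

Lemma orthoproj_id (R : realType) (r k : nat) (B : 'M[R]_(r, k)) :
  row_free B -> B *m orthoproj B = B.
Proof.
by move=> /gram_unit uB; rewrite /orthoproj !mulmxA mulmxV // mul1mx.
Qed.

Section frames.
Variables (R : realType) (m n p : nat) (M : manifold R m) (N : manifold R n).
Variables (F : vbundle N p) (G : gla M F) (U : set M) (T : 'I_p -> hsec G).
Hypothesis oU : open U.
Hypothesis sT : forall a, T a \in hsections G U.
Hypothesis bT : forall x, U x -> is_basis setT (fun a => T a x).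
Implicit Types (X Y Z W : hsec G) (x : M) (f g : M -> R).
Local Notation secb Z := (Z \in hsections G U).
Local Notation h := (gh G).

Definition frame_coord x (v : F (h x)) : 'rV[R]_p :=
  xget 0 [set a | lcomb (fun b => T b x) a = v].

Lemma frame_coordK x (v : F (h x)) : U x -> lcomb (fun b => T b x) (frame_coord v) = v.
Proof.
move=> /bT[_ ran]; rewrite /frame_coord.
have : setT v by [].
rewrite -ran => -[a _ av].
by case: xgetP => [b -> //|/(_ a)].
Qed.

Lemma frame_coord_lcomb x a : U x -> frame_coord (lcomb (fun b => T b x) a) = a.
Proof. by move=> Ux; have [inj _] := bT Ux; apply: inj; rewrite frame_coordK. Qed.

Lemma frame_coordD x (v w : F (h x)) : U x -> frame_coord (v + w) = frame_coord v + frame_coord w.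
Proof.
move=> Ux; have [inj _] := bT Ux; apply: inj.
by rewrite lcombD !frame_coordK.
Qed.

Lemma frame_coordZ x a (v : F (h x)) : U x -> frame_coord (a *: v) = a *: frame_coord v.
Proof. by move=> Ux; have [inj _] := bT Ux; apply: inj; rewrite lcombZ !frame_coordK. Qed.

Lemma smooth_sec_frame x a : U x -> smooth_sec (T a) x.
Proof. by move=> Ux; have /(hsecP oU)[H _] := sT a; exact: H. Qed.

(** In a bundle chart, the coordinates in the frame [T] are obtained by
    inverting the matrix of the components of the [T a]. *)
Lemma frame_coord_smooth x Z a : U x -> smooth_sec Z x ->
  smooth_at x (fun y => frame_coord (Z y) 0 a).
Proof.
move=> Ux sZ; have [c Ac cx] := batlas_cover F (h x).
pose B y := \matrix_(b < p, i < p) bmap c (T b y) 0 i.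
have nU : \forall y \near x, U y by exact: open_nbhs_nbhs.
have nc := near_bdom (gh_smooth G) cx.
have BE y v : bdom c (h y) -> bmap c (lcomb (fun b => T b y) v) = v *m B y.
  move=> cy; rewrite /lcomb bmap_sum //; apply/rowP => i; rewrite summxE mxE.
  by apply: eq_bigr => b _; rewrite bmapZ // !mxE.
have uB : \forall y \near x, B y \in unitmx.
  apply: filterS2 nU nc => y Uy cy; rewrite -row_free_unit; apply: inj_row_free => v.
  rewrite -BE // => v0; have [inj _] := bT Uy; apply: inj.
  by apply: (bmap_inj cy) => /=; rewrite v0 lcomb0 bmap0.
apply: (@smooth_at_near _ _ _ _ (fun y => \sum_b bmap c (Z y) 0 b * invmx (B y) b a)).
  apply: filterS3 nU nc uB => y Uy cy uy.
  rewrite -[in LHS](frame_coordK (Z y) Uy).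
  have -> : \sum_b bmap c (lcomb (fun b => T b y) (frame_coord (Z y))) 0 b * invmx (B y) b a
     = (bmap c (lcomb (fun b => T b y) (frame_coord (Z y))) *m invmx (B y)) 0 a by rewrite mxE.
  by rewrite BE // mulmxK.
apply: smooth_at_sum => b _; apply: smooth_atM; first exact: sZ.
apply: smooth_at_invmx uB b a => i j.
have sTi := smooth_sec_frame i Ux Ac cx j.
by apply: smooth_at_eq sTi => y; rewrite mxE.
Qed.

Section projector.
Variable E : forall x : M, set (F (h x)).
Hypothesis hE : is_IDS U E.

(** The three clauses characterize the matrix, in the frame [T], of the
    orthogonal projection onto the fibre of [E], for the metric that makes [T]
    orthonormal. No local frame of [E] is mentioned, so the local descriptions
    glue. *)
Definition is_projector x (P : 'M[R]_p) : Prop :=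
  [/\ forall v, E (lcomb (fun b => T b x) (v *m P)),
      forall v, E (lcomb (fun b => T b x) v) -> v *m P = v & P^T = P].

(** A product of two such matrices is the first one, and transposing exchanges
    them. *)
Lemma projector_unique x P Q : is_projector x P -> is_projector x Q -> P = Q.
Proof.
move=> [EP PE tP] [EQ QE tQ].
have PQ : P *m Q = P by apply/row_matrixP => i; rewrite !rowE mulmxA; exact: QE.
have QP : Q *m P = Q by apply/row_matrixP => i; rewrite !rowE mulmxA; exact: PE.
by rewrite -PQ -[P in LHS]tP -[Q in LHS]tQ -trmx_mul QP.
Qed.

Definition projector x : 'M[R]_p := xget 0 [set P | is_projector x P].

Lemma projectorE x P : is_projector x P -> projector x = P.
Proof.
move=> HP; rewrite /projector; case: xgetP => [Q -> HQ|/(_ P)//].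
exact: projector_unique HQ HP.
Qed.

(** Gram's formula, for the matrix [B] of coordinates of a local frame of
    [E]. *)
Lemma local_projector x : U x -> exists (r : nat) (B : M -> 'M[R]_(r, p)),
  (\forall y \near x, [/\ U y, row_free (B y) & is_projector y (orthoproj (B y))]) /\
  forall i j, smooth_at x (fun y => B y i j).
Proof.
case: hE => r /[apply] -[V [e [oV Vx VU se be]]].
exists r, (fun y => \matrix_(i < r) frame_coord (e i y)); split; last first.
  move=> i j.
  have sei : smooth_sec (e i) x.
    have := se i; rewrite /hsections /= => /(sectionsP (gh_smooth G) _ oV)[+ _]; exact.
  by apply: smooth_at_eq (frame_coord_smooth j (VU _ Vx) sei) => y; rewrite mxE.
have : nbhs x V by exact: open_nbhs_nbhs.
apply: filterS => y Vy; have Uy := VU _ Vy; have [inj ran] := be y Vy.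
set B := \matrix_(i < r) frame_coord (e i y).
have BE u : lcomb (fun b => T b y) (u *m B) = lcomb (fun i => e i y) u.
  rewrite lcomb_mulmx; congr (lcomb _ _); apply/funext => i.
  by rewrite rowK frame_coordK.
have fB : row_free B.
  apply: inj_row_free => v vB; apply: inj; rewrite -!BE vB mul0mx //.
split=> //; split.
- by move=> v; rewrite /orthoproj !mulmxA BE -ran; eexists.
- move=> v; rewrite -ran => -[u _]; rewrite -BE => uv.
  have [injT _] := bT Uy; rewrite -(injT _ _ uv) -mulmxA orthoproj_id //.
- exact: orthoproj_sym.
Qed.

Lemma projectorP x : U x -> is_projector x (projector x).
Proof.
move=> /local_projector[r [B [/nbhs_singleton[_ _ HB] _]]].
by rewrite (projectorE HB).
Qed.

Lemma projector_smooth x i j : U x -> smooth_at x (fun y => projector y i j).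
Proof.
move=> /local_projector[r [B [HB sB]]].
apply: (@smooth_at_near _ _ _ _ (fun y => orthoproj (B y) i j)).
  by apply: filterS HB => y [_ _ Py]; rewrite (projectorE Py).
have smul a b c (A : M -> 'M[R]_(a, b)) (C : M -> 'M[R]_(b, c)) :
  (forall i j, smooth_at x (fun y => A y i j)) ->
  (forall i j, smooth_at x (fun y => C y i j)) ->
  forall i j, smooth_at x (fun y => (A y *m C y) i j).
  move=> sA sC i' j'; under eq_fun do rewrite mxE.
  by apply: smooth_at_sum => k _; exact: smooth_atM.
have sBT i' j' : smooth_at x (fun y => (B y)^T i' j').
  by under eq_fun do rewrite mxE; exact: sB.
apply: (smul _ _ _ (fun y => (B y)^T *m invmx (B y *m (B y)^T))) => // i' j'.
apply: (smul _ _ _ (fun y => (B y)^T)) => // i2 j2.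
apply: smooth_at_invmx; first by move=> ? ?; exact: smul.
by apply: filterS HB => y [_ fy _]; exact: gram_unit.
Qed.

End projector.
End frames.

(** * The ideal generated by the annihilator *)

Lemma not_uniq_split (T : eqType) (t : seq T) : ~~ uniq t ->
  exists a t1 t2 t3, t = t1 ++ a :: t2 ++ a :: t3.
Proof.
elim: t => [//|a t IH] /=; rewrite negb_and negbK => /orP[/splitPr[t2 t3]|/IH].
  by exists a, [::], t2, t3.
by move=> [b [t1 [t2 [t3 ->]]]]; exists b, (a :: t1), t2, t3.
Qed.

Section ideal_of_annihilator.
Variables (R : realType) (m n p : nat) (M : manifold R m) (N : manifold R n).
Variables (F : vbundle N p) (G : gla M F) (U : set M) (T : 'I_p -> hsec G).
Hypothesis oU : open U.
Hypothesis sT : forall a, T a \in hsections G U.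
Hypothesis bT : forall x, U x -> is_basis setT (fun a => T a x).
Variable E : forall x : M, set (F (gh G x)).
Hypothesis hE : is_IDS U E.
Implicit Types (X Y Z W : hsec G) (x : M) (f g : M -> R) (w v : form G).
Implicit Types (s : seq (hsec G)).
Local Notation secb Z := (Z \in hsections G U).
Local Notation ext := (exterior U).
Local Notation Pi := (projector T E).

(** The coordinates in the frame [T] of the component of [Z] orthogonal to
    [E]. *)
Definition conormal Z x : 'rV[R]_p :=
  if x \in U then frame_coord T (Z x) *m (1%:M - Pi x) else 0.

(** These p forms generate the annihilator, although neither [E] nor its
    orthogonal complement need have a frame over [U]. *)
Definition omega (a : 'I_p) : form G := fun s x =>
  if s is [:: Z] then if secb Z then conormal Z x 0 a else 0 else 0.

Lemma funs_frame_coord Z a : secb Z -> funs U (fun x => if x \in U then frame_coord T (Z x) 0 a else 0).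
Proof.
move=> /(hsecP oU)[sZ Z0]; apply/(funsP oU); split=> x Ux; last by rewrite memNset.
have nU : \forall y \near x, U y by exact: open_nbhs_nbhs.
apply: smooth_at_near (frame_coord_smooth oU sT bT a Ux (sZ x Ux)).
by apply: filterS nU => y Uy; rewrite mem_set.
Qed.

Lemma funs_conormal Z a : secb Z -> funs U (fun x => conormal Z x 0 a).
Proof.
move=> /(hsecP oU)[sZ Z0]; apply/(funsP oU); split=> x Ux; last by rewrite /conormal memNset // mxE.
have nU : \forall y \near x, U y by exact: open_nbhs_nbhs.
apply: (@smooth_at_near _ _ _ _
  (fun y => \sum_b frame_coord T (Z y) 0 b * ((1%:M : 'M[R]_p) b a - Pi y b a))).
  apply: filterS nU => y Uy; rewrite /conormal mem_set // mxE; apply: eq_bigr => b _.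
  by rewrite !mxE.
apply: smooth_at_sum => b _; apply: smooth_atM.
  exact: (frame_coord_smooth oU sT bT b Ux (sZ x Ux)).
apply: smooth_atB; first exact: smooth_at_cst.
exact: (projector_smooth oU sT bT hE b a Ux).
Qed.

Lemma conormalD Z W x : conormal (fun x => Z x + W x) x = conormal Z x + conormal W x.
Proof.
rewrite /conormal; case: ifPn => [/set_mem Ux|_]; last by rewrite addr0.
by rewrite (frame_coordD bT) // mulmxDl.
Qed.

Lemma conormalZ f Z x : conormal (fun x => f x *: Z x) x = f x *: conormal Z x.
Proof.
rewrite /conormal; case: ifPn => [/set_mem Ux|_]; last by rewrite scaler0.
by rewrite (frame_coordZ bT) // scalemxAl.
Qed.

Lemma conormal0P Z x : U x -> conormal Z x = 0 <-> E (Z x).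
Proof.
move=> Ux; rewrite /conormal mem_set // mulmxBr mulmx1.
have [EP PE _] := projectorP oU sT bT hE Ux.
split=> [/eqP|EZ]; last by rewrite PE ?subrr // (frame_coordK bT).
rewrite subr_eq0 => /eqP ZP; have := EP (frame_coord T (Z x)).
by rewrite -ZP (frame_coordK bT).
Qed.

Lemma omega_ext a : ext (omega a).
Proof.
apply: (exterior_adjacent oU).
- move=> [|Z [|? ?]] _; rewrite /omega; try exact: funs0.
  by case: (boolP (secb Z)) => sZ; [exact: funs_conormal|exact: funs0].
- by move=> [|Z [|? ?]] //; rewrite all_sec_cons andbT /omega => /negbTE ->.
- move=> [|X s1] s2 Z W _ _ sZ sW; apply/funext => x.
    case: s2 => [|Y s2] /=; last by rewrite addr0.
    by rewrite sZ sW (hsecD oU sZ sW) conormalD mxE.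
  by case: s1 => [|? ?] /=; rewrite addr0.
- move=> [|X s1] s2 f Z _ _ sf sZ; apply/funext => x.
    case: s2 => [|Y s2] /=; last by rewrite mulr0.
    by rewrite sZ (hsecZ oU sf sZ) conormalZ mxE.
  by case: s1 => [|? ?] /=; rewrite mulr0.
- by move=> [|X s1] [|Y s2] Z //; case: s1.
Qed.

Lemma omega_annihilator a : annihilator E U (omega a).
Proof.
split; first split; first exact: omega_ext.
- by move=> [|Z [|? ?]] //=.
- move=> S [sS ES]; apply/funext => x; rewrite /omega mem_set //.
  have [Ux|nUx] := pselect (U x); last by rewrite /conormal memNset // mxE.
  by rewrite ((conormal0P _ Ux).2 (ES x Ux)) mxE.
Qed.

Definition normal_part Z : hsec G := fun x => \sum_a conormal Z x 0 a *: T a x.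
Definition tangential_part Z : hsec G := fun x => Z x + (-1) *: normal_part Z x.

Lemma hsec_sum (r : seq 'I_p) (f : 'I_p -> M -> R) : (forall a, funs U (f a)) ->
  secb (fun x => \sum_(a <- r) f a x *: T a x).
Proof.
move=> sf; elim: r => [|a r IH].
  have -> : (fun x => \sum_(a <- [::]) f a x *: T a x) = fun=> 0.
    by apply: functional_extensionality_dep => x; rewrite big_nil.
  exact: hsec0.
have -> : (fun x => \sum_(b <- a :: r) f b x *: T b x) =
     fun x => f a x *: T a x + \sum_(b <- r) f b x *: T b x.
  by apply: functional_extensionality_dep => x; rewrite big_cons.
by apply: hsecD => //; exact: hsecZ.
Qed.

Lemma hsec_normal Z : secb Z -> secb (normal_part Z).
Proof. by move=> sZ; apply: hsec_sum => a; exact: funs_conormal. Qed.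

Lemma hsecN Z : secb Z -> secb (fun x => (-1) *: Z x).
Proof.
move=> /(hsecP oU)[sZ Z0]; apply/(hsecP oU); split=> x Ux; last by rewrite Z0 ?scaler0.
by apply: (smooth_secZ (gh_smooth G)) (sZ x Ux); exact: smooth_at_cst.
Qed.

Lemma hsec_tangential Z : secb Z -> secb (tangential_part Z).
Proof. by move=> sZ; apply: hsecD => //; apply: hsecN; exact: hsec_normal. Qed.

Lemma normal_decomp Z : Z = fun x => normal_part Z x + tangential_part Z x.
Proof.
by apply: functional_extensionality_dep => x; rewrite /tangential_part scaleN1r addrC subrK.
Qed.

Lemma conormal_normal Z : conormal (normal_part Z) = conormal Z.
Proof.
apply/funext => x; rewrite /conormal; case: ifPn => // /set_mem Ux.
rewrite /normal_part -/(lcomb (fun a => T a x) (conormal Z x)) (frame_coord_lcomb bT) //.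
rewrite /conormal mem_set // -mulmxA; congr (_ *m _).
have [EP PE _] := projectorP oU sT bT hE Ux.
have PP : Pi x *m Pi x = Pi x.
  by apply/row_matrixP => i; rewrite row_mul rowE; apply: PE; rewrite -rowE rowE.
by rewrite mulmxBl mul1mx mulmxBr mulmx1 PP subrr subr0.
Qed.

Lemma normal_idem Z : normal_part (normal_part Z) = normal_part Z.
Proof. by rewrite /normal_part -/(normal_part Z) conormal_normal. Qed.

Lemma tangential_section Z : secb Z -> sub_sections E U (tangential_part Z).
Proof.
move=> sZ; split; first by apply: set_mem; exact: hsec_tangential.
move=> x Ux; apply/conormal0P => //.
have := congr1 (fun W => conormal W x) (normal_decomp Z).
rewrite conormalD conormal_normal => /eqP.
by rewrite addrC -subr_eq subrr eq_sym => /eqP.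
Qed.

Lemma ext_sum_slot w s1 s2 (r : seq 'I_p) (f : 'I_p -> M -> R) x : ext w ->
  (forall a, funs U (f a)) ->
  w (s1 ++ (fun x => \sum_(a <- r) f a x *: T a x) :: s2) x =
  \sum_(a <- r) f a x * w (s1 ++ T a :: s2) x.
Proof.
move=> ew sf; elim: r => [|a r IH].
  have -> : (fun x => \sum_(a <- [::]) f a x *: T a x) = fun x => 0 *: (0 : F (gh G x)).
    by apply: functional_extensionality_dep => y; rewrite big_nil scaler0.
  rewrite (extZ oU _ _ ew (funs0 oU) (hsec0 G oU)) mul0r big_nil //.
have -> : (fun x => \sum_(b <- a :: r) f b x *: T b x) =
     fun x => f a x *: T a x + \sum_(b <- r) f b x *: T b x.
  by apply: functional_extensionality_dep => y; rewrite big_cons.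
rewrite (extD oU) //; [|exact: hsecZ|exact: hsec_sum].
by rewrite (extZ oU) // IH big_cons.
Qed.

Lemma ext_normal w Z s x : ext w -> secb Z ->
  w (normal_part Z :: s) x = \sum_a conormal Z x 0 a * w (T a :: s) x.
Proof. by move=> ew sZ; apply: (ext_sum_slot [::]) => // a; exact: funs_conormal. Qed.

(** Expand all the arguments in the frame [T]: by the pigeonhole principle some
    element of the frame is repeated. *)
Lemma ext_degree w s : ext w -> (p < size s)%N -> w s = fun=> 0.
Proof.
move=> ew ps; suff H (t : seq 'I_p) : (p < size t + size s)%N ->
    w (map T t ++ s) = fun=> 0 by exact: (H [::]).
move=> {ps}; elim: s t => [|Z s IH] t.
  rewrite addn0 => pt; have /not_uniq_split[a [t1 [t2 [t3 ->]]]] : ~~ uniq t.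
    apply/negP => /card_uniqP ct; have := max_card (mem t).
    by rewrite ct card_ord leqNgt pt.
  by rewrite cats0 map_cat /= map_cat /= (ext_alt _ _ _ _ ew).
move=> pts; have [sZ|nZ] := boolP (secb Z); last first.
  by rewrite (ext_nonsec ew) // all_sec_cat all_sec_cons (negbTE nZ) andbF.
have -> : Z = fun x => \sum_a (if x \in U then frame_coord T (Z x) 0 a else 0) *: T a x.
  apply: functional_extensionality_dep => x; have [Ux|nUx] := pselect (U x).
    by rewrite -{1}(frame_coordK bT (Z x) Ux) mem_set.
  have /(hsecP oU)[_ ->] // := sZ.
  by rewrite big1 // => a _; rewrite memNset // scale0r.
apply/funext => x; rewrite ext_sum_slot //; last by move=> a; exact: funs_frame_coord.
rewrite big1 // => a _; rewrite -cat_rcons -map_rcons IH ?mulr0 //.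
by rewrite size_rcons addSn -addnS.
Qed.

Definition is_normal Z : bool := `[< normal_part Z = Z >].
(** Here homogeneous means purely normal or purely tangential to [E];
    [ext_homogeneous0] reduces the study of a form to such arguments. *)
Definition homogeneous_arg Z : bool :=
  secb Z && (is_normal Z || (Z \in sub_sections E U)).

Lemma homogeneous_normal Z : secb Z -> homogeneous_arg (normal_part Z).
Proof.
move=> sZ; rewrite /homogeneous_arg hsec_normal //=; apply/orP; left.
by apply/asboolP; exact: normal_idem.
Qed.

Lemma homogeneous_tangential Z : secb Z -> homogeneous_arg (tangential_part Z).
Proof.
move=> sZ; rewrite /homogeneous_arg hsec_tangential //=; apply/orP; right.
by apply: mem_set; exact: tangential_section.
Qed.

Lemma ext_homogeneous0 w : ext w ->
  (forall s, all homogeneous_arg s -> w s = fun=> 0) -> w = fun _ _ => 0.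
Proof.
move=> ew Hw; apply/funext => s; elim: s w ew Hw => [|Z s IH] w ew Hw; first exact: Hw.
have [sZ|nZ] := boolP (secb Z); last first.
  by rewrite -/(contract Z w s) (contract_nonsec ew nZ).
rewrite (normal_decomp Z) (extD oU [::] s ew (hsec_normal sZ) (hsec_tangential sZ)) /=.
apply/funext => x.
have H X : homogeneous_arg X -> w (X :: s) = fun=> 0.
  move=> hX; apply: (IH (contract X w)); first exact: ext_contract.
  by move=> t ht; apply: Hw; rewrite /= hX.
by rewrite !H ?addr0 //; [exact: homogeneous_tangential|exact: homogeneous_normal].
Qed.

(** The derivation of the exterior algebra that extends the projection on
    normal parts. As a sum of products by the [omega a], it takes values in
    every ideal that contains the annihilator. *)
Definition normal_derivation w : form G :=
  fun s x => \sum_a wedge (omega a) (contract (T a) w) s x.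

(** A form of degree 0 is a function. *)
Lemma wedge_degree0 w v s x : (forall Z s, w (Z :: s) = fun=> 0) ->
  wedge w v s x = w [::] x * v s x.
Proof.
move=> w0; elim: s v => [|Z s IH] v; first exact: wedge_nil.
have -> : wedge w v (Z :: s) x = wedge (grading_sign w) (contract Z v) s x.
  rewrite wedge_cons; have -> : contract Z w = fun _ _ => 0 by apply/funext => t; exact: w0.
  by rewrite wedge0l add0r.
have -> : grading_sign w = w.
  apply/funext => -[|Y t]; apply/funext => y; rewrite /grading_sign.
    by rewrite expr0 mul1r.
  by rewrite w0 mulr0.
exact: IH.
Qed.

(** A derivation applied to [w] at Z :: s acts either on [Z] or on the
    contraction of [w] by [Z]. *)
Lemma normal_derivation_cons w Z s x : ext w -> secb Z ->
  normal_derivation w (Z :: s) x =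
  w (normal_part Z :: s) x + normal_derivation (contract Z w) s x.
Proof.
move=> ew sZ; rewrite /normal_derivation ext_normal // -big_split.
apply: eq_bigr => a _ /=; rewrite wedge_cons; congr (_ + _).
  by rewrite wedge_degree0 // /contract /= sZ.
rewrite (contract_anti oU Z (T a) ew).
have -> : grading_sign (omega a) = fun s x => (-1) * omega a s x.
  by apply/funext => -[|Y [|? ?]]; apply/funext => y; rewrite /grading_sign /= ?mulr0 ?expr1.
by rewrite (wedgeZl _ (fun=> -1)) (wedgeZr _ (fun=> -1)) mulrA mulrNN !mul1r.
Qed.

(** The derivation acts on each normal argument as the identity and on each
    tangential one as zero. *)
Lemma normal_derivation_homogeneous w s x : ext w -> all homogeneous_arg s ->
  normal_derivation w s x = (count is_normal s)%:R * w s x.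
Proof.
elim: s w => [|Z s IH] w ew /=.
  by move=> _; rewrite mul0r /normal_derivation big1 // => a _; rewrite wedge_nil mul0r.
move=> /andP[/andP[sZ hZ] hs]; rewrite normal_derivation_cons // IH //; last exact: ext_contract.
rewrite /contract; case: (boolP (is_normal Z)) hZ => [/asboolP -> _|_ /= /set_mem[_ EZ]].
  by rewrite natrD mulrDl mul1r.
rewrite add0n ext_normal // big1 ?add0r // => a _.
have [Ux|nUx] := pselect (U x); last by rewrite /conormal memNset // mxE mul0r.
by rewrite ((conormal0P _ Ux).2 (EZ x Ux)) mxE mul0r.
Qed.

(** The composite of the operators 1 - D / j for j = 1, .., k, where D is
    [normal_derivation]. The factor 1 - D / j kills the values with exactly j
    normal arguments. *)
Fixpoint correction (k : nat) w : form G :=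
  if k is k'.+1 then
    let v := correction k' w in
    fun s x => v s x + \sum_a wedge (omega a) (fun s x => (- k'.+1%:R^-1) * contract (T a) v s x) s x
  else w.

Lemma ext_sum (r : seq 'I_p) (w : 'I_p -> form G) : (forall a, ext (w a)) ->
  ext (fun s x => \sum_(a <- r) w a s x).
Proof.
move=> ew; elim: r => [|a r IH].
  have -> : (fun s x => \sum_(a <- [::]) w a s x) = (fun _ _ => 0) :> form G.
    by apply/funext => s; apply/funext => x; rewrite big_nil.
  exact: ext0.
have -> : (fun s x => \sum_(b <- a :: r) w b s x) =
    (fun s x => w a s x + \sum_(b <- r) w b s x) :> form G.
  by apply/funext => s; apply/funext => x; rewrite big_cons.
exact: ext_add.
Qed.

Lemma ext_correction k w : ext w -> ext (correction k w).
Proof.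
move=> ew; elim: k => [//|k IH] /=; apply: ext_add => //; apply: ext_sum => a.
apply: ext_wedge => //; first exact: omega_ext.
by apply: (ext_scale oU (fun=> _)); exact: ext_contract.
Qed.

(** For the empty tuple of sections the condition says that the component of
    degree 0 is zero, as it should be for elements of the ideal. *)
Definition vanishing_forms : set (form G) :=
  [set w | ext w /\ forall s, all (fun Z => Z \in sub_sections E U) s -> w s = fun=> 0].

(** A form that vanishes on sections of [E] has no value without normal
    argument, and the successive factors remove the values with 1, .., k of
    them. *)
Lemma correction_vanish k w s : vanishing_forms w -> all homogeneous_arg s ->
  (count is_normal s <= k)%N -> correction k w s = fun=> 0.
Proof.
move=> [ew w0]; elim: k s => [|k IH] s hs ck /=.
  apply: w0; move: ck; rewrite leqNgt -has_count -all_predC => ck; move: hs ck.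
  elim: s => [//|Z s IHs] /= /andP[/andP[_ hZ] hs] /andP[nZ ns].
  by rewrite IHs // andbT; move: hZ; rewrite (negbTE nZ).
apply/funext => x; have ev := ext_correction k ew.
have -> : \sum_a wedge (omega a) (fun s x => - k.+1%:R^-1 * contract (T a) (correction k w) s x) s x
   = - k.+1%:R^-1 * normal_derivation (correction k w) s x.
  rewrite /normal_derivation mulr_sumr; apply: eq_bigr => a _.
  exact: (wedgeZr _ (fun=> _)).
rewrite normal_derivation_homogeneous //.
move: ck; rewrite leq_eqVlt => /orP[/eqP ->|]; last first.
  by rewrite ltnS => /IH ->; rewrite // !mulr0 addr0.
by rewrite mulrA mulNr mulVf ?pnatr_eq0 // mulN1r subrr.
Qed.

(** Forms vanish on more than p arguments, so at most p arguments are
    normal. *)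
Lemma correction_eq0 w : vanishing_forms w -> correction p w = fun _ _ => 0.
Proof.
move=> vw; have ew := vw.1; apply: ext_homogeneous0; first exact: ext_correction.
move=> s hs; have [sp|sp] := leqP (size s) p; last exact: (ext_degree (ext_correction p ew)).
by apply: correction_vanish => //; exact: leq_trans (count_size _ _) sp.
Qed.

Lemma ideal_sum (I : set (form G)) (r : seq 'I_p) (w : 'I_p -> form G) : ext_ideal U I ->
  (forall a, I (w a)) -> I (fun s x => \sum_(a <- r) w a s x).
Proof.
move=> [_ I0 ID _] Iw; elim: r => [|a r IH].
  have -> : (fun s x => \sum_(a <- [::]) w a s x) = (fun _ _ => 0) :> form G.
    by apply/funext => s; apply/funext => x; rewrite big_nil.
  exact: I0.
have -> : (fun s x => \sum_(b <- a :: r) w b s x) =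
    (fun s x => w a s x + \sum_(b <- r) w b s x) :> form G.
  by apply/funext => s; apply/funext => x; rewrite big_cons.
exact: ID.
Qed.

(** The operator 1 - D / j is the identity modulo the ideal. *)
Lemma correction_ideal (I : set (form G)) k w : ext_ideal U I ->
  annihilator E U `<=` I -> ext w -> I (correction k w) -> I w.
Proof.
move=> iI AI ew; elim: k => [//|k IH] /= H; apply: IH.
have ev := ext_correction k ew; set v := correction k w in ev H *.
have [_ _ ID IM] := iI.
have -> : v = fun s x => (v s x + \sum_a wedge (omega a) (fun s x => - k.+1%:R^-1 * contract (T a) v s x) s x)
   + \sum_a wedge (omega a) (fun s x => k.+1%:R^-1 * contract (T a) v s x) s x.
  apply/funext => s; apply/funext => x; rewrite -addrA -big_split big1 ?addr0 // => a _ /=.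
  by rewrite (wedgeZr _ (fun=> _)) (wedgeZr _ (fun=> k.+1%:R^-1)) mulNr addNr.
apply: ID => //; apply: ideal_sum => // a; apply: (IM _ _ _ _).2.
  by apply: (ext_scale oU (fun=> _)); exact: ext_contract.
by apply: AI; exact: omega_annihilator.
Qed.

Lemma vanishing_ideal : ext_ideal U vanishing_forms.
Proof.
split.
- by move=> w [].
- by split=> //; exact: ext0.
- move=> w v [ew w0] [ev v0]; split; first exact: ext_add.
  by move=> s hs; rewrite w0 // v0 //; apply/funext => x; rewrite addr0.
- move=> w v ew [ev v0]; split; split; try exact: ext_wedge.
    move=> s hs; apply/funext => x.
    by case: (wedge_vanish w x hs v0).
  move=> s hs; apply/funext => x.
  by case: (wedge_vanish w x hs v0).
Qed.

Lemma annihilator_vanishing : annihilator E U `<=` vanishing_forms.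
Proof.
move=> w [[ew hw] w0]; split=> // -[|S [|? ?]] hs; try exact: hw.
by apply: w0; apply: set_mem; move: hs; rewrite /= andbT.
Qed.

(** One inclusion holds since vanishing on [E] defines an ideal that contains
    the annihilator. For the other, a form that vanishes on [E] is congruent
    modulo the ideal to its image by [correction p], which is zero. *)
Theorem ideal_generatedE : ideal_generated U (annihilator E U) = vanishing_forms.
Proof.
apply/seteqP; split=> w.
  by apply; [exact: vanishing_ideal|exact: annihilator_vanishing].
move=> vw I iI AI; apply: (correction_ideal (k := p) iI AI vw.1).
by rewrite correction_eq0 //; case: iI.
Qed.

End ideal_of_annihilator.

(** * Involutivity *)

Section involutivity.
Variables (R : realType) (m n p : nat) (M : manifold R m) (N : manifold R n).
Variables (F : vbundle N p) (G : gla M F).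
Variable E : forall x : M, set (F (gh G x)).
Hypothesis hE : is_IDS setT E.
Implicit Types (U : set M) (Z W S : hsec G) (x : M).

Lemma IDS_fibreZ x a v : E v -> E (a *: v :> F (gh G x)).
Proof.
case: hE => r /(_ x I)[V [e [_ Vx _ _ /(_ x Vx)[_ <-]]]] [u _ <-].
by exists (a *: u) => //; rewrite lcombZ.
Qed.

Lemma IDS_fibre0 x : E (0 : F (gh G x)).
Proof.
case: hE => r /(_ x I)[V [e [_ Vx _ _ /(_ x Vx)[_ <-]]]].
by exists 0 => //; rewrite lcomb0.
Qed.

Definition restrict_sec U Z : hsec G := fun x => if x \in U then Z x else 0.

Lemma restrict_near U Z x : open U -> U x -> \forall y \near x, Z y = restrict_sec U Z y.
Proof.
move=> oU Ux; have : nbhs x U by exact: open_nbhs_nbhs.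
by apply: filterS => y Uy; rewrite /restrict_sec mem_set.
Qed.

Lemma hsec_restrict U V Z : open U -> open V -> U `<=` V ->
  hsections G V Z -> hsections G U (restrict_sec U Z).
Proof.
move=> oU oV UV /mem_set/(hsecP oV)[sZ _]; apply: set_mem; apply/(hsecP oU); split=> x Ux.
  by apply: smooth_sec_near (sZ x (UV x Ux)); exact: restrict_near.
by rewrite /restrict_sec memNset.
Qed.

Lemma IDS_restrict U : open U -> is_IDS U E.
Proof.
move=> oU; case: hE => r H; exists r => x Ux.
have [V [e [oV Vx _ se be]]] := H x I.
exists (V `&` U), (fun i => restrict_sec (V `&` U) (e i)); split.
- exact: openI.
- by [].
- by move=> y [].
- by move=> i; apply: (hsec_restrict (openI oV oU) oV) => [y []|].
- move=> y [Vy Uy]; have -> : (fun i => restrict_sec (V `&` U) (e i) y) = (fun i => e i y).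
    by apply/funext => i; rewrite /restrict_sec mem_set.
  exact: be.
Qed.

(** Involutivity speaks of global sections. Near a given point, sections over
    [U] are restrictions of global sections of [E], by bump functions, and the
    bracket depends only on germs. *)
Lemma involutive_local U S W : open U -> is_involutive E ->
  sub_sections E U S -> sub_sections E U W -> sub_sections E U (hbracket U S W).
Proof.
move=> oU invE [sS ES] [sW EW].
have /(hsecP oU)[sSx _] := mem_set sS; have /(hsecP oU)[sWx _] := mem_set sW.
split; first exact: set_mem (hsec_bracket oU (mem_set sS) (mem_set sW)).
move=> x Ux.
have ext Z : (forall y, U y -> smooth_sec Z y) -> (forall y, U y -> E (Z y)) ->
    exists Z', sub_sections E setT Z' /\ \forall y \near x, Z y = Z' y.
  move=> sZ EZ; have [phi [_ phi1 phi0 sphi]] := section_cutoff (gh_smooth G) oU Ux sZ.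
  exists (fun y => phi y *: Z y); split; last by apply: filterS phi1 => y ->; rewrite scale1r.
  split=> // y _; have [Uy|nUy] := pselect (U y); first exact/IDS_fibreZ/EZ.
  by rewrite phi0 // scale0r; exact: IDS_fibre0.
have [S' [sS' SS']] := ext S sSx ES; have [W' [sW' WW']] := ext W sWx EW.
rewrite (hbracket_ext (U' := setT) Ux I (sSx x Ux) (sWx x Ux) SS' WW').
by have [_] := invE S' W' sS' sW'; exact.
Qed.

Lemma all_del (T : Type) (P : pred T) i (s : seq T) : all P s -> all P (del i s).
Proof.
elim: s i => [//|a s IH] [|i]; first by rewrite del0 => /andP[].
by rewrite delS => /andP[Pa Ps]; rewrite /= Pa IH.
Qed.

(** In the formula for the differential of a form that vanishes on [E],
    evaluated on sections of [E], all terms vanish: those with the anchor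
    contain a value of the form on sections of [E], and so do those with a
    bracket, by involutivity. The IDS required by the definition is [E]
    itself. *)
Lemma involutive_EDS U (T : 'I_p -> hsec G) : open U ->
  (forall a, hsections G U (T a)) ->
  (forall x, U x -> is_basis setT (fun a => T a x)) ->
  is_involutive E -> is_EDS U (ideal_generated U (annihilator E U)).
Proof.
move=> oU sT bT invE; have hU := IDS_restrict oU.
rewrite (ideal_generatedE oU (fun a => mem_set (sT a)) bT hU).
split; last first.
  exists E; split=> // k w _ [_ w0] _ s sk Hs; apply: w0.
  by apply/(all_nthP (fun=> 0)) => i; rewrite sk => ik; apply: mem_set; exact: Hs.
split; first exact: vanishing_ideal.
move=> w [ew w0]; split; first exact: ext_hd.
move=> s hs; apply/funext => x; rewrite /hd; case: ifP => // /andP[a /set_mem Ux].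
rewrite big1 ?add0r => [|i _]; last by rewrite w0 ?rhohat0 ?mulr0 //; exact: all_del.
rewrite big1 // => j _; rewrite big1 // => i _.
have nthE k : (k < size s)%N -> sub_sections E U (nth (fun=> 0) s k).
  by move=> ks; apply: set_mem; move/(all_nthP (fun=> 0)): hs; exact.
have ij : (i < size s)%N by apply: ltn_trans (ltn_ord i) (ltn_ord j).
rewrite w0 ?mulr0 //= all_del ?andbT; last exact: all_del.
by apply: mem_set; apply: involutive_local => //; exact: nthE.
Qed.

(** The differential of [omega a] belongs to the ideal, so it vanishes on [E].
    On two sections of [E] it equals minus the value of [omega a] on their
    bracket, and a vector annihilated by all the [omega a] is in [E]. *)
Lemma EDS_involutive_at U (T : 'I_p -> hsec G) S W x : open U -> U x ->
  (forall a, hsections G U (T a)) ->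
  (forall x, U x -> is_basis setT (fun a => T a x)) ->
  is_EDS U (ideal_generated U (annihilator E U)) ->
  sub_sections E setT S -> sub_sections E setT W -> E (hbracket setT S W x).
Proof.
move=> oU Ux sT bT + [sS ES] [sW EW]; have hU := IDS_restrict oU.
have sT' a := mem_set (sT a).
rewrite (ideal_generatedE oU sT' bT hU) => -[[_ dI] _].
pose S' := restrict_sec U S; pose W' := restrict_sec U W.
have ES' : sub_sections E U S'.
  split; first exact: (hsec_restrict oU openT).
  by move=> y Uy; rewrite /S' /restrict_sec mem_set //; exact: ES.
have EW' : sub_sections E U W'.
  split; first exact: (hsec_restrict oU openT).
  by move=> y Uy; rewrite /W' /restrict_sec mem_set //; exact: EW.
have /(hsecP openT)[sSx _] := mem_set sS; have /(hsecP openT)[sWx _] := mem_set sW.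
rewrite (hbracket_ext (U' := U) I Ux (sSx x I) (sWx x I)
  (restrict_near S oU Ux) (restrict_near W oU Ux)) -/S' -/W'.
apply/(conormal0P oU sT' bT hU _ Ux); apply/rowP => a; rewrite [RHS]mxE.
have Aa := omega_annihilator oU sT' bT hU a.
have [ea _] := annihilator_vanishing Aa; have [_ a0] := Aa.
have [_ d0] := dI _ (annihilator_vanishing Aa).
have := d0 [:: S'; W']; rewrite /= !mem_set // => /(_ isT)/(congr1 (fun k => k x)).
have bS' : S' \in hsections G U by apply: mem_set; case: ES'.
have bW' : W' \in hsections G U by apply: mem_set; case: EW'.
rewrite (hd_recE oU ea) //=; last by rewrite /all_sec /= bS' bW'.
rewrite /contract (a0 _ ES') (a0 _ EW') !rhohat0 /= (hsec_bracket oU bS' bW').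
by rewrite sub0r !subr0 => /eqP; rewrite oppr_eq0 => /eqP.
Qed.

End involutivity.

Theorem corollary5p16 (R : realType) (m n p : nat) (M : manifold R m)
    (N : manifold R n) (F : vbundle N p) (G : gla M F)
    (A : set (chart R m M)) (hA : adapted_charts G A)
    (E : forall x : M, set (F (gh G x))) (hE : is_IDS setT E) :
  is_involutive E <->
  forall c, A c ->
    is_EDS (cdom c) (ideal_generated (cdom c) (annihilator E (cdom c))).
Proof.
case: hA => [_ Acover Aframe]; split=> [invE c Ac|H S W sS sW].
  by have [T [sT bT]] := Aframe c Ac; apply: (involutive_EDS hE _ sT bT) => //; exact: cdom_open.
split; first by apply: set_mem; apply: (hsec_bracket openT); apply: mem_set; [case: sS|case: sW].
move=> x _; have [c Ac cx] := Acover x; have [T [sT bT]] := Aframe c Ac.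
exact: (EDS_involutive_at hE (@cdom_open _ _ _ c) cx sT bT (H c Ac) sS sW).
Qed.
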